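(* Let $\phi=\frac{1+\sqrt5}{2}$, $\ell=\log\phi$ and $\lambda=\log 2$. Then \[ \sum_{n=0}^{\infty} \frac{(-1)^{n}}{(2n+1)^3 \binom{2n}{n}} = -\frac{4 \operatorname{Li}_3\bigl(\phi^{-3}\bigr)}{3}-4 \operatorname{Li}_2 \bigl(\phi^{-3}\bigr) \ell+\operatorname{Li}_3\bigl(\phi^{-1}\bigr)-\frac{25\ell^3}{3} +6 \lambda\ell^2 + \frac{\pi^2 \ell}{10} +\frac{12 \zeta(3)}{5}-\frac{\pi^2 \lambda}{3}, \] and this number lies in $\mathfrak Z_3(10)$.
   Context: $\operatorname{Li}_s(z)=\sum_{n\ge1} z^n/n^s$ for $|z|\le1$, $s\ge2$; $\zeta(3)=\sum_{n\ge1}n^{-3}$. For positive integers $s_1,\dots,s_m$ and complex $z_1,\dots,z_m$, $\operatorname{Li}_{s_1,\dots,s_m}(z_1,\dots,z_m)=\sum_{n_1>\cdots>n_m\ge1} \frac{z_1^{n_1}\cdots z_m^{n_m}}{n_1^{s_1}\cdots n_m^{s_m}}$ (when convergent). For positive integers $k,N$, $\mathfrak Z_k(N)$ is the $\mathbb Q$-linear span of all $\operatorname{Li}_{s_1,\dots,s_m}(z_1,\dots,z_m)$ with $s_j\in\mathbb Z_{>0}$, $\sum_j s_j=k$, $z_j^N=1$ for all $j$, and $(s_1,z_1)\neq(1,1)$. *)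

(* Defs.v *)
From Stdlib Require Import Reals QArith Qreals List.
From Coquelicot Require Import Coquelicot.
Open Scope R_scope.

Definition Li (s : nat) (x : R) : R :=
  Series (fun n => x ^ (S n) / (INR (S n)) ^ s).

Definition zeta3 : R := Series (fun n => / (INR (S n)) ^ 3).

(* Truncated multiple polylogarithm: for l = [(s1,z1);...;(sm,zm)],
   mpl_part l M = sum over M >= n1 > n2 > ... > nm >= 1 of
                  z1^n1 ... zm^nm / (n1^s1 ... nm^sm). *)
Fixpoint mpl_part (l : list (nat * C)) (M : nat) : C :=
  match l with
  | nil => 1%C
  | (s, z) :: r =>
      (fix inner (M : nat) : C :=
         match M with
         | O => 0%C
         | S M' => (inner M' + (z ^ (S M')) / (RtoC (INR (S M')) ^ s) * mpl_part r M')%C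
         end) M
  end.

Definition mpl_converges_to (l : list (nat * C)) (v : C) : Prop :=
  filterlim (mpl_part l) eventually (locally v).

Definition admissible (k N : nat) (l : list (nat * C)) : Prop :=
  l <> nil /\
  List.Forall (fun p => (1 <= fst p)%nat /\ (snd p ^ N)%C = 1%C) l /\
  fold_right (fun p acc => (fst p + acc)%nat) 0%nat l = k /\
  (forall s z r, l = (s, z) :: r -> ~ (s = 1%nat /\ z = 1%C)).

Definition in_frakZ (k N : nat) (x : C) : Prop :=
  exists terms : list (Q * list (nat * C) * C),
    List.Forall (fun t => let '(_, l, v) := t in admissible k N l /\ mpl_converges_to l v) terms /\
    x = fold_right (fun t acc => let '(q, _, v) := t in (RtoC (Q2R q) * v + acc)%C) 0%C terms.

Definition phi : R := (1 + sqrt 5) / 2.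
Definition ell : R := ln phi.
Definition lam : R := ln 2.

Definition lhs_term (n : nat) : R :=
  (-1) ^ n / ((INR (2 * n + 1)) ^ 3 * Binomial.C (2 * n) n).

Definition rhs_value : R :=
  - 4 * Li 3 (/ phi ^ 3) / 3 - 4 * Li 2 (/ phi ^ 3) * ell + Li 3 (/ phi)
  - 25 * ell ^ 3 / 3 + 6 * lam * ell ^ 2 + PI ^ 2 * ell / 10
  + 12 * zeta3 / 5 - PI ^ 2 * lam / 3.

(* Main.v *)
(* Put v = tanh(t/2) and y = 2 sinh t = 4v/(1 - v^2).  The power series
   sum (-1)^n y^(2n+1) / ((2n+1)^3 C(2n,n)) is then a combination of trilogarithms of v, -v,
   -v/(1-v) and v/(1+v), and y = 1 corresponds to v = phi^-3.  At this point all arguments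
   are, up to sign, products of powers of 2 and phi, and so are their complements to 1.  The
   three-term relation and two one-variable specializations of Kummer's trilogarithm equation
   (second variable -1 and 1/2) leave only Li_3(phi^-3), Li_3(phi^-1) and zeta(3).

   For the second assertion let e = exp(i pi/5) and parametrize v = c (1 - z)/(1 + z) with
   c = (e^2 - 1)/(e^2 + 1) = i tan(pi/5), so that v(1) = 0 and v(e) = phi^-3.  As functions of z,
   the logarithmic derivatives needed to integrate the series are combinations of
   a dz/(1 - a z) with a^10 = 1.  Along the segments [0,1] and [0,e] the series is therefore a
   combination of iterated integrals, whose values at the end points are, by Abel's theorem,
   multiple polylogarithms at 10th roots of unity.  On [0,1] the series vanishes at z = 1, which
   determines the constants at z = 0 after removal of logarithmic divergences; on [0,e] it
   takes at z = e the value to be computed.  Products of constants stay in the spaces by the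
   quasi-shuffle product of truncated sums. *)

Require Import Defs.
From Stdlib Require Import Reals QArith Qreals List.
From Coquelicot Require Import Coquelicot.
From Stdlib Require Import Lra Lia.
Open Scope R_scope.

(** The map from v to z is chosen so that five points go to tenth roots of unity. In v the
    logarithmic forms have poles at 0, infinity, 1 and -1, and the value sought is taken at phi^-3;
    these points become z = 1, -1, e^3, -e^2 and e. The price is the base point: the iterated
    integrals start at z = 0, where y^2 = -(phi + 2) and the series is not known. Hence two segments
    with a common origin: the one ending at the zero of y fixes three constants of integration, the
    other leads to y = 1. Since phi + 2 < 4 the origin lies in the disk of convergence in y^2, and
    both segments have to be shown to stay there. All complex functions are functions of the real
    parameter of a segment, and the root Q of 1 + y^2/4 is carried along as a rational function of
    z, so that no branch is chosen. For the closed form, the derivative of each trilogarithm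
    relation splits by partial fractions into dilogarithm relations, which are proved beforehand.
    Boundary values come from continuity, because arguments reach 0, 1 or -1 there. *)

(** * Elementary convergence facts *)

Lemma INR_S_ge1 (n : nat) : 1 <= INR (S n).
Proof. rewrite S_INR; generalize (pos_INR n); lra. Qed.

Lemma pow_INR_ge1 (n s : nat) : 1 <= INR (S n) ^ s.
Proof. apply pow_R1_Rle, INR_S_ge1. Qed.

Lemma CV_radius_bounded_coef (a : nat -> R) (r M x : R) :
  (forall n, Rabs (a n * r ^ n) <= M) -> Rabs x < r -> Rbar_lt (Rabs x) (CV_radius a).
Proof.
  intros H Hx.
  apply Rbar_lt_le_trans with (Finite r); [exact Hx|].
  apply (proj1 (CV_radius_bounded a)); exists M; exact H.
Qed.

Lemma ex_series_dominated (a b : nat -> R) :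
  (forall n, Rabs (a n) <= b n) -> ex_series b -> ex_series a.
Proof. exact (ex_series_le (K := R_AbsRing) (V := R_CompleteNormedModule) a b). Qed.

Lemma is_series_telescope (u : nat -> R) (l : R) :
  is_lim_seq u l -> is_series (fun n => u n - u (S n)) (u 0%nat - l).
Proof.
  intros Hu; unfold is_series.
  apply (filterlim_ext (fun n => u 0%nat - u (S n))).
  { induction x as [|n IH]; [now rewrite sum_O|].
    rewrite sum_Sn, <- IH; unfold plus; simpl; ring. }
  apply (is_lim_seq_minus' (fun _ => u 0%nat) (fun n => u (S n)));
    [apply is_lim_seq_const | now apply (is_lim_seq_incr_1 u)].
Qed.

Lemma is_lim_seq_inv_sqrt : is_lim_seq (fun n => / sqrt (INR (S n))) 0.
Proof.
  apply (is_lim_seq_inv (fun n => sqrt (INR (S n))) p_infty); [|discriminate].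
  apply (filterlim_comp _ _ _ (fun n => INR (S n)) sqrt _ (Rbar_locally p_infty));
    [|exact filterlim_sqrt_p].
  apply (is_lim_seq_incr_1 INR), is_lim_seq_INR.
Qed.

(** The term m^(-3/2) is at most 2 (1/sqrt (m-1) - 1/sqrt m), which telescopes; the shift by one
    keeps m - 1 positive. This majorant serves both the Hoelder bound on polylogarithms and the
    convergence of multiple polylogarithms. *)
Lemma ex_series_sqrt : ex_series (fun n => sqrt (INR (S n)) / INR (S n) ^ 2).
Proof.
  apply (ex_series_incr_1 (fun n => sqrt (INR (S n)) / INR (S n) ^ 2)).
  apply (ex_series_dominated _ (fun n => 2 * (/ sqrt (INR (S n)) - / sqrt (INR (S (S n)))))).
  2:{ apply (ex_series_scal (V := R_NormedModule) 2).
      eexists; apply (is_series_telescope _ _ is_lim_seq_inv_sqrt). }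
  intros n;
  set (b := sqrt (INR (S (S n)))); set (a := sqrt (INR (S n))).
  assert (Ha2 : a * a = INR (S n)) by (apply sqrt_sqrt; generalize (INR_S_ge1 n); lra).
  assert (Hb2 : b * b = INR (S (S n))) by (apply sqrt_sqrt; generalize (INR_S_ge1 (S n)); lra).
  assert (Hab : b * b = a * a + 1) by (rewrite Ha2, Hb2, (S_INR (S n)); ring).
  assert (Ha : 0 < a) by (apply sqrt_lt_R0; generalize (INR_S_ge1 n); lra).
  assert (Hb : 0 < b) by (apply sqrt_lt_R0; generalize (INR_S_ge1 (S n)); lra).
  rewrite <- Hb2.
  assert (Hle : a <= b) by nra.
  rewrite Rabs_pos_eq.
  2:{ apply Rmult_le_pos; [lra|]. left; apply Rinv_0_lt_compat, pow_lt; nra. }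
  replace (b / (b * b) ^ 2) with (/ (b * b * b)) by (field; lra).
  replace (2 * (/ a - / b)) with (/ ((a * b * (a + b)) / 2)).
  2:{ assert (b - a = / (a + b)).
      { apply (Rmult_eq_reg_r (a + b)); [|lra]. rewrite Rinv_l by lra. nra. }
      replace (/ a - / b) with ((b - a) / (a * b)) by (field; lra).
      rewrite H; field; lra. }
  apply Rinv_le_contravar.
  - assert (0 < a * b) by nra. nra.
  - assert (a * b <= b * b) by nra. assert (0 < b * b) by nra. nra.
Qed.

Lemma ex_series_inv_sqr : ex_series (fun n => / INR (S n) ^ 2).
Proof.
  apply (ex_series_dominated _ (fun n => sqrt (INR (S n)) / INR (S n) ^ 2)); [|exact ex_series_sqrt].
  intros n;
  assert (0 < / INR (S n) ^ 2) by (apply Rinv_0_lt_compat; generalize (pow_INR_ge1 n 2); lra).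
  rewrite Rabs_pos_eq by lra.
  assert (1 <= sqrt (INR (S n))) by (rewrite <- sqrt_1; apply sqrt_le_1_alt, INR_S_ge1).
  unfold Rdiv; nra.
Qed.

(** * Real polylogarithms *)

(** Li_s(x)/x, the derivative of Li_{s+1}, as a power series so that it makes sense at 0. *)
Definition Li_quot (s : nat) (x : R) : R := PSeries (fun n => / INR (S n) ^ s) x.

Lemma Li_quot_radius (s : nat) (x : R) :
  Rabs x < 1 -> Rbar_lt (Rabs x) (CV_radius (fun n => / INR (S n) ^ s)).
Proof.
  apply (CV_radius_bounded_coef _ 1 1); intros n.
  rewrite pow1, Rmult_1_r, Rabs_pos_eq.
  - rewrite <- Rinv_1; apply Rinv_le_contravar; [lra | apply pow_INR_ge1].
  - left; apply Rinv_0_lt_compat; generalize (pow_INR_ge1 n s); lra.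
Qed.

Lemma Li_eq (s : nat) (x : R) : Li s x = x * Li_quot s x.
Proof.
  unfold Li, Li_quot, PSeries; rewrite <- Series_scal_l.
  apply Series_ext; intros n; simpl; unfold Rdiv; ring.
Qed.

Lemma Li_0 (s : nat) : Li s 0 = 0.
Proof. rewrite Li_eq; ring. Qed.

Lemma is_derive_Li (s : nat) (x : R) :
  Rabs x < 1 -> is_derive (Li (S s)) x (Li_quot s x).
Proof.
  intros Hx.
  apply (is_derive_ext (PSeries (PS_incr_1 (fun n => / INR (S n) ^ (S s))))).
  { intros t; rewrite PSeries_incr_1; symmetry; apply Li_eq. }
  evar_last.
  - apply is_derive_PSeries. rewrite CV_radius_incr_1. now apply Li_quot_radius.
  - apply PSeries_ext; intros n; unfold PS_derive, PS_incr_1.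
    cbn -[INR]. field. split; [apply pow_nonzero|]; generalize (INR_S_ge1 n); lra.
Qed.

Lemma Li1_eq (x : R) : Rabs x < 1 -> Li 1 x = - ln (1 - x).
Proof.
  intros Hx; apply Rabs_def2 in Hx.
  assert (E : Li 1 x + ln (1 - x) = Li 1 0 + ln (1 - 0)).
  { destruct (Req_dec x 0) as [->|Hn]; [reflexivity|].
    destruct (MVT_gen (fun t => Li 1 t + ln (1 - t)) 0 x (fun _ => 0)) as [c [_ Hc]].
    - intros t Ht.
      assert (Ht1 : Rabs t < 1).
      { apply Rabs_def1; unfold Rmin, Rmax in Ht; destruct (Rle_dec 0 x); lra. }
      replace 0 with (Li_quot 0 t + - / (1 - t)).
      + apply (is_derive_plus (Li 1)); [now apply is_derive_Li|].
        apply Rabs_def2 in Ht1; auto_derive; [lra|]. field; lra.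
      + unfold Li_quot, PSeries.
        rewrite (Series_ext _ (fun k => t ^ k)) by (intros n; simpl; field).
        rewrite Series_geom by assumption. apply Rabs_def2 in Ht1. field; lra.
    - intros t Ht. apply continuity_pt_filterlim.
      assert (Ht1 : Rabs t < 1).
      { apply Rabs_def1; unfold Rmin, Rmax in Ht; destruct (Rle_dec 0 x); lra. }
      apply (continuous_plus (Li 1) (fun t => ln (1 - t))); apply ex_derive_continuous.
      + eexists; now apply is_derive_Li.
      + apply Rabs_def2 in Ht1; auto_derive; lra.
    - lra. }
  rewrite Li_0, Rminus_0_r, ln_1 in E; lra.
Qed.

Lemma Rabs_pow_minus_le (n : nat) (x y : R) :
  Rabs x <= 1 -> Rabs y <= 1 -> Rabs (x ^ n - y ^ n) <= INR n * Rabs (x - y).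
Proof.
  intros Hx Hy; induction n as [|n IH].
  - simpl; rewrite Rminus_diag, Rabs_R0; lra.
  - replace (x ^ S n - y ^ S n) with (x * (x ^ n - y ^ n) + (x - y) * y ^ n) by (simpl; ring).
    eapply Rle_trans; [apply Rabs_triang|]. rewrite !Rabs_mult, S_INR.
    assert (Rabs (y ^ n) <= 1).
    { rewrite <- RPow_abs, <- (pow1 n). apply pow_incr; split; [apply Rabs_pos | assumption]. }
    generalize (Rabs_pos (x - y)) (Rabs_pos x) (Rabs_pos (x ^ n - y ^ n)); nra.
Qed.

Lemma Rabs_pow_le1 (n : nat) (x : R) : Rabs x <= 1 -> Rabs (x ^ n) <= 1.
Proof.
  intros Hx; rewrite <- RPow_abs, <- (pow1 n).
  apply pow_incr; split; [apply Rabs_pos | assumption].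
Qed.

Lemma ex_series_Li (s : nat) (x : R) :
  Rabs x <= 1 -> ex_series (fun n => x ^ S n / INR (S n) ^ S (S s)).
Proof.
  intros Hx; apply (ex_series_dominated _ (fun n => / INR (S n) ^ 2)); [|exact ex_series_inv_sqr].
  intros n;
  unfold Rdiv; rewrite Rabs_mult.
  generalize (pow_INR_ge1 n 2) (pow_INR_ge1 n (S (S s))); intros H2 Hs.
  assert (E : / INR (S n) ^ S (S s) <= / INR (S n) ^ 2).
  { apply Rinv_le_contravar; [lra|]. apply Rle_pow; [apply INR_S_ge1 | lia]. }
  rewrite (Rabs_pos_eq (/ _)) by (left; apply Rinv_0_lt_compat; lra).
  generalize (Rabs_pow_le1 (S n) x Hx) (Rabs_pos (x ^ S n)); intros.
  assert (0 < / INR (S n) ^ S (S s)) by (apply Rinv_0_lt_compat; lra). nra.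
Qed.

(* [|x^n - y^n|] is at most both [2] and [n |x - y|], hence at most [sqrt (2 n |x - y|)]. *)
Lemma Li_holder (s : nat) : exists M, 0 <= M /\ forall x y, Rabs x <= 1 -> Rabs y <= 1 ->
  Rabs (Li (S (S s)) x - Li (S (S s)) y) <= M * sqrt (Rabs (x - y)).
Proof.
  pose (c := fun n : nat => sqrt (INR (S n)) / INR (S n) ^ 2).
  assert (Hc : forall n, 0 <= c n).
  { intros n; unfold c; apply Rmult_le_pos; [apply sqrt_pos|].
    left; apply Rinv_0_lt_compat; generalize (pow_INR_ge1 n 2); lra. }
  exists (sqrt 2 * Series c); split.
  { apply Rmult_le_pos; [apply sqrt_pos|].
    eapply Rle_trans; [apply (Rabs_pos (Series c))|]. eapply Rle_trans; [apply Series_Rabs|].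
    - apply (ex_series_ext c); [|exact ex_series_sqrt].
      intros n; symmetry; apply Rabs_pos_eq, Hc.
    - right; apply Series_ext; intros n; apply Rabs_pos_eq, Hc. }
  intros x y Hx Hy; unfold Li.
  rewrite <- Series_minus by (apply ex_series_Li; assumption).
  set (d := sqrt (Rabs (x - y))).
  assert (B : forall n, Rabs (x ^ S n / INR (S n) ^ S (S s) - y ^ S n / INR (S n) ^ S (S s))
                        <= sqrt 2 * d * c n).
  { intros n; unfold c.
    generalize (pow_INR_ge1 n 2) (pow_INR_ge1 n (S (S s))); intros H2 Hs.
    assert (E : / INR (S n) ^ S (S s) <= / INR (S n) ^ 2).
    { apply Rinv_le_contravar; [lra|]. apply Rle_pow; [apply INR_S_ge1 | lia]. }
    replace (x ^ S n / INR (S n) ^ S (S s) - y ^ S n / INR (S n) ^ S (S s))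
      with ((x ^ S n - y ^ S n) * / INR (S n) ^ S (S s)) by (unfold Rdiv; ring).
    rewrite Rabs_mult.
    rewrite (Rabs_pos_eq (/ _)) by (left; apply Rinv_0_lt_compat; lra).
    assert (G : Rabs (x ^ S n - y ^ S n) <= sqrt 2 * d * sqrt (INR (S n))).
    { unfold d; rewrite <- !sqrt_mult_alt by (try lra; apply Rmult_le_pos; try lra; apply Rabs_pos).
      rewrite <- (sqrt_Rsqr (Rabs (x ^ S n - y ^ S n))) by apply Rabs_pos.
      apply sqrt_le_1_alt; unfold Rsqr.
      generalize (Rabs_pow_minus_le (S n) x y Hx Hy) (Rabs_pos (x ^ S n - y ^ S n)); intros G1 G2.
      assert (Rabs (x ^ S n - y ^ S n) <= 2).
      { unfold Rminus; eapply Rle_trans; [apply Rabs_triang|]. rewrite Rabs_Ropp.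
        generalize (Rabs_pow_le1 (S n) x Hx) (Rabs_pow_le1 (S n) y Hy); lra. }
      nra. }
    assert (0 < / INR (S n) ^ S (S s)) by (apply Rinv_0_lt_compat; lra).
    generalize (Rabs_pos (x ^ S n - y ^ S n)); unfold Rdiv; rewrite <- Rmult_assoc; intros.
    apply Rmult_le_compat; lra. }
  assert (ES : ex_series (fun n => sqrt 2 * d * c n))
    by (apply (ex_series_scal (V := R_NormedModule)), ex_series_sqrt).
  replace (sqrt 2 * Series c * d) with (sqrt 2 * d * Series c) by ring.
  rewrite <- Series_scal_l.
  eapply Rle_trans; [apply Series_Rabs|].
  - eapply ex_series_dominated; [|exact ES]. intros n;
    rewrite Rabs_Rabsolu; apply B.
  - apply Series_le; [|exact ES]. intros n; split; [apply Rabs_pos | apply B].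
Qed.

Definition clamp (x : R) : R := Rmax (-1) (Rmin 1 x).

(* [Li s x] is a junk value for [|x| > 1]; precomposing with [clamp] makes it continuous
   on the whole line, in particular two-sided at the endpoints. *)
Definition Lic (s : nat) (x : R) : R := Li s (clamp x).

Lemma clamp_bound (x : R) : Rabs (clamp x) <= 1.
Proof.
  apply Rabs_le; unfold clamp, Rmax, Rmin.
  destruct (Rle_dec 1 x); destruct (Rle_dec _ _); lra.
Qed.

Lemma clamp_id (x : R) : -1 <= x <= 1 -> clamp x = x.
Proof.
  intros H; unfold clamp, Rmax, Rmin.
  destruct (Rle_dec 1 x); destruct (Rle_dec _ _); lra.
Qed.

Lemma clamp_lipschitz (x y : R) : Rabs (clamp x - clamp y) <= Rabs (x - y).
Proof.
  unfold clamp, Rmax, Rmin, Rabs.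
  destruct (Rle_dec 1 x), (Rle_dec 1 y); repeat destruct (Rle_dec _ _);
    repeat destruct (Rcase_abs _); lra.
Qed.

Lemma Lic_id (s : nat) (x : R) : -1 <= x <= 1 -> Lic s x = Li s x.
Proof. intros H; unfold Lic; now rewrite clamp_id. Qed.

Lemma continuous_Lic (s : nat) (x : R) : continuous (Lic (S (S s))) x.
Proof.
  destruct (Li_holder s) as [M [HM H]].
  intros P [eps HP]; unfold filtermap.
  pose (d := (eps / (M + 1)) ^ 2).
  assert (He : 0 < eps / (M + 1)) by (apply Rdiv_lt_0_compat; [apply cond_pos | lra]).
  assert (Hd : 0 < d) by (unfold d; nra).
  exists (mkposreal d Hd); intros y Hy; apply HP.
  unfold ball in *; simpl in *; unfold AbsRing_ball, abs, minus, plus, opp in *; simpl in *.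
  fold (Rminus (Lic (S (S s)) y) (Lic (S (S s)) x)); fold (Rminus y x) in Hy.
  unfold Lic; eapply Rle_lt_trans; [apply H; apply clamp_bound|].
  assert (sqrt (Rabs (clamp y - clamp x)) < eps / (M + 1)).
  { rewrite <- (sqrt_pow2 (eps / (M + 1))) by lra.
    apply sqrt_lt_1_alt; split; [apply Rabs_pos|].
    eapply Rle_lt_trans; [apply clamp_lipschitz|]. exact Hy. }
  generalize (sqrt_pos (Rabs (clamp y - clamp x))); intros.
  apply Rle_lt_trans with (M * (eps / (M + 1))); [nra|].
  unfold Rdiv; assert (0 < / (M + 1)) by (apply Rinv_0_lt_compat; lra).
  assert (eps = (M + 1) * (eps * / (M + 1)) :> R) by (field; lra).
  unfold Rdiv in He; lra.
Qed.

Definition dilog : R -> R := Lic 2.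
Definition trilog : R -> R := Lic 3.

Lemma Lic_eq_locally (s : nat) (x : R) : -1 < x < 1 -> locally x (fun t => Li s t = Lic s t).
Proof.
  intros Hx.
  apply (filter_imp (fun t => -1 < t /\ t < 1)).
  { intros t Ht; symmetry; apply Lic_id; lra. }
  apply filter_and; [apply open_gt | apply open_lt]; lra.
Qed.

Lemma is_derive_dilog (x : R) : -1 < x < 1 /\ x <> 0 -> is_derive dilog x (- ln (1 - x) / x).
Proof.
  intros [Hx H0].
  apply (is_derive_ext_loc (Li 2)); [now apply (Lic_eq_locally 2)|].
  evar_last; [apply is_derive_Li, Rabs_def1; lra|].
  rewrite <- Li1_eq, Li_eq by (apply Rabs_def1; lra). now field.
Qed.

Lemma is_derive_trilog (x : R) : -1 < x < 1 /\ x <> 0 -> is_derive trilog x (dilog x / x).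
Proof.
  intros [Hx H0].
  apply (is_derive_ext_loc (Li 3)); [now apply (Lic_eq_locally 3)|].
  evar_last; [apply is_derive_Li, Rabs_def1; lra|].
  unfold dilog; rewrite Lic_id, (Li_eq 2) by lra. now field.
Qed.

(** Makes both functions known to [auto_derive], whose side conditions then place each argument in
    (-1, 1) away from 0. *)
Instance UnaryDiff_dilog : UnaryDiff' dilog := Build_UnaryDiff' dilog _ _ is_derive_dilog.
Instance UnaryDiff_trilog : UnaryDiff' trilog := Build_UnaryDiff' trilog _ _ is_derive_trilog.

(** The derivative is required only inside the interval: at the ends, arguments of polylogarithms
    reach 0, 1 or -1, where only continuity is available. *)
Lemma eq_of_derive_0 (f : R -> R) (a b : R) : a < b ->
  (forall t, a < t < b -> is_derive f t 0) ->
  (forall t, a <= t <= b -> continuous f t) -> f b = f a.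
Proof.
  intros Hab Hd Hc.
  destruct (MVT_gen f a b (fun _ => 0)) as [c [_ E]]; [| |lra].
  - intros t; rewrite Rmin_left, Rmax_right by lra; apply Hd.
  - intros t; rewrite Rmin_left, Rmax_right by lra; intros Ht.
    apply continuity_pt_filterlim, Hc, Ht.
Qed.

Ltac cont :=
  match goal with
  | |- continuous (fun t => dilog _) _ =>
      apply (continuous_comp _ dilog); [cont | apply (continuous_Lic 0)]
  | |- continuous (fun t => trilog _) _ =>
      apply (continuous_comp _ trilog); [cont | apply (continuous_Lic 1)]
  | |- continuous (fun t => _ + _) _ => apply (continuous_plus (V := R_NormedModule)); cont
  | |- continuous (fun t => _ - _) _ => apply (continuous_minus (V := R_NormedModule)); cont
  | |- continuous (fun t => - _) _ => apply (continuous_opp (V := R_NormedModule)); cont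
  | |- continuous (fun t => _ * _) _ => apply (continuous_mult (K := R_AbsRing)); cont
  | |- continuous dilog _ => apply (continuous_Lic 0)
  | |- continuous trilog _ => apply (continuous_Lic 1)
  | |- continuous _ _ =>
      apply (ex_derive_continuous (V := R_NormedModule)); auto_derive; try exact I
  end.

(** The output of [auto_derive] is folded back into differences and quotients, so that the arguments
    of its logarithms match later rewriting. *)
Ltac derive_0 :=
  auto_derive;
  repeat match goal with
  | |- context [?a + - ?b] => change (a + - b) with (a - b)
  | |- context [?a * / ?b] => change (a * / b) with (a / b)
  end.

(** * Functional equations of the dilogarithm and the trilogarithm *)

Lemma dilog_0 : dilog 0 = 0.
Proof. unfold dilog; rewrite Lic_id by lra; apply Li_0. Qed.

Lemma trilog_0 : trilog 0 = 0.
Proof. unfold trilog; rewrite Lic_id by lra; apply Li_0. Qed.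

Lemma dilog_sqr (x : R) : 0 <= x <= 1 -> dilog (x * x) = 2 * (dilog x + dilog (- x)).
Proof.
  intros Hx; destruct (Req_dec x 0) as [->|H0]; [rewrite Rmult_0_l, Ropp_0, dilog_0; ring|].
  enough (dilog (x * x) - 2 * (dilog x + dilog (- x)) =
          dilog (0 * 0) - 2 * (dilog 0 + dilog (- 0))) as E
    by (rewrite Rmult_0_l, Ropp_0, dilog_0 in E; lra).
  apply (eq_of_derive_0 (fun t => dilog (t * t) - 2 * (dilog t + dilog (- t))) 0 x); [lra| |].
  - intros t Ht; derive_0; [repeat split; nra|].
    replace (1 - t * t) with ((1 - t) * (1 - - t)) by ring.
    rewrite ln_mult by lra. field; lra.
  - intros t Ht; cont.
Qed.

Lemma trilog_sqr (x : R) : 0 <= x <= 1 -> trilog (x * x) = 4 * (trilog x + trilog (- x)).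
Proof.
  intros Hx; destruct (Req_dec x 0) as [->|H0]; [rewrite Rmult_0_l, Ropp_0, trilog_0; ring|].
  enough (trilog (x * x) - 4 * (trilog x + trilog (- x)) =
          trilog (0 * 0) - 4 * (trilog 0 + trilog (- 0))) as E
    by (rewrite Rmult_0_l, Ropp_0, trilog_0 in E; lra).
  apply (eq_of_derive_0 (fun t => trilog (t * t) - 4 * (trilog t + trilog (- t))) 0 x); [lra| |].
  - intros t Ht; derive_0; [repeat split; nra|].
    rewrite dilog_sqr by lra. field; lra.
  - intros t Ht; cont.
Qed.

(** Landen's identity. The bound 1/2 keeps -x/(1-x) in [-1, 0], where the series converges. *)
Lemma dilog_landen (x : R) : 0 <= x <= 1 / 2 ->
  dilog x + dilog (- x / (1 - x)) = - ln (1 - x) ^ 2 / 2.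
Proof.
  intros Hx; destruct (Req_dec x 0) as [->|H0].
  { replace (- 0 / (1 - 0)) with 0 by field. rewrite dilog_0, Rminus_0_r, ln_1; field. }
  pose (f := fun t => dilog t + dilog (- t / (1 - t)) + ln (1 - t) ^ 2 / 2).
  enough (f x = f 0) as E.
  { unfold f in E; replace (- 0 / (1 - 0)) with 0 in E by field.
    rewrite dilog_0, Rminus_0_r, ln_1 in E; lra. }
  apply eq_of_derive_0; [lra| |]; unfold f; intros t Ht.
  - assert (Hq : - 1 < - t / (1 - t) < 0).
    { split; [apply Rlt_div_r; lra | apply Rlt_div_l; lra]. }
    derive_0; [repeat split; lra|].
    replace (1 - - t / (1 - t)) with (/ (1 - t)) by (field; lra).
    rewrite ln_Rinv by lra. field; lra.
  - cont; lra.
Qed.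

(** With r = sqrt x one has x ln x = 2 r^2 ln r, and ln r >= -1/r. The bound controls a logarithm
    against a zero, here at 0 and later in the regularization at t = 1. *)
Lemma Rabs_mul_ln_le (x : R) : 0 <= x <= 1 -> Rabs (x * ln x) <= 2 * sqrt x.
Proof.
  intros [[Hx|<-] Hx1]; [|rewrite Rmult_0_l, Rabs_R0, sqrt_0; lra].
  set (r := sqrt x); assert (Hr : 0 < r) by now apply sqrt_lt_R0.
  assert (Hr2 : r * r = x) by (apply sqrt_sqrt; lra).
  assert (E : ln x = 2 * ln r) by (rewrite <- Hr2, ln_mult by assumption; ring).
  assert (G : - / r <= ln r).
  { generalize (exp_ineq1_le (ln (/ r))); rewrite exp_ln by now apply Rinv_0_lt_compat.
    rewrite ln_Rinv by assumption; lra. }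
  assert (ln x <= 0) by (rewrite <- ln_1; apply ln_le; lra).
  rewrite Rabs_mult, Rabs_pos_eq, Rabs_left1 by lra.
  assert (r * / r = 1) by (field; lra). nra.
Qed.

(* Stdlib sets [ln x = 0] for [x <= 0], so [ln t * ln (1 - t)] is continuous across [0]. *)
Lemma continuous_ln_mul_ln : continuous (fun t => ln t * ln (1 - t)) 0.
Proof.
  apply continuity_pt_filterlim. intros eps Heps.
  exists (Rmin (1 / 2) ((eps / 8) ^ 2)); split.
  { apply Rmin_glb_lt; [lra | apply pow_lt; lra]. }
  intros t [_ Ht]; simpl in *; unfold Rdist in *; rewrite Rminus_0_r in Ht.
  rewrite Rminus_0_r, ln_1, Rmult_0_r, Rminus_0_r.
  assert (H1 : Rabs t < 1 / 2) by (eapply Rlt_le_trans; [exact Ht | apply Rmin_l]).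
  assert (H2 : Rabs t < (eps / 8) ^ 2) by (eapply Rlt_le_trans; [exact Ht | apply Rmin_r]).
  destruct (Rle_or_lt t 0) as [Hn|Hp].
  { replace (ln t) with 0; [rewrite Rmult_0_l, Rabs_R0; lra|].
    unfold ln; destruct (Rlt_dec 0 t); [exfalso; lra | reflexivity]. }
  rewrite Rabs_pos_eq in H1, H2 by lra.
  assert (G : sqrt t < eps / 8).
  { rewrite <- (sqrt_pow2 (eps / 8)) by lra. apply sqrt_lt_1_alt; lra. }
  generalize (Rabs_mul_ln_le t ltac:(lra)); intros G2.
  assert (A1 : ln (1 - t) <= 0) by (rewrite <- ln_1; apply ln_le; lra).
  assert (A2 : - (2 * t) <= ln (1 - t)).
  { generalize (exp_ineq1_le (ln (/ (1 - t)))); rewrite exp_ln by (apply Rinv_0_lt_compat; lra).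
    rewrite ln_Rinv by lra. intros.
    assert (/ (1 - t) <= 1 + 2 * t).
    { apply (Rmult_le_reg_r (1 - t)); [lra|]. rewrite Rinv_l by lra. nra. }
    lra. }
  rewrite Rabs_mult in *. rewrite (Rabs_pos_eq t) in G2 by lra.
  rewrite (Rabs_left1 (ln (1 - t))) by lra.
  generalize (Rabs_pos (ln t)); nra.
Qed.

Lemma continuous_ln_mul_ln_at (t : R) : 0 <= t < 1 -> continuous (fun t => ln t * ln (1 - t)) t.
Proof.
  intros [[Ht|<-] H1]; [cont; lra | exact continuous_ln_mul_ln].
Qed.

(** Landen's identity minus Euler's reflection formula; in this form Li_2(x) itself is
    eliminated. *)
Lemma dilog_reflect (x : R) : 0 <= x <= 1 / 2 ->
  dilog (- x / (1 - x)) - dilog (1 - x) = ln x * ln (1 - x) - ln (1 - x) ^ 2 / 2 - dilog 1.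
Proof.
  intros Hx; destruct (Req_dec x 0) as [->|H0].
  { replace (- 0 / (1 - 0)) with 0 by field. rewrite dilog_0, Rminus_0_r, ln_1; field. }
  pose (f := fun t => dilog (- t / (1 - t)) - dilog (1 - t) - ln t * ln (1 - t)
                      + ln (1 - t) ^ 2 / 2).
  enough (f x = f 0) as E.
  { unfold f in E; replace (- 0 / (1 - 0)) with 0 in E by field.
    rewrite dilog_0, Rminus_0_r, ln_1 in E; lra. }
  apply eq_of_derive_0; [lra| |]; unfold f; intros t Ht.
  - assert (Hq : - 1 < - t / (1 - t) < 0).
    { split; [apply Rlt_div_r; lra | apply Rlt_div_l; lra]. }
    derive_0; [repeat split; lra|].
    replace (1 - - t / (1 - t)) with (/ (1 - t)) by (field; lra).
    replace (1 - (1 - t)) with t by ring.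
    rewrite ln_Rinv by lra. field; lra.
  - apply (continuous_plus (V := R_NormedModule)); [|cont; lra].
    apply (continuous_minus (V := R_NormedModule)); [cont; lra|].
    apply continuous_ln_mul_ln_at; lra.
Qed.

(** The derivative involves Li_2 at t, 1 - t and -t/(1-t). Landen's identity and the reflection
    express the first two by the third, whose coefficient then vanishes. *)
Lemma trilog_three_term (x : R) : 0 <= x <= 1 / 2 ->
  trilog (1 - x) + trilog x + trilog (- x / (1 - x)) =
  - ln x * ln (1 - x) ^ 2 / 2 + ln (1 - x) ^ 3 / 6 + dilog 1 * ln (1 - x) + trilog 1.
Proof.
  intros Hx; destruct (Req_dec x 0) as [->|H0].
  { replace (- 0 / (1 - 0)) with 0 by field. rewrite trilog_0, Rminus_0_r, ln_1; field. }
  (* The product ln t * ln (1 - t) is kept as one factor, because only the product is continuous at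
     0. *)
  pose (f := fun t => trilog (1 - t) + trilog t + trilog (- t / (1 - t))
    + (ln t * ln (1 - t)) * (ln (1 - t) / 2) - ln (1 - t) ^ 3 / 6 - dilog 1 * ln (1 - t)).
  enough (f x = f 0) as E.
  { unfold f in E; replace (- 0 / (1 - 0)) with 0 in E by field.
    rewrite trilog_0, Rminus_0_r, ln_1 in E; lra. }
  apply eq_of_derive_0; [lra| |]; unfold f; intros t Ht.
  - assert (Hq : - 1 < - t / (1 - t) < 0).
    { split; [apply Rlt_div_r; lra | apply Rlt_div_l; lra]. }
    derive_0; [repeat split; lra|].
    generalize (dilog_landen t ltac:(lra)) (dilog_reflect t ltac:(lra)); intros E1 E2.
    replace (dilog t) with (- ln (1 - t) ^ 2 / 2 - dilog (- t / (1 - t))) by lra.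
    replace (dilog (1 - t)) with (dilog (- t / (1 - t)) - ln t * ln (1 - t)
      + ln (1 - t) ^ 2 / 2 + dilog 1) by lra.
    field; lra.
  - apply (continuous_minus (V := R_NormedModule)); [|cont; lra].
    apply (continuous_minus (V := R_NormedModule)); [|cont; lra].
    apply (continuous_plus (V := R_NormedModule)); [cont; lra|].
    apply (continuous_mult (K := R_AbsRing)); [apply continuous_ln_mul_ln_at; lra | cont; lra].
Qed.

Lemma dilog_m1 : dilog (-1) = - dilog 1 / 2.
Proof. generalize (dilog_sqr 1 ltac:(lra)); rewrite Rmult_1_l; replace (- (1)) with (-1) by ring; lra. Qed.

Lemma trilog_m1 : trilog (-1) = - 3 / 4 * trilog 1.
Proof. generalize (trilog_sqr 1 ltac:(lra)); rewrite Rmult_1_l; replace (- (1)) with (-1) by ring; lra. Qed.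

Lemma ln_half : ln (1 / 2) = - ln 2.
Proof. replace (1 / 2) with (/ 2) by field; apply ln_Rinv; lra. Qed.

Lemma dilog_half : dilog (1 / 2) = dilog 1 / 2 - ln 2 ^ 2 / 2.
Proof.
  generalize (dilog_landen (1 / 2) ltac:(lra)).
  replace (- (1 / 2) / (1 - 1 / 2)) with (-1) by field.
  replace (1 - 1 / 2) with (1 / 2) by field. rewrite dilog_m1, ln_half; lra.
Qed.

Lemma trilog_half :
  trilog (1 / 2) = 7 / 8 * trilog 1 + ln 2 ^ 3 / 6 - dilog 1 * ln 2 / 2.
Proof.
  generalize (trilog_three_term (1 / 2) ltac:(lra)).
  replace (- (1 / 2) / (1 - 1 / 2)) with (-1) by field.
  replace (1 - 1 / 2) with (1 / 2) by field. rewrite trilog_m1, ln_half; lra.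
Qed.

Lemma ln_div_pos (x y : R) : 0 < x -> 0 < y -> ln (x / y) = ln x - ln y.
Proof.
  intros; unfold Rdiv; rewrite ln_mult, ln_Rinv by (try apply Rinv_0_lt_compat; lra); ring.
Qed.

(* Kummer's equation with second variable [-1]. *)
Lemma dilog_kummer_sum (x : R) : 0 <= x < 1 ->
  dilog x - dilog (- x) - 2 * dilog (2 * x / (1 + x))
  + dilog (4 * x / ((1 + x) * (1 + x))) / 2 = 0.
Proof.
  intros Hx; destruct (Req_dec x 0) as [->|H0].
  { replace (2 * 0 / (1 + 0)) with 0 by field.
    replace (4 * 0 / ((1 + 0) * (1 + 0))) with 0 by field. rewrite Ropp_0, dilog_0; field. }
  pose (f := fun t => dilog t - dilog (- t) - 2 * dilog (2 * t / (1 + t))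
    + dilog (4 * t / ((1 + t) * (1 + t))) * / 2).
  enough (f x = f 0) as E.
  { unfold f in E; replace (2 * 0 / (1 + 0)) with 0 in E by field.
    replace (4 * 0 / ((1 + 0) * (1 + 0))) with 0 in E by field.
    rewrite Ropp_0, dilog_0 in E; unfold Rdiv; lra. }
  apply eq_of_derive_0; [lra| |]; unfold f; intros t Ht.
  - assert (H1 : 0 < 2 * t / (1 + t) < 1).
    { split; [apply Rlt_div_r; lra | apply Rlt_div_l; lra]. }
    assert (H2 : 0 < 4 * t / ((1 + t) * (1 + t)) < 1).
    { split; [apply Rlt_div_r; nra | apply Rlt_div_l; nra]. }
    derive_0; [repeat split; nra|].
    replace (1 - 2 * t / (1 + t)) with ((1 - t) / (1 + t)) by (field; lra).
    replace (1 - 4 * t / ((1 + t) * (1 + t)))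
      with (((1 - t) / (1 + t)) * ((1 - t) / (1 + t))) by (field; lra).
    rewrite (ln_mult ((1 - t) / (1 + t))) by (apply Rdiv_lt_0_compat; lra).
    rewrite ln_div_pos by lra.
    replace (1 - - t) with (1 + t) by ring. field; repeat split; lra.
  - cont; nra.
Qed.

(** The derivative of the trilogarithm relation below has simple poles at t = 0 and t = -1. The
    residue at 0 is [dilog_kummer_sum], the one at -1 is this relation. *)
Lemma dilog_kummer_sum' (x : R) : 0 <= x < 1 ->
  2 * dilog (2 * x / (1 + x)) - 2 * dilog ((1 + x) / 2) - dilog (4 * x / ((1 + x) * (1 + x)))
  = ln (1 + x) ^ 2 - 2 * ln 2 * ln (1 + x) + ln 2 ^ 2 - dilog 1.
Proof.
  intros Hx; destruct (Req_dec x 0) as [->|H0].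
  { replace (2 * 0 / (1 + 0)) with 0 by field.
    replace (4 * 0 / ((1 + 0) * (1 + 0))) with 0 by field.
    rewrite Rplus_0_r, dilog_0, dilog_half, ln_1; field. }
  pose (f := fun t => 2 * dilog (2 * t / (1 + t)) - 2 * dilog ((1 + t) / 2)
    - dilog (4 * t / ((1 + t) * (1 + t))) - ln (1 + t) ^ 2 + 2 * ln 2 * ln (1 + t)).
  enough (f x = f 0) as E.
  { unfold f in E; replace (2 * 0 / (1 + 0)) with 0 in E by field.
    replace (4 * 0 / ((1 + 0) * (1 + 0))) with 0 in E by field.
    rewrite Rplus_0_r, dilog_0, dilog_half, ln_1 in E; lra. }
  apply eq_of_derive_0; [lra| |]; unfold f; intros t Ht.
  - assert (H1 : 0 < 2 * t / (1 + t) < 1).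
    { split; [apply Rlt_div_r; lra | apply Rlt_div_l; lra]. }
    assert (H2 : 0 < 4 * t / ((1 + t) * (1 + t)) < 1).
    { split; [apply Rlt_div_r; nra | apply Rlt_div_l; nra]. }
    derive_0; [repeat split; nra|].
    replace (1 - 2 * t / (1 + t)) with ((1 - t) / (1 + t)) by (field; lra).
    replace (1 - 4 * t / ((1 + t) * (1 + t)))
      with (((1 - t) / (1 + t)) * ((1 - t) / (1 + t))) by (field; lra).
    rewrite (ln_mult ((1 - t) / (1 + t))) by (apply Rdiv_lt_0_compat; lra).
    replace (1 - (1 + t) / 2) with ((1 - t) / 2) by field.
    rewrite !ln_div_pos by lra.
    field; repeat split; lra.
  - cont; nra.
Qed.

Lemma trilog_kummer_sum (x : R) : 0 <= x < 1 ->
  trilog x - trilog (- x) - 2 * trilog (2 * x / (1 + x)) - 2 * trilog ((1 + x) / 2)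
  + trilog (4 * x / ((1 + x) * (1 + x))) / 2
  = ln (1 + x) ^ 3 / 3 - ln 2 * ln (1 + x) ^ 2 + (ln 2 ^ 2 - dilog 1) * ln (1 + x)
    - 2 * trilog (1 / 2).
Proof.
  intros Hx; destruct (Req_dec x 0) as [->|H0].
  { replace (2 * 0 / (1 + 0)) with 0 by field.
    replace (4 * 0 / ((1 + 0) * (1 + 0))) with 0 by field.
    rewrite Ropp_0, Rplus_0_r, trilog_0, ln_1; field. }
  pose (f := fun t => trilog t - trilog (- t) - 2 * trilog (2 * t / (1 + t))
    - 2 * trilog ((1 + t) / 2) + trilog (4 * t / ((1 + t) * (1 + t))) * / 2
    - ln (1 + t) ^ 3 / 3 + ln 2 * ln (1 + t) ^ 2 - (ln 2 ^ 2 - dilog 1) * ln (1 + t)).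
  enough (f x = f 0) as E.
  { unfold f in E; replace (2 * 0 / (1 + 0)) with 0 in E by field.
    replace (4 * 0 / ((1 + 0) * (1 + 0))) with 0 in E by field.
    rewrite Ropp_0, Rplus_0_r, trilog_0, ln_1 in E; unfold Rdiv; lra. }
  apply eq_of_derive_0; [lra| |]; unfold f; intros t Ht.
  - assert (H1 : 0 < 2 * t / (1 + t) < 1).
    { split; [apply Rlt_div_r; lra | apply Rlt_div_l; lra]. }
    assert (H2 : 0 < 4 * t / ((1 + t) * (1 + t)) < 1).
    { split; [apply Rlt_div_r; nra | apply Rlt_div_l; nra]. }
    derive_0; [repeat split; nra|].
    generalize (dilog_kummer_sum t ltac:(lra)) (dilog_kummer_sum' t ltac:(lra)); intros E1 E2.
    replace (dilog t) with (dilog (- t) + 2 * dilog (2 * t / (1 + t))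
      - dilog (4 * t / ((1 + t) * (1 + t))) / 2) by lra.
    replace (dilog ((1 + t) / 2)) with ((2 * dilog (2 * t / (1 + t))
      - dilog (4 * t / ((1 + t) * (1 + t))) - (ln (1 + t) ^ 2 - 2 * ln 2 * ln (1 + t)
      + ln 2 ^ 2 - dilog 1)) / 2) by lra.
    field; repeat split; lra.
  - cont; nra.
Qed.

(* Kummer's equation with second variable [1 / 2]. *)
Lemma ln_kummer (t : R) : 0 < t <= 2 / 5 ->
  ln (1 - t / (2 * ((1 - t) * (1 - t)))) =
    ln (1 - 2 * t) + ln (2 - t) - ln 2 - 2 * ln (1 - t) /\
  ln (1 - t / 2) = ln (2 - t) - ln 2 /\
  ln (1 - t / (1 - t)) = ln (1 - 2 * t) - ln (1 - t) /\
  ln (1 - - t / (2 * (1 - t))) = ln (2 - t) - ln 2 - ln (1 - t) /\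
  ln (1 - / (2 * (1 - t))) = ln (1 - 2 * t) - ln 2 - ln (1 - t).
Proof.
  intros Ht; repeat split.
  - replace (1 - _) with ((1 - 2 * t) * (2 - t) / (2 * ((1 - t) * (1 - t)))) by (field; lra).
    rewrite ln_div_pos by nra. rewrite !ln_mult by nra. ring.
  - replace (1 - _) with ((2 - t) / 2) by field. apply ln_div_pos; lra.
  - replace (1 - _) with ((1 - 2 * t) / (1 - t)) by (field; lra). apply ln_div_pos; lra.
  - replace (1 - _) with ((2 - t) / (2 * (1 - t))) by (field; lra).
    rewrite ln_div_pos, ln_mult by lra; ring.
  - replace (1 - _) with ((1 - 2 * t) / (2 * (1 - t))) by (field; lra).
    rewrite ln_div_pos, ln_mult by lra; ring.
Qed.

(** The bound 2/5 lies between phi^-2 = 0.38..., where the relation is evaluated, and 1/2, where 2t,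
    t/(1-t) and 1/(2(1-t)) reach 1. The factor 5/3 is 1/(1 - 2/5). *)
Lemma kummer_args_bound (t : R) : 0 <= t <= 2 / 5 ->
  0 <= t / (2 * ((1 - t) * (1 - t))) < 1 /\ 0 <= t / (1 - t) < 1 /\
  -1 < - t / (2 * (1 - t)) <= 0 /\ 0 < / (2 * (1 - t)) < 1 /\
  (0 < t -> 0 < t / (2 * ((1 - t) * (1 - t))) /\ 0 < t / (1 - t) /\ - t / (2 * (1 - t)) < 0).
Proof.
  intros Ht.
  assert (0 < / (1 - t) <= 5 / 3).
  { split; [apply Rinv_0_lt_compat; lra|].
    replace (5 / 3) with (/ (3 / 5)) by field. apply Rinv_le_contravar; lra. }
  replace (t / (2 * ((1 - t) * (1 - t)))) with (t * / (1 - t) * / (1 - t) / 2) by (field; lra).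
  replace (- t / (2 * (1 - t))) with (- (t * / (1 - t)) / 2) by (field; lra).
  replace (/ (2 * (1 - t))) with (/ (1 - t) / 2) by (field; lra).
  change (t / (1 - t)) with (t * / (1 - t)). set (u := / (1 - t)) in *.
  assert (0 <= t * u <= 2 / 3) by nra.
  assert (0 <= t * u * u <= 10 / 9) by nra.
  repeat split; try nra.
  assert (0 < t * u) by nra. nra.
Qed.

(** The coefficient of dt/t in the derivative of [trilog_kummer]; twice the relation [dilog_kummer']
    is the coefficient of dt/(1-t). *)
Lemma dilog_kummer (x : R) : 0 <= x <= 2 / 5 ->
  dilog (x / (2 * ((1 - x) * (1 - x)))) + dilog (x / 2) + dilog (2 * x)
  - 2 * dilog (x / (1 - x)) - 2 * dilog (- x / (2 * (1 - x))) - 2 * dilog x = 0.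
Proof.
  intros Hx; destruct (Req_dec x 0) as [->|H0].
  { unfold Rdiv; rewrite ?Ropp_0, !Rmult_0_l, Rmult_0_r, dilog_0; ring. }
  pose (f := fun x => dilog (x / (2 * ((1 - x) * (1 - x)))) + dilog (x / 2) + dilog (2 * x)
    - 2 * dilog (x / (1 - x)) - 2 * dilog (- x / (2 * (1 - x))) - 2 * dilog x).
  change (f x = 0).
  transitivity (f 0).
  2:{ unfold f, Rdiv; rewrite ?Ropp_0, !Rmult_0_l, Rmult_0_r, dilog_0; ring. }
  apply eq_of_derive_0; [lra| |]; unfold f; intros t Ht;
    destruct (kummer_args_bound t ltac:(lra)) as (B1 & B2 & B3 & B4 & B5).
  - destruct (B5 ltac:(lra)) as (B6 & B7 & B8).
    derive_0; [repeat split; nra|].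
    destruct (ln_kummer t ltac:(lra)) as (E1 & E2 & E3 & E4 & E5).
    rewrite E1, E2, E3, E4. field; repeat split; lra.
  - cont; nra.
Qed.

Lemma dilog_kummer' (x : R) : 0 <= x <= 2 / 5 ->
  dilog (x / (2 * ((1 - x) * (1 - x)))) - dilog (x / (1 - x)) - dilog (- x / (2 * (1 - x)))
  - dilog (/ (2 * (1 - x))) + dilog (- (1 - x))
  = (ln 2 ^ 2 - ln (1 - x) ^ 2) / 2 - dilog 1.
Proof.
  intros Hx.
  assert (Z : dilog (0 / (2 * ((1 - 0) * (1 - 0)))) - dilog (0 / (1 - 0))
    - dilog (- 0 / (2 * (1 - 0))) - dilog (/ (2 * (1 - 0))) + dilog (- (1 - 0))
    = ln 2 ^ 2 / 2 - dilog 1).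
  { replace (/ (2 * (1 - 0))) with (1 / 2) by field.
    replace (- (1 - 0)) with (-1) by ring. unfold Rdiv at 1 2 3.
    rewrite Ropp_0, !Rmult_0_l, dilog_0, dilog_m1, dilog_half; field. }
  destruct (Req_dec x 0) as [->|H0].
  { rewrite Z, Rminus_0_r, ln_1; field. }
  pose (f := fun x => dilog (x / (2 * ((1 - x) * (1 - x)))) - dilog (x / (1 - x))
    - dilog (- x / (2 * (1 - x))) - dilog (/ (2 * (1 - x))) + dilog (- (1 - x))
    + ln (1 - x) ^ 2 / 2).
  enough (f x = f 0) as E.
  { unfold f in E; rewrite Z, (Rminus_0_r 1), ln_1 in E; lra. }
  apply eq_of_derive_0; [lra| |]; unfold f; intros t Ht;
    destruct (kummer_args_bound t ltac:(lra)) as (B1 & B2 & B3 & B4 & B5).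
  - destruct (B5 ltac:(lra)) as (B6 & B7 & B8).
    derive_0; [repeat split; nra|].
    destruct (ln_kummer t ltac:(lra)) as (E1 & E2 & E3 & E4 & E5).
    rewrite E1, E3, E4, E5. replace (1 - - (1 - t)) with (2 - t) by ring.
    field; repeat split; lra.
  - cont; nra.
Qed.

Lemma trilog_kummer (x : R) : 0 <= x <= 2 / 5 ->
  trilog (x / (2 * ((1 - x) * (1 - x)))) + trilog (x / 2) + trilog (2 * x)
  - 2 * trilog (x / (1 - x)) - 2 * trilog (- x / (2 * (1 - x)))
  - 2 * trilog (/ (2 * (1 - x))) - 2 * trilog (- (1 - x)) - 2 * trilog x
  = ln (1 - x) ^ 3 / 3 + (2 * dilog 1 - ln 2 ^ 2) * ln (1 - x)
    - 2 * trilog (1 / 2) - 2 * trilog (-1).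
Proof.
  intros Hx.
  pose (f := fun x => trilog (x / (2 * ((1 - x) * (1 - x)))) + trilog (x / 2) + trilog (2 * x)
    - 2 * trilog (x / (1 - x)) - 2 * trilog (- x / (2 * (1 - x)))
    - 2 * trilog (/ (2 * (1 - x))) - 2 * trilog (- (1 - x)) - 2 * trilog x
    - ln (1 - x) ^ 3 / 3 - (2 * dilog 1 - ln 2 ^ 2) * ln (1 - x)).
  assert (Z : f 0 = - 2 * trilog (1 / 2) - 2 * trilog (-1)).
  { unfold f; replace (/ (2 * (1 - 0))) with (1 / 2) by field.
    replace (- (1 - 0)) with (-1) by ring. rewrite Rminus_0_r, ln_1. unfold Rdiv at 1 2 3 4.
    rewrite Ropp_0, Rmult_0_r, !Rmult_0_l, trilog_0; field. }
  enough (f x = f 0) as E by (rewrite Z in E; unfold f in E; lra).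
  destruct (Req_dec x 0) as [->|H0]; [reflexivity|].
  apply eq_of_derive_0; [lra| |]; unfold f; intros t Ht;
    destruct (kummer_args_bound t ltac:(lra)) as (B1 & B2 & B3 & B4 & B5).
  - destruct (B5 ltac:(lra)) as (B6 & B7 & B8).
    derive_0; [repeat split; nra|].
    generalize (dilog_kummer t ltac:(lra)) (dilog_kummer' t ltac:(lra)); intros E1 E2.
    replace (dilog t) with ((dilog (t / (2 * ((1 - t) * (1 - t)))) + dilog (t / 2)
      + dilog (2 * t) - 2 * dilog (t / (1 - t)) - 2 * dilog (- t / (2 * (1 - t)))) / 2) by lra.
    replace (dilog (- (1 - t))) with ((ln 2 ^ 2 - ln (1 - t) ^ 2) / 2 - dilog 1
      - (dilog (t / (2 * ((1 - t) * (1 - t)))) - dilog (t / (1 - t))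
      - dilog (- t / (2 * (1 - t))) - dilog (/ (2 * (1 - t))))) by lra.
    field; repeat split; lra.
  - cont; nra.
Qed.

(** * The value of zeta(2) *)

(* Matsuoka's proof: [wallis_sqr n / wallis n] tends to [0] and its differences
   are [1 / (2 (n+1)^2)]. *)
Definition wallis (n : nat) : R := RInt (fun x => cos x ^ (2 * n)) 0 (PI / 2).
Definition wallis_sqr (n : nat) : R := RInt (fun x => x ^ 2 * cos x ^ (2 * n)) 0 (PI / 2).

Lemma ex_derive_RInt (f : R -> R) (a b : R) : (forall x, ex_derive f x) -> ex_RInt f a b.
Proof.
  intros H; apply (ex_RInt_continuous (V := R_CompleteNormedModule)).
  intros x _; apply (ex_derive_continuous (V := R_NormedModule)), H.
Qed.

Lemma is_RInt_wallis (n : nat) : is_RInt (fun x => cos x ^ (2 * n)) 0 (PI / 2) (wallis n).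
Proof. apply (RInt_correct (V := R_CompleteNormedModule)), ex_derive_RInt; intros x; now auto_derive. Qed.

Lemma is_RInt_wallis_sqr (n : nat) :
  is_RInt (fun x => x ^ 2 * cos x ^ (2 * n)) 0 (PI / 2) (wallis_sqr n).
Proof. apply (RInt_correct (V := R_CompleteNormedModule)), ex_derive_RInt; intros x; now auto_derive. Qed.

Lemma RInt_eq_of_antiderivative (f F : R -> R) (v : R) :
  (forall x, is_derive F x (f x)) -> (forall x, ex_derive f x) ->
  is_RInt f 0 (PI / 2) v -> v = F (PI / 2) - F 0.
Proof.
  intros HF Hf Hv; apply (is_RInt_unique (V := R_CompleteNormedModule)) in Hv; rewrite <- Hv.
  apply (is_RInt_unique (V := R_CompleteNormedModule)).
  apply (is_RInt_derive (V := R_CompleteNormedModule) F f); intros x _; [apply HF|].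
  apply (ex_derive_continuous (V := R_NormedModule)), Hf.
Qed.

Lemma pow_cos_succ (n : nat) (x : R) : cos x ^ (2 * S n) = cos x ^ (2 * n) * cos x ^ 2.
Proof. rewrite <- pow_add; f_equal; lia. Qed.

Lemma sin_sqr (x : R) : sin x ^ 2 = 1 - cos x ^ 2.
Proof. generalize (sin2_cos2 x); unfold Rsqr; intros; nra. Qed.

Lemma is_derive_mult_pow_cos (g : R -> R) (n : nat) (x dg : R) : is_derive g x dg ->
  is_derive (fun x => g x * cos x ^ S n) x
    (cos x ^ n * (dg * cos x - (INR n + 1) * g x * sin x)).
Proof.
  intros Hg; evar_last.
  - apply Derive.is_derive_mult; [exact Hg|].
    apply (is_derive_pow cos (S n)), is_derive_cos.
  - rewrite S_INR; simpl; ring.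
Qed.

Lemma wallis_succ (n : nat) : (2 * INR n + 2) * wallis (S n) = (2 * INR n + 1) * wallis n.
Proof.
  enough ((2 * INR n + 2) * wallis (S n) - (2 * INR n + 1) * wallis n = 0) by lra.
  transitivity (sin (PI / 2) * cos (PI / 2) ^ S (2 * n) - sin 0 * cos 0 ^ S (2 * n)).
  2:{ rewrite cos_PI2, sin_0; simpl; ring. }
  apply (RInt_eq_of_antiderivative
    (fun x => (2 * INR n + 2) * cos x ^ (2 * S n) - (2 * INR n + 1) * cos x ^ (2 * n))
    (fun x => sin x * cos x ^ S (2 * n))).
  - intros x; evar_last.
    { apply (is_derive_mult_pow_cos sin). apply is_derive_sin. }
    rewrite pow_cos_succ, mult_INR. simpl (INR 2). ring [(sin_sqr x)].
  - intros x; now auto_derive.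
  - apply (is_RInt_minus (V := R_NormedModule)); apply (is_RInt_scal (V := R_NormedModule));
      apply is_RInt_wallis.
Qed.

(** Two integrations by parts of cos^(2n+2), the first with x and the second with x^2/2; [F]
    collects both boundary terms and vanishes at 0 and PI/2. *)
Lemma wallis_parts (n : nat) :
  wallis (S n) = (INR n + 1) * (2 * INR n + 1) * wallis_sqr n
                 - 2 * (INR n + 1) ^ 2 * wallis_sqr (S n).
Proof.
  enough (wallis (S n) - ((INR n + 1) * (2 * INR n + 1) * wallis_sqr n
                 - 2 * (INR n + 1) ^ 2 * wallis_sqr (S n)) = 0) by lra.
  pose (F := fun x => x * cos x ^ (2 * S n) + (INR n + 1) * x ^ 2 * sin x * cos x ^ S (2 * n)).
  transitivity (F (PI / 2) - F 0).
  2:{ unfold F; rewrite sin_0, pow_cos_succ, cos_PI2; simpl; ring. }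
  apply (RInt_eq_of_antiderivative
    (fun x => cos x ^ (2 * S n) -
       ((INR n + 1) * (2 * INR n + 1) * (x ^ 2 * cos x ^ (2 * n))
        - 2 * (INR n + 1) ^ 2 * (x ^ 2 * cos x ^ (2 * S n))))); unfold F; clear F.
  - intros x; evar_last.
    { apply (is_derive_plus (V := R_NormedModule)).
      - apply (is_derive_ext (fun x => (x * cos x) * cos x ^ S (2 * n))).
        { intros t; replace (2 * S n)%nat with (S (S (2 * n))) by lia; simpl; ring. }
        apply is_derive_mult_pow_cos. auto_derive; [exact I | reflexivity].
      - apply is_derive_mult_pow_cos. auto_derive; [exact I | reflexivity]. }
    match goal with |- plus ?a ?b = ?c => change (a + b = c) end.
    rewrite pow_cos_succ, mult_INR. simpl (INR 2). ring [(sin_sqr x)].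
  - intros x; now auto_derive.
  - apply (is_RInt_minus (V := R_NormedModule)); [apply is_RInt_wallis|].
    apply (is_RInt_minus (V := R_NormedModule)); apply (is_RInt_scal (V := R_NormedModule));
      apply is_RInt_wallis_sqr.
Qed.

Lemma wallis_pos (n : nat) : 0 < wallis n.
Proof.
  induction n as [|n IH].
  - rewrite (RInt_eq_of_antiderivative (fun x => cos x ^ (2 * 0)) (fun x => x) (wallis 0)).
    + generalize PI_RGT_0; lra.
    + intros x; simpl; auto_derive; [exact I | ring].
    + intros x; now auto_derive.
    + apply is_RInt_wallis.
  - generalize (wallis_succ n) (pos_INR n); intros E H. nra.
Qed.

Lemma wallis_sqr_nonneg (n : nat) : 0 <= wallis_sqr n.
Proof.
  apply RInt_ge_0; [generalize PI_RGT_0; lra | |].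
  - apply ex_derive_RInt; intros x; now auto_derive.
  - intros x _; apply Rmult_le_pos; [nra|]. rewrite pow_mult; apply pow_le; nra.
Qed.

Lemma x_cos_le_sin (x : R) : 0 <= x <= PI / 2 -> x * cos x <= sin x.
Proof.
  intros Hx; destruct (MVT_gen (fun x => sin x - x * cos x) 0 x (fun x => x * sin x)) as [c [Hc E]].
  - intros t _; auto_derive; [exact I | ring].
  - intros t _; apply continuity_pt_filterlim.
    apply (ex_derive_continuous (V := R_NormedModule) (fun x => sin x - x * cos x)).
    now auto_derive.
  - rewrite Rmin_left, Rmax_right in Hc by lra. rewrite sin_0 in E.
    assert (0 <= sin c) by (apply sin_ge_0; generalize PI_RGT_0; lra).
    assert (0 <= c * sin c * (x - 0)) by (repeat apply Rmult_le_pos; lra). lra.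
Qed.

(** From x cos x <= sin x the integrand is at most cos^(2n) sin^2, whose integral is
    [wallis n - wallis (S n)], that is [wallis n / (2n+2)]. *)
Lemma wallis_sqr_le (n : nat) : (2 * INR n + 2) * wallis_sqr (S n) <= wallis n.
Proof.
  apply Rle_trans with ((2 * INR n + 2) * (wallis n - wallis (S n))).
  2:{ generalize (wallis_succ n); nra. }
  apply Rmult_le_compat_l; [generalize (pos_INR n); lra|].
  apply (is_RInt_le (fun x => x ^ 2 * cos x ^ (2 * S n))
    (fun x => cos x ^ (2 * n) - cos x ^ (2 * S n)) 0 (PI / 2)); [generalize PI_RGT_0; lra | | |].
  - apply is_RInt_wallis_sqr.
  - apply (is_RInt_minus (V := R_NormedModule)); apply is_RInt_wallis.
  - intros x Hx. generalize (x_cos_le_sin x ltac:(lra)); intros G.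
    assert (0 <= cos x) by (apply cos_ge_0; lra).
    rewrite pow_cos_succ.
    assert (0 <= cos x ^ (2 * n)) by (apply pow_le; assumption).
    generalize (sin_sqr x); intros G2.
    assert ((x * cos x) ^ 2 <= sin x ^ 2) by (apply pow_incr; split; [nra | assumption]).
    replace (x ^ 2 * (cos x ^ (2 * n) * cos x ^ 2)) with (cos x ^ (2 * n) * (x * cos x) ^ 2) by ring.
    nra.
Qed.

Lemma is_series_inv_sqr : is_series (fun n => / INR (S n) ^ 2) (PI ^ 2 / 6).
Proof.
  pose (r := fun n => wallis_sqr n / wallis n).
  assert (Hr : forall n, / INR (S n) ^ 2 = 2 * (r n - r (S n))).
  { intros n; unfold r; generalize (wallis_pos n) (wallis_pos (S n)) (wallis_succ n)
      (wallis_parts n) (pos_INR n); intros P1 P2 E1 E2 P3.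
    replace (wallis n) with ((2 * INR n + 2) * wallis (S n) / (2 * INR n + 1))
      by (rewrite E1; field; lra).
    apply (Rmult_eq_reg_r (INR (S n) ^ 2 * wallis (S n))); [|rewrite S_INR; nra].
    rewrite S_INR; transitivity (wallis (S n)); [field; nra|].
    rewrite E2 at 1. field; repeat split; nra. }
  apply (is_series_ext (fun n => 2 * (r n - r (S n)))); [intros n; now rewrite Hr|].
  (* The first quotient r 0 is (PI^3/24)/(PI/2) = PI^2/12. *)
  replace (PI ^ 2 / 6) with (2 * (r 0%nat - 0)).
  - apply (is_series_scal (V := R_NormedModule)), is_series_telescope.
    apply is_lim_seq_incr_1.
    apply (is_lim_seq_le_le (fun _ => 0) _ (fun n => / INR (S n))).
    + intros n; unfold r; generalize (wallis_pos n) (wallis_pos (S n)) (wallis_succ n)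
        (wallis_sqr_nonneg (S n)) (wallis_sqr_le n) (pos_INR n); intros P1 P2 E1 P3 P4 P5.
      split; [apply Rdiv_le_0_compat; assumption|].
      apply Rle_div_l; [assumption|]. rewrite S_INR.
      apply (Rmult_le_reg_l (INR n + 1)); [lra|].
      rewrite <- Rmult_assoc, Rinv_r, Rmult_1_l by lra. nra.
    + apply is_lim_seq_const.
    + apply (is_lim_seq_inv (fun n => INR (S n)) p_infty); [|discriminate].
      apply (is_lim_seq_incr_1 INR), is_lim_seq_INR.
  - unfold r. rewrite (RInt_eq_of_antiderivative (fun x => cos x ^ (2 * 0)) (fun x => x) (wallis 0)).
    + rewrite (RInt_eq_of_antiderivative (fun x => x ^ 2 * cos x ^ (2 * 0)) (fun x => x ^ 3 / 3)
        (wallis_sqr 0)).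
      * generalize PI_RGT_0; intros; field; lra.
      * intros x; simpl; auto_derive; [exact I | field].
      * intros x; now auto_derive.
      * apply is_RInt_wallis_sqr.
    + intros x; simpl; auto_derive; [exact I | ring].
    + intros x; now auto_derive.
    + apply is_RInt_wallis.
Qed.

Lemma dilog_1 : dilog 1 = PI ^ 2 / 6.
Proof.
  unfold dilog; rewrite Lic_id by lra; unfold Li.
  apply is_series_unique, (is_series_ext (fun n => / INR (S n) ^ 2)); [|exact is_series_inv_sqr].
  intros n; rewrite pow1; unfold Rdiv; now rewrite Rmult_1_l.
Qed.

(** * Complex-valued functions of a real variable *)

(** Derivative in the real parameter of a segment, by components, so that uniqueness of primitives
    reduces to the real case. *)
Definition is_Cderive (f : R -> C) (t : R) (l : C) : Prop :=
  is_derive (fun u => Re (f u)) t (Re l) /\ is_derive (fun u => Im (f u)) t (Im l).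

Lemma C_eq (a b : C) : Re a = Re b -> Im a = Im b -> a = b.
Proof. destruct a, b; simpl; now intros -> ->. Qed.

Lemma is_Cderive_val (f : R -> C) (t : R) (l l' : C) :
  is_Cderive f t l -> l = l' -> is_Cderive f t l'.
Proof. now intros H <-. Qed.

Lemma is_Cderive_const (c : C) (t : R) : is_Cderive (fun _ => c) t 0%C.
Proof.
  split; [exact (is_derive_const (V := R_NormedModule) (Re c) t)
         | exact (is_derive_const (V := R_NormedModule) (Im c) t)].
Qed.

Lemma is_Cderive_RtoC (t : R) : is_Cderive RtoC t 1%C.
Proof.
  split; [exact (is_derive_id (K := R_AbsRing) t)
         | exact (is_derive_const (V := R_NormedModule) 0 t)].
Qed.

Lemma is_Cderive_RtoC_comp (f : R -> R) (t l : R) :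
  is_derive f t l -> is_Cderive (fun u => RtoC (f u)) t (RtoC l).
Proof. split; [assumption | exact (is_derive_const (V := R_NormedModule) 0 t)]. Qed.

Lemma is_Cderive_plus (f g : R -> C) (t : R) (a b : C) :
  is_Cderive f t a -> is_Cderive g t b -> is_Cderive (fun u => f u + g u)%C t (a + b)%C.
Proof.
  intros [H1 H2] [H3 H4]; split; apply (is_derive_plus (V := R_NormedModule)); assumption.
Qed.

Lemma is_Cderive_opp (f : R -> C) (t : R) (a : C) :
  is_Cderive f t a -> is_Cderive (fun u => - f u)%C t (- a)%C.
Proof. intros [H1 H2]; split; apply (is_derive_opp (V := R_NormedModule)); assumption. Qed.

Lemma is_Cderive_minus (f g : R -> C) (t : R) (a b : C) :
  is_Cderive f t a -> is_Cderive g t b -> is_Cderive (fun u => f u - g u)%C t (a - b)%C.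
Proof. intros; apply is_Cderive_plus; [assumption | now apply is_Cderive_opp]. Qed.

Lemma is_Cderive_mult (f g : R -> C) (t : R) (a b : C) :
  is_Cderive f t a -> is_Cderive g t b ->
  is_Cderive (fun u => f u * g u)%C t (a * g t + f t * b)%C.
Proof.
  intros [H1 H2] [H3 H4]; unfold Re, Im in *; split; simpl.
  - evar_last.
    + apply (is_derive_minus (V := R_NormedModule)); apply Derive.is_derive_mult; eassumption.
    + unfold minus, plus, opp; simpl; ring.
  - evar_last.
    + apply (is_derive_plus (V := R_NormedModule)); apply Derive.is_derive_mult; eassumption.
    + unfold plus; simpl; ring.
Qed.

Lemma is_Cderive_scal (c : C) (f : R -> C) (t : R) (a : C) :
  is_Cderive f t a -> is_Cderive (fun u => c * f u)%C t (c * a)%C.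
Proof.
  intros H; eapply is_Cderive_val;
    [apply is_Cderive_mult; [apply is_Cderive_const | exact H] | cbv beta; ring].
Qed.

Lemma C_norm2_pos (z : C) : z <> 0%C -> 0 < Re z ^ 2 + Im z ^ 2.
Proof.
  intros Hz; rewrite <- Cmod2_alt; apply pow_lt; now apply Cmod_gt_0.
Qed.

Lemma is_Cderive_inv (f : R -> C) (t : R) (a : C) :
  is_Cderive f t a -> f t <> 0%C -> is_Cderive (fun u => / f u)%C t (- a / (f t * f t))%C.
Proof.
  intros [H1 H2] Hf; apply C_norm2_pos in Hf; unfold Re, Im in *.
  assert (D : is_derive (fun u => fst (f u) ^ 2 + snd (f u) ^ 2) t
                (2 * fst (f t) * fst a + 2 * snd (f t) * snd a)).
  { evar_last.
    - apply (is_derive_plus (V := R_NormedModule)); apply is_derive_pow; eassumption.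
    - match goal with |- plus ?a ?b = ?c => change (a + b = c) end. simpl; ring. }
  split; unfold Re, Im; simpl.
  - evar_last; [apply is_derive_div; [exact H1 | exact D | simpl in *; lra]|].
    simpl in *; field; split; [|lra].
    match goal with |- ?e <> 0 => replace e with
      ((fst (f t) * (fst (f t) * 1) + snd (f t) * (snd (f t) * 1)) ^ 2) by ring end.
    apply pow_nonzero; lra.
  - evar_last; [apply is_derive_div;
      [apply (is_derive_opp (V := R_NormedModule)); exact H2 | exact D | simpl in *; lra]|].
    unfold opp; simpl in *; field; split; [|lra].
    match goal with |- ?e <> 0 => replace e with
      ((fst (f t) * (fst (f t) * 1) + snd (f t) * (snd (f t) * 1)) ^ 2) by ring end.
    apply pow_nonzero; lra.
Qed.

Lemma is_Cderive_div (f g : R -> C) (t : R) (a b : C) :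
  is_Cderive f t a -> is_Cderive g t b -> g t <> 0%C ->
  is_Cderive (fun u => f u / g u)%C t ((a * g t - f t * b) / (g t * g t))%C.
Proof.
  intros Hf Hg H0; eapply is_Cderive_val;
    [apply is_Cderive_mult; [exact Hf | apply is_Cderive_inv; eassumption] | cbv beta; now field].
Qed.

Lemma is_Cderive_ext (f g : R -> C) (t : R) (l : C) :
  (forall u, f u = g u) -> is_Cderive f t l -> is_Cderive g t l.
Proof.
  intros H [H1 H2]; split; [eapply is_derive_ext; [|exact H1] | eapply is_derive_ext; [|exact H2]];
    intros u; simpl; now rewrite H.
Qed.

Lemma is_Cderive_0_eq (f : R -> C) (b : R) : 0 <= b ->
  (forall t, 0 <= t <= b -> is_Cderive f t 0%C) -> f b = f 0.
Proof.
  intros [Hb|<-] H; [|reflexivity].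
  apply C_eq; symmetry.
  - apply (eq_is_derive (V := R_NormedModule) (fun u => Re (f u))); [|assumption].
    intros t Ht; apply (H t Ht).
  - apply (eq_is_derive (V := R_NormedModule) (fun u => Im (f u))); [|assumption].
    intros t Ht; apply (H t Ht).
Qed.

Lemma is_Cderive_unique_primitive (f g l : R -> C) (b : R) : 0 <= b ->
  (forall t, 0 <= t <= b -> is_Cderive f t (l t)) ->
  (forall t, 0 <= t <= b -> is_Cderive g t (l t)) -> (f b - f 0 = g b - g 0)%C.
Proof.
  intros Hb Hf Hg.
  enough (f b - g b = f 0 - g 0)%C as E.
  { replace (f b) with (f b - g b + g b)%C by ring. rewrite E; ring. }
  apply (is_Cderive_0_eq (fun u => f u - g u)%C); [assumption|].
  intros t Ht; eapply is_Cderive_val; [apply is_Cderive_minus; auto | ring].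
Qed.

(** Turns a quadratic remainder estimate into a derivative: [h] will be a multiple of a squared
    distance. *)
Lemma is_derive_squeeze (r h : R -> R) (t : R) :
  locally t (fun u => Rabs (r u) <= h u) -> h t = 0 -> is_derive h t 0 -> is_derive r t 0.
Proof.
  intros [d Hd] Ht Hh; apply is_derive_Reals; apply is_derive_Reals in Hh.
  assert (Hr : r t = 0).
  { specialize (Hd t (ball_center t d)); rewrite Ht in Hd.
    generalize (Rabs_pos (r t)); intros; destruct (Req_dec (r t) 0) as [|Hn]; [assumption|].
    apply Rabs_pos_lt in Hn; lra. }
  intros eps Heps; destruct (Hh eps Heps) as [d' Hd'].
  assert (Hm : 0 < Rmin d d') by (apply Rmin_pos; apply cond_pos).
  exists (mkposreal _ Hm); intros e He Hle; simpl in Hle.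
  assert (He1 : Rabs e < d) by (eapply Rlt_le_trans; [exact Hle | apply Rmin_l]).
  assert (He2 : Rabs e < d') by (eapply Rlt_le_trans; [exact Hle | apply Rmin_r]).
  specialize (Hd' e He He2); rewrite Ht in Hd'; rewrite Hr.
  assert (B : Rabs (r (t + e)) <= h (t + e)).
  { apply Hd; unfold ball; simpl; unfold AbsRing_ball, abs, minus, plus, opp; simpl.
    now replace (t + e + - t) with e by ring. }
  eapply Rle_lt_trans; [|exact Hd'].
  rewrite !Rminus_0_r; unfold Rdiv; rewrite !Rabs_mult.
  apply Rmult_le_compat_r; [apply Rabs_pos|].
  eapply Rle_trans; [exact B | apply Rle_abs].
Qed.

(** * Complex power series *)

Definition CSeries (a : nat -> C) : C := (Series (fun n => Re (a n)), Series (fun n => Im (a n))).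

Definition Csummable (a : nat -> C) : Prop := ex_series (fun n => Cmod (a n)).

Lemma im_le_Cmod (c : C) : Rabs (Im c) <= Cmod c.
Proof. eapply Rle_trans; [apply Rmax_r | apply Rmax_Cmod]. Qed.

Lemma Csummable_Re (a : nat -> C) : Csummable a -> ex_series (fun n => Re (a n)).
Proof. apply ex_series_dominated; intros n; apply re_le_Cmod. Qed.

Lemma Csummable_Im (a : nat -> C) : Csummable a -> ex_series (fun n => Im (a n)).
Proof. apply ex_series_dominated; intros n; apply im_le_Cmod. Qed.

Lemma Csummable_dominated (a : nat -> C) (b : nat -> R) :
  (forall n, Cmod (a n) <= b n) -> ex_series b -> Csummable a.
Proof.
  intros H; apply ex_series_dominated; intros n.
  rewrite Rabs_pos_eq by apply Cmod_ge_0; apply H.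
Qed.

Lemma CSeries_ext (a b : nat -> C) : (forall n, a n = b n) -> CSeries a = CSeries b.
Proof. intros H; unfold CSeries; f_equal; apply Series_ext; intros n; now rewrite H. Qed.

Lemma CSeries_plus (a b : nat -> C) : Csummable a -> Csummable b ->
  CSeries (fun n => a n + b n)%C = (CSeries a + CSeries b)%C.
Proof.
  intros Ha Hb; apply C_eq; simpl.
  - apply Series_plus; now apply Csummable_Re.
  - apply Series_plus; now apply Csummable_Im.
Qed.

Lemma Csummable_scal (c : C) (a : nat -> C) : Csummable a -> Csummable (fun n => c * a n)%C.
Proof.
  intros Ha; apply (Csummable_dominated _ (fun n => Cmod c * Cmod (a n))).
  - intros n; rewrite Cmod_mult; lra.
  - now apply (ex_series_scal (V := R_NormedModule)).
Qed.

Lemma Csummable_plus (a b : nat -> C) :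
  Csummable a -> Csummable b -> Csummable (fun n => a n + b n)%C.
Proof.
  intros Ha Hb; apply (Csummable_dominated _ (fun n => Cmod (a n) + Cmod (b n))).
  - intros n; apply Cmod_triangle.
  - now apply (ex_series_plus (V := R_NormedModule)).
Qed.

Lemma Csummable_minus (a b : nat -> C) :
  Csummable a -> Csummable b -> Csummable (fun n => a n - b n)%C.
Proof.
  intros Ha Hb; apply (Csummable_dominated _ (fun n => Cmod (a n) + Cmod (b n))).
  - intros n; rewrite <- (Cmod_opp (b n)); apply Cmod_triangle.
  - now apply (ex_series_plus (V := R_NormedModule)).
Qed.

Lemma CSeries_scal (c : C) (a : nat -> C) : Csummable a ->
  CSeries (fun n => c * a n)%C = (c * CSeries a)%C.
Proof.
  intros Ha; apply C_eq; simpl.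
  - rewrite <- !Series_scal_l, <- Series_minus; [reflexivity| |];
      apply (ex_series_scal (V := R_NormedModule)); [now apply Csummable_Re | now apply Csummable_Im].
  - rewrite <- !Series_scal_l, <- Series_plus; [reflexivity| |];
      apply (ex_series_scal (V := R_NormedModule)); [now apply Csummable_Im | now apply Csummable_Re].
Qed.

Lemma CSeries_minus (a b : nat -> C) : Csummable a -> Csummable b ->
  CSeries (fun n => a n - b n)%C = (CSeries a - CSeries b)%C.
Proof.
  intros Ha Hb.
  rewrite (CSeries_ext _ (fun n => a n + (-1) * b n)%C) by (intros n; ring).
  rewrite CSeries_plus, CSeries_scal; [ring | assumption | assumption | now apply Csummable_scal].
Qed.

Lemma Csummable_incr_1 (a : nat -> C) : Csummable a <-> Csummable (fun n => a (S n)).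
Proof. apply (ex_series_incr_1 (V := R_NormedModule)). Qed.

Lemma CSeries_incr_1 (a : nat -> C) : Csummable a ->
  CSeries a = (a 0%nat + CSeries (fun n => a (S n)))%C.
Proof.
  intros Ha; apply C_eq; simpl; apply Series_incr_1; [now apply Csummable_Re | now apply Csummable_Im].
Qed.

Lemma Cmod_le_Re_Im (z : C) : Cmod z <= Rabs (Re z) + Rabs (Im z).
Proof.
  apply Rsqr_incr_0; [|apply Cmod_ge_0 | generalize (Rabs_pos (Re z)) (Rabs_pos (Im z)); lra].
  unfold Rsqr. replace (Cmod z * Cmod z) with (Cmod z ^ 2) by ring. rewrite Cmod2_alt.
  generalize (Rabs_pos (Re z)) (Rabs_pos (Im z)) (pow2_abs (Re z)) (pow2_abs (Im z)); nra.
Qed.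

Lemma Re_CSeries_le (a : nat -> C) (b : nat -> R) :
  (forall n, Cmod (a n) <= b n) -> ex_series b -> Rabs (Re (CSeries a)) <= Series b.
Proof.
  intros H Hb; simpl.
  assert (G : forall n, Rabs (Re (a n)) <= b n)
    by (intros n; eapply Rle_trans; [apply re_le_Cmod | apply H]).
  eapply Rle_trans; [apply Series_Rabs|].
  - apply (ex_series_dominated _ b); [|assumption]. intros n; rewrite Rabs_Rabsolu; apply G.
  - apply Series_le; [|assumption]. intros n; split; [apply Rabs_pos | apply G].
Qed.

Lemma Im_CSeries_le (a : nat -> C) (b : nat -> R) :
  (forall n, Cmod (a n) <= b n) -> ex_series b -> Rabs (Im (CSeries a)) <= Series b.
Proof.
  intros H Hb; simpl.
  assert (G : forall n, Rabs (Im (a n)) <= b n)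
    by (intros n; eapply Rle_trans; [apply im_le_Cmod | apply H]).
  eapply Rle_trans; [apply Series_Rabs|].
  - apply (ex_series_dominated _ b); [|assumption]. intros n; rewrite Rabs_Rabsolu; apply G.
  - apply Series_le; [|assumption]. intros n; split; [apply Rabs_pos | apply G].
Qed.

Definition CPSeries (a : nat -> C) (z : C) : C := CSeries (fun n => a n * z ^ n)%C.

Definition CPS_derive (a : nat -> C) (n : nat) : C := (INR (S n) * a (S n))%C.

(** Strictly inside the disk of convergence, expressed by the moduli of the coefficients so that the
    real theory of the radius applies. *)
Definition in_disk (a : nat -> C) (r : R) : Prop := Rbar_lt r (CV_radius (fun n => Cmod (a n))).

Lemma in_disk_derive (a : nat -> C) (r : R) : in_disk a r -> in_disk (CPS_derive a) r.
Proof.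
  unfold in_disk; rewrite <- CV_radius_derive.
  rewrite (CV_radius_ext (fun n => Cmod (CPS_derive a n)) (PS_derive (fun n => Cmod (a n))));
    [easy|].
  intros n; unfold CPS_derive, PS_derive; rewrite Cmod_mult, Cmod_R, Rabs_pos_eq; [reflexivity|].
  apply pos_INR.
Qed.

Lemma in_disk_le (a : nat -> C) (r r' : R) : r' <= r -> in_disk a r -> in_disk a r'.
Proof. intros H; unfold in_disk; now apply Rbar_le_lt_trans. Qed.

Lemma in_disk_summable_abs (a : nat -> C) (r : R) : 0 <= r ->
  in_disk a r -> ex_series (fun n => Cmod (a n) * r ^ n).
Proof.
  intros Hr H; eapply ex_series_ext; [|apply (CV_disk_inside (fun n => Cmod (a n)) r)].
  - intros n; simpl; apply Rabs_pos_eq, Rmult_le_pos; [apply Cmod_ge_0 | now apply pow_le].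
  - now rewrite Rabs_pos_eq.
Qed.

Lemma in_disk_summable (a : nat -> C) (z : C) :
  in_disk a (Cmod z) -> Csummable (fun n => a n * z ^ n)%C.
Proof.
  intros H; eapply (Csummable_dominated _ (fun n => Cmod (a n) * Cmod z ^ n)).
  - intros n; rewrite Cmod_mult, Cmod_pow; lra.
  - apply in_disk_summable_abs; [apply Cmod_ge_0 | assumption].
Qed.

Lemma in_disk_bounded (a : nat -> C) (r r' M : R) :
  (forall n, Cmod (a n) * r ^ n <= M) -> 0 <= r' < r -> in_disk a r'.
Proof.
  intros H Hr; unfold in_disk; rewrite <- (Rabs_pos_eq r') by lra.
  apply (CV_radius_bounded_coef _ r M); [|rewrite Rabs_pos_eq; lra].
  intros n; rewrite Rabs_pos_eq; [apply H|].
  apply Rmult_le_pos; [apply Cmod_ge_0 | apply pow_le; lra].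
Qed.

Lemma in_disk_open (a : nat -> C) (r : R) : in_disk a r -> exists r', r < r' /\ in_disk a r'.
Proof.
  unfold in_disk; destruct (CV_radius _) as [x| |]; simpl; intros H.
  - exists ((r + x) / 2); lra.
  - exists (r + 1); split; [lra | exact I].
  - contradiction.
Qed.

(** Multiplied by r to avoid the exponent n - 1. In the induction the remainder for n + 2 is w times
    the one for n + 1 plus (n+1) z^n (w - z)^2. *)
Lemma Cpow_taylor (w z : C) (r : R) (n : nat) : Cmod w <= r -> Cmod z <= r ->
  r * Cmod (w ^ S n - z ^ S n - INR (S n) * z ^ n * (w - z))%C
  <= INR n * INR (S n) * r ^ n * Cmod (w - z)%C ^ 2.
Proof.
  intros Hw Hz; assert (Hr : 0 <= r) by (generalize (Cmod_ge_0 w); lra).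
  induction n as [|n IH].
      - replace (w ^ 1 - z ^ 1 - INR 1 * z ^ 0 * (w - z))%C with (RtoC 0) by (simpl; ring).
    rewrite Cmod_0; simpl; lra.
  - replace (w ^ S (S n) - z ^ S (S n) - INR (S (S n)) * z ^ S n * (w - z))%C with
      (w * (w ^ S n - z ^ S n - INR (S n) * z ^ n * (w - z))
       + INR (S n) * z ^ n * ((w - z) * (w - z)))%C
      by (rewrite (S_INR (S n)), RtoC_plus; simpl; ring).
    set (d := Cmod (w - z)%C) in *.
    set (D := (w ^ S n - z ^ S n - INR (S n) * z ^ n * (w - z))%C) in *.
    assert (Hd : 0 <= d) by apply Cmod_ge_0.
    assert (HD : 0 <= Cmod D) by apply Cmod_ge_0.
    apply Rle_trans with (r * (r * Cmod D + INR (S n) * r ^ n * (d * d))).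
    { apply Rmult_le_compat_l; [assumption|]. eapply Rle_trans; [apply Cmod_triangle|].
      rewrite !Cmod_mult, Cmod_pow, Cmod_R, (Rabs_pos_eq (INR (S n))) by apply pos_INR.
      fold d; apply Rplus_le_compat; [now apply Rmult_le_compat_r|].
      apply Rmult_le_compat_r; [nra|]. apply Rmult_le_compat_l; [apply pos_INR|].
      apply pow_incr; split; [apply Cmod_ge_0 | assumption]. }
    assert (0 <= r ^ n * d ^ 2) by (apply Rmult_le_pos; [now apply pow_le | nra]).
    generalize (pos_INR n); intros Hn.
    apply Rle_trans with (r * (INR n * INR (S n) * r ^ n * d ^ 2 + INR (S n) * r ^ n * (d * d))).
    { apply Rmult_le_compat_l; [assumption|]. lra. }
    rewrite (S_INR (S n)), !S_INR; simpl (r ^ S n).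
    assert (0 <= r * (r ^ n * d ^ 2)) by now apply Rmult_le_pos. simpl in *. nra.
Qed.

Lemma CPSeries_taylor (a : nat -> C) (r : R) : 0 < r -> in_disk a r ->
  exists M, forall w z, Cmod w <= r -> Cmod z <= r ->
  let e := (CPSeries a w - CPSeries a z - CPSeries (CPS_derive a) z * (w - z))%C in
  Rabs (Re e) <= M * Cmod (w - z)%C ^ 2 /\ Rabs (Im e) <= M * Cmod (w - z)%C ^ 2.
Proof.
  intros Hr H.
  (* Shifted by one, this is the series of the second derivative at r, with moduli of
     coefficients. *)
  pose (b := fun n => Cmod (a (S n)) * (INR n * INR (S n) * r ^ n / r)).
  assert (Hb : ex_series b).
  { apply ex_series_incr_1.
    eapply ex_series_ext; [|apply (in_disk_summable_abs (CPS_derive (CPS_derive a)) r);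
      [lra | now do 2 apply in_disk_derive]].
    intros n; unfold b, CPS_derive; rewrite !Cmod_mult, !Cmod_R, !Rabs_pos_eq by apply pos_INR.
    match goal with |- ?x = ?y => change (x = y :> R) end. simpl (r ^ S n); field; lra. }
  exists (Series b); intros w z Hw Hz e.
  assert (Dw : in_disk a (Cmod w)) by now apply (in_disk_le a r).
  assert (Dz : in_disk a (Cmod z)) by now apply (in_disk_le a r).
  assert (Sw := proj1 (Csummable_incr_1 _) (in_disk_summable _ _ Dw)).
  assert (Sz := proj1 (Csummable_incr_1 _) (in_disk_summable _ _ Dz)).
  assert (Sd := in_disk_summable _ _ (in_disk_derive _ _ Dz)).
  assert (E : e = CSeries (fun n => (a (S n) * w ^ S n - a (S n) * z ^ S n)
                 - (w - z) * (CPS_derive a n * z ^ n))%C).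
  { rewrite CSeries_minus, CSeries_minus, CSeries_scal; try assumption.
    2: now apply Csummable_minus. 2: now apply Csummable_scal.
    unfold e, CPSeries.
    rewrite (CSeries_incr_1 (fun n => a n * w ^ n)%C) by now apply in_disk_summable.
    rewrite (CSeries_incr_1 (fun n => a n * z ^ n)%C) by now apply in_disk_summable.
    simpl (w ^ 0)%C; simpl (z ^ 0)%C; ring. }
  rewrite Rmult_comm, <- Series_scal_l, E.
  assert (B : forall n, Cmod ((a (S n) * w ^ S n - a (S n) * z ^ S n)
                 - (w - z) * (CPS_derive a n * z ^ n))%C <= Cmod (w - z)%C ^ 2 * b n).
  { intros n; unfold CPS_derive.
    match goal with |- Cmod ?e <= _ => replace e with
      (a (S n) * (w ^ S n - z ^ S n - INR (S n) * z ^ n * (w - z)))%C by ring end.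
    rewrite Cmod_mult; unfold b.
    replace (Cmod (w - z)%C ^ 2 * (Cmod (a (S n)) * (INR n * INR (S n) * r ^ n / r))) with
      (Cmod (a (S n)) * (INR n * INR (S n) * r ^ n * Cmod (w - z)%C ^ 2 / r)) by (field; lra).
    apply Rmult_le_compat_l; [apply Cmod_ge_0|].
    apply Rle_div_r; [assumption|]. rewrite Rmult_comm. now apply Cpow_taylor. }
  assert (ES : ex_series (fun n => Cmod (w - z)%C ^ 2 * b n))
    by now apply (ex_series_scal (V := R_NormedModule)).
  split; [now apply Re_CSeries_le | now apply Im_CSeries_le].
Qed.

(** Chain rule along a curve. The linearization [lin] carries the derivative; its distance to the
    series is O(|g u - g t|^2) and has derivative 0. A radius r slightly beyond |g t| makes the
    estimate valid for all nearby u. *)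
Lemma is_Cderive_CPSeries (a : nat -> C) (g : R -> C) (t : R) (dg : C) :
  is_Cderive g t dg -> in_disk a (Cmod (g t)) ->
  is_Cderive (fun u => CPSeries a (g u)) t (CPSeries (CPS_derive a) (g t) * dg)%C.
Proof.
  intros Hg Hd.
  destruct (in_disk_open a _ Hd) as [r [Hr Hd']].
  assert (Hr0 : 0 < r) by (generalize (Cmod_ge_0 (g t)); lra).
  destruct (CPSeries_taylor a r Hr0 Hd') as [M HM].
  pose (lin := fun u => (CPSeries a (g t) + CPSeries (CPS_derive a) (g t) * (g u - g t))%C).
  assert (Hl : is_Cderive lin t (CPSeries (CPS_derive a) (g t) * dg)%C).
  { eapply is_Cderive_val.
    - apply is_Cderive_plus; [apply is_Cderive_const|].
      apply is_Cderive_scal, is_Cderive_minus; [exact Hg | apply is_Cderive_const].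
    - ring. }
  assert (Hloc : locally t (fun u => Cmod (g u) <= r)).
  { destruct Hg as [G1 G2].
    assert (C1 := ex_derive_continuous _ _ (ex_intro _ _ G1)).
    assert (C2 := ex_derive_continuous _ _ (ex_intro _ _ G2)).
    assert (He : 0 < (r - Cmod (g t)) / 2) by lra.
    generalize (proj1 (filterlim_locally _ _) C1 (mkposreal _ He))
      (proj1 (filterlim_locally _ _) C2 (mkposreal _ He)).
    intros F1 F2; generalize (filter_and _ _ F1 F2); apply filter_imp.
    intros u [B1 B2]; unfold ball in B1, B2; simpl in B1, B2;
      unfold AbsRing_ball, abs, minus, plus, opp in B1, B2; simpl in B1, B2.
    replace (g u) with (g t + (g u - g t))%C by ring.
    eapply Rle_trans; [apply Cmod_triangle|].
    generalize (Cmod_le_Re_Im (g u - g t)%C); unfold Re, Im in *; simpl; lra. }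
  pose (h := fun u => M * (Re (g u - g t)%C ^ 2 + Im (g u - g t)%C ^ 2)).
  assert (Hh0 : h t = 0) by (unfold h, Re, Im; simpl; ring).
  assert (Hh : is_derive h t 0).
  { destruct (is_Cderive_minus g (fun _ => g t) t dg 0%C Hg (is_Cderive_const _ _)) as [G1 G2].
    evar_last.
    - apply is_derive_scal, (is_derive_plus (V := R_NormedModule)); apply is_derive_pow;
        [exact G1 | exact G2].
    - match goal with |- _ * plus ?a ?b = _ => change (M * (a + b) = 0) end.
      unfold Re, Im; simpl; ring. }
  split.
  - apply (is_derive_ext (fun u => Re (lin u) + Re (CPSeries a (g u) - lin u)%C)).
    { intros u; simpl; unfold Re; simpl; ring. }
    rewrite <- (Rplus_0_r (Re (_ * _)%C)).
    apply (is_derive_plus (V := R_NormedModule)); [apply Hl|].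
    apply (is_derive_squeeze _ h); [|assumption|assumption].
    revert Hloc; apply filter_imp; intros u Hu.
    destruct (HM (g u) (g t) Hu ltac:(lra)) as [B _]; rewrite Cmod2_alt in B.
    replace (CPSeries a (g u) - lin u)%C with (CPSeries a (g u) - CPSeries a (g t)
      - CPSeries (CPS_derive a) (g t) * (g u - g t))%C by (unfold lin; ring). exact B.
  - apply (is_derive_ext (fun u => Im (lin u) + Im (CPSeries a (g u) - lin u)%C)).
    { intros u; simpl; unfold Im; simpl; ring. }
    rewrite <- (Rplus_0_r (Im (_ * _)%C)).
    apply (is_derive_plus (V := R_NormedModule)); [apply Hl|].
    apply (is_derive_squeeze _ h); [|assumption|assumption].
    revert Hloc; apply filter_imp; intros u Hu.
    destruct (HM (g u) (g t) Hu ltac:(lra)) as [_ B]; rewrite Cmod2_alt in B.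
    replace (CPSeries a (g u) - lin u)%C with (CPSeries a (g u) - CPSeries a (g t)
      - CPSeries (CPS_derive a) (g t) * (g u - g t))%C by (unfold lin; ring). exact B.
Qed.

(** * The series as a function of its variable *)

(** Coefficients in w = y^2: y [central s (y^2)] is the sum of (-1)^n y^(2n+1)/((2n+1)^s C(2n,n)),
    on which y d/dy lowers s by one. *)
Definition central_coef (s n : nat) : R :=
  (-1) ^ n / (INR (2 * n + 1) ^ s * Binomial.C (2 * n) n).

Definition central (s : nat) (w : C) : C := CPSeries (fun n => RtoC (central_coef s n)) w.

Lemma INR_odd (n : nat) : INR (2 * n + 1) = 2 * INR n + 1.
Proof. rewrite plus_INR, mult_INR; simpl; ring. Qed.

Lemma binomial_pos (n k : nat) : 0 < Binomial.C n k.
Proof.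
  unfold Binomial.C; apply Rdiv_lt_0_compat; [apply INR_fact_lt_0|].
  apply Rmult_lt_0_compat; apply INR_fact_lt_0.
Qed.

Lemma central_binomial_succ (n : nat) :
  (INR n + 1) * Binomial.C (2 * S n) (S n) = 2 * (2 * INR n + 1) * Binomial.C (2 * n) n.
Proof.
  unfold Binomial.C.
  replace (2 * S n - S n)%nat with (S n) by lia. replace (2 * n - n)%nat with n by lia.
  replace (2 * S n)%nat with (S (S (2 * n))) by lia.
  rewrite !fact_simpl, !mult_INR, !S_INR, mult_INR; simpl (INR 2).
  generalize (pos_INR n) (INR_fact_lt_0 n); intros.
  field; lra.
Qed.

Lemma central_coef_scal (s n : nat) :
  central_coef s n = INR (2 * n + 1) * central_coef (S s) n.
Proof.
  unfold central_coef; generalize (binomial_pos (2 * n) n) (pos_INR n); intros.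
  rewrite <- tech_pow_Rmult, INR_odd. field; repeat split; try lra. apply pow_nonzero; lra.
Qed.

Lemma central_coef_1_succ (n : nat) :
  2 * (2 * INR n + 3) * central_coef 1 (S n) = - (INR n + 1) * central_coef 1 n.
Proof.
  unfold central_coef; generalize (binomial_pos (2 * n) n) (pos_INR n) (central_binomial_succ n);
    intros Hb Hn E.
  replace (Binomial.C (2 * S n) (S n)) with (2 * (2 * INR n + 1) * Binomial.C (2 * n) n / (INR n + 1))
    by (rewrite <- E; field; lra).
  rewrite !INR_odd, S_INR; simpl pow; field; repeat split; lra.
Qed.

(** For exponent 1 successive coefficients have ratio (n+1)/(2(2n+3)) <= 1/4 in modulus; higher
    exponents only decrease them. Hence convergence for |y^2| < 4. *)
Lemma central_coef_bound (s n : nat) : Rabs (central_coef (S s) n) * 4 ^ n <= 1.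
Proof.
  assert (H1 : Rabs (central_coef 1 n) * 4 ^ n <= 1).
  { induction n as [|n IH].
    - unfold central_coef, Binomial.C; simpl. rewrite Rabs_pos_eq; lra || (field_simplify; lra).
    - generalize (central_coef_1_succ n) (pos_INR n); intros E Hn.
      replace (central_coef 1 (S n)) with (- ((INR n + 1) / (2 * (2 * INR n + 3))) * central_coef 1 n)
        by (apply (Rmult_eq_reg_l (2 * (2 * INR n + 3))); [rewrite E; field; lra | lra]).
      rewrite Rabs_mult, Rabs_Ropp.
      assert (0 <= (INR n + 1) / (2 * (2 * INR n + 3)) <= / 4).
      { split; [apply Rdiv_le_0_compat; lra | apply Rle_div_l; lra]. }
      rewrite (Rabs_pos_eq (_ / _)) by lra. simpl (4 ^ S n).
      assert (0 <= Rabs (central_coef 1 n) * 4 ^ n)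
        by (apply Rmult_le_pos; [apply Rabs_pos | apply pow_le; lra]).
      nra. }
  induction s as [|s IH]; [assumption|].
  eapply Rle_trans; [|exact IH]. apply Rmult_le_compat_r; [apply pow_le; lra|].
  rewrite (central_coef_scal (S s)), Rabs_mult, INR_odd.
  generalize (pos_INR n) (Rabs_pos (central_coef (S (S s)) n)); intros.
  rewrite (Rabs_pos_eq (2 * INR n + 1)) by lra. nra.
Qed.

Lemma central_in_disk (s : nat) (w : C) : Cmod w < 4 ->
  in_disk (fun n => RtoC (central_coef (S s) n)) (Cmod w).
Proof.
  intros Hw; apply (in_disk_bounded _ 4 _ 1).
  - intros n; rewrite Cmod_R; apply central_coef_bound.
  - split; [apply Cmod_ge_0 | assumption].
Qed.

Lemma CPSeries_derive_mul (a : nat -> C) (w : C) : in_disk a (Cmod w) ->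
  Csummable (fun n => INR n * a n * w ^ n)%C /\
  (w * CPSeries (CPS_derive a) w)%C = CSeries (fun n => INR n * a n * w ^ n)%C.
Proof.
  intros H; assert (Sd := in_disk_summable _ _ (in_disk_derive _ _ H)).
  assert (S1 : Csummable (fun n => INR n * a n * w ^ n)%C).
  { apply Csummable_incr_1. eapply ex_series_ext; [|exact (Csummable_scal w _ Sd)].
    intros n; apply (f_equal Cmod); unfold CPS_derive; simpl; ring. }
  split; [assumption|].
  rewrite CSeries_incr_1 by assumption.
  unfold CPSeries; rewrite <- CSeries_scal by assumption. simpl (INR 0).
  rewrite Cmult_0_l, Cmult_0_l, Cplus_0_l.
  apply CSeries_ext; intros n; unfold CPS_derive; simpl; ring.
Qed.

Lemma central_derive (s : nat) (w : C) : Cmod w < 4 ->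
  (central (S (S s)) w + 2 * w * CPSeries (CPS_derive (fun n => RtoC (central_coef (S (S s)) n))) w)%C
  = central (S s) w.
Proof.
  intros Hw; assert (D := central_in_disk (S s) w Hw).
  destruct (CPSeries_derive_mul _ _ D) as [S1 E].
  rewrite <- Cmult_assoc, E. unfold central at 1, CPSeries at 1.
  rewrite <- CSeries_scal, <- CSeries_plus; try assumption.
  2: now apply in_disk_summable. 2: now apply Csummable_scal.
  apply CSeries_ext; intros n.
  rewrite (central_coef_scal (S s)), INR_odd, !RtoC_mult, RtoC_plus, RtoC_mult; ring.
Qed.

(** For E = y [central 1 (y^2)] this reads (1 + y^2/4) dE/dy + (y/4) E = 1. Hence E sqrt(1 + y^2/4)
    has derivative 1/sqrt(1 + y^2/4) in y. *)
Lemma central_ode (w : C) : Cmod w < 4 ->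
  ((1 + w / 4) * (central 1 w + 2 * w * CPSeries (CPS_derive (fun n => RtoC (central_coef 1 n))) w)
   + w / 4 * central 1 w = 1)%C.
Proof.
  intros Hw; assert (D := central_in_disk 0 w Hw).
  assert (S0 := in_disk_summable _ _ D).
  destruct (CPSeries_derive_mul _ _ D) as [S1 E].
  set (H1 := central 1 w). set (K := CPSeries (CPS_derive _) w) in *.
  replace (_ + _)%C with ((H1 + 2 * (w * K)) + w / 2 * (H1 + w * K))%C by field.
  rewrite E; unfold H1, central, CPSeries.
  set (c := fun n => (central_coef 1 n * w ^ n)%C) in *.
  set (d := fun n => (INR n * central_coef 1 n * w ^ n)%C) in *.
  (* The coefficient recurrence multiplied by w^(n+1)/2; only the constant term 1 survives in the
     sum. *)
  assert (Z : forall n, (c (S n) + 2 * d (S n) + w / 2 * (c n + d n) = 0)%C).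
  { intros n; unfold c, d; generalize (f_equal RtoC (central_coef_1_succ n)).
    rewrite S_INR, !RtoC_mult, !RtoC_opp, !RtoC_plus, !RtoC_mult; intros Z; simpl.
    transitivity ((2 * (2 * INR n + 3) * central_coef 1 (S n)
                   - - (INR n + 1) * central_coef 1 n) * (w / 2 * w ^ n))%C; [field|].
    rewrite Z; field. }
  assert (Sc := proj1 (Csummable_incr_1 _) S0). assert (Sd := proj1 (Csummable_incr_1 _) S1).
  assert (Scd := Csummable_plus _ _ S0 S1).
  rewrite <- (CSeries_plus _ _ S0 S1), <- (CSeries_scal (w / 2)%C _ Scd).
  rewrite (CSeries_incr_1 c), (CSeries_incr_1 d) by assumption.
  replace (c 0%nat) with (RtoC 1).
  2:{ unfold c, central_coef, Binomial.C; simpl. rewrite Cmult_1_r. f_equal; field. }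
  replace (d 0%nat) with (RtoC 0) by (unfold d; simpl; ring).
  transitivity (1 + (CSeries (fun n => c (S n)) + 2 * CSeries (fun n => d (S n))
    + CSeries (fun n => w / 2 * (c n + d n))))%C; [ring|].
  assert (S2 := Csummable_scal 2 _ Sd).
  rewrite <- (CSeries_scal 2 _ Sd), <- (CSeries_plus _ _ Sc S2),
    <- (CSeries_plus _ _ (Csummable_plus _ _ Sc S2) (Csummable_scal (w / 2)%C _ Scd)).
  rewrite (CSeries_ext _ (fun _ => RtoC 0)) by assumption.
  assert (Z0 : CSeries (fun _ => RtoC 0) = 0%C).
  { rewrite (CSeries_ext _ (fun n => 0 * c n)%C) by (intros n; ring).
    rewrite CSeries_scal by assumption; ring. }
  rewrite Z0; ring.
Qed.

Lemma is_Cderive_central (s : nat) (y : R -> C) (t : R) (dy : C) :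
  is_Cderive y t dy -> Cmod (y t * y t)%C < 4 ->
  is_Cderive (fun u => y u * central (S (S s)) (y u * y u))%C t
    (dy * central (S s) (y t * y t))%C.
Proof.
  intros Hy Hd; eapply is_Cderive_val.
  - apply is_Cderive_mult; [exact Hy|].
    apply (is_Cderive_CPSeries _ (fun u => y u * y u)%C).
    + apply is_Cderive_mult; exact Hy.
    + now apply central_in_disk.
  - rewrite <- central_derive by assumption. unfold central; ring.
Qed.

(** [Q] is a branch of sqrt(1 + y^2/4) along the curve, given with its derivative; in the
    applications it is a rational function of the parameter. *)
Lemma is_Cderive_central_1 (y Q : R -> C) (t : R) (dy : C) :
  is_Cderive y t dy -> is_Cderive Q t (y t * dy / (4 * Q t))%C ->
  Cmod (y t * y t)%C < 4 -> (Q t * Q t = 1 + y t * y t / 4)%C -> Q t <> 0%C ->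
  is_Cderive (fun u => y u * central 1 (y u * y u) * Q u)%C t (dy / Q t)%C.
Proof.
  intros Hy HQ Hd EQ HQ0; eapply is_Cderive_val.
  - apply is_Cderive_mult; [|exact HQ]. apply is_Cderive_mult; [exact Hy|].
    apply (is_Cderive_CPSeries _ (fun u => y u * y u)%C).
    + apply is_Cderive_mult; exact Hy.
    + now apply central_in_disk.
  - generalize (central_ode _ Hd); unfold central.
    set (H1 := CPSeries _ (y t * y t)%C). set (K := CPSeries (CPS_derive _) _).
    rewrite <- EQ; intros E.
    transitivity (dy / Q t * (Q t * Q t * (H1 + 2 * (y t * y t) * K) + y t * y t / 4 * H1))%C;
      [field; assumption|].
    rewrite E; field; assumption.
Qed.

(** * Evaluation of the series *)

(** The odd series in y at a real argument, taken from the complex series so that the differential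
    relations are shared. *)
Definition central_re (s : nat) (y : R) : R := y * Re (central s (RtoC y * RtoC y)%C).

Lemma Cmod_sqr_RtoC (y : R) : -2 < y < 2 -> Cmod (RtoC y * RtoC y)%C < 4.
Proof. intros H; rewrite <- RtoC_mult, Cmod_R, Rabs_pos_eq; nra. Qed.

Lemma is_derive_central_re (s : nat) (y : R -> R) (t dy : R) :
  is_derive y t dy -> -2 < y t < 2 -> y t <> 0 ->
  is_derive (fun u => central_re (S (S s)) (y u)) t (central_re (S s) (y t) * dy / y t).
Proof.
  intros Hy Hd H0.
  destruct (is_Cderive_central s _ t _ (is_Cderive_RtoC_comp y t dy Hy) (Cmod_sqr_RtoC _ Hd))
    as [H _].
  rewrite re_scal_l in H. eapply is_derive_ext; [|evar_last; [exact H|]].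
  - intros u; cbv beta; unfold central_re. now rewrite re_scal_l.
  - unfold central_re; field; assumption.
Qed.

Lemma is_derive_central_re_1 (y Q : R -> R) (t dy : R) :
  is_derive y t dy -> is_derive Q t (y t * dy / (4 * Q t)) -> -2 < y t < 2 ->
  Q t * Q t = 1 + y t * y t / 4 -> Q t <> 0 ->
  is_derive (fun u => central_re 1 (y u) * Q u) t (dy / Q t).
Proof.
  intros Hy HQ Hd E H0.
  destruct (is_Cderive_central_1 (fun u => RtoC (y u)) (fun u => RtoC (Q u)) t (RtoC dy)) as [H _].
  - now apply is_Cderive_RtoC_comp.
  - eapply is_Cderive_val; [apply is_Cderive_RtoC_comp; exact HQ|].
    rewrite RtoC_div, !RtoC_mult by lra; reflexivity.
  - now apply Cmod_sqr_RtoC.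
  - rewrite <- !RtoC_mult, E, RtoC_plus, RtoC_div by lra; reflexivity.
  - intros E0; apply H0; now injection E0.
  - eapply is_derive_ext; [|evar_last; [exact H|]].
    + intros u; cbv beta; unfold central_re. now rewrite re_scal_r, re_scal_l.
    + now rewrite <- RtoC_div by assumption.
Qed.

(* With [v = tanh (t / 2)] this is the argument [2 sinh t]. *)
Definition ypar (v : R) : R := 4 * v / (1 - v * v).

(** The bound 1/4 exceeds phi^-3 = 0.236..., where the formulas are evaluated, and keeps y below the
    radius 2. *)
Lemma ypar_bound (v : R) : 0 <= v <= 1 / 4 -> 0 <= ypar v < 2 /\ (0 < v -> 0 < ypar v).
Proof.
  intros H; unfold ypar; repeat split.
  - apply Rdiv_le_0_compat; nra.
  - apply Rlt_div_l; nra.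
  - intros; apply Rdiv_lt_0_compat; nra.
Qed.

Lemma is_derive_ypar (v : R) : 0 <= v <= 1 / 4 ->
  is_derive ypar v (4 * (1 + v * v) / ((1 - v * v) * (1 - v * v))).
Proof. intros H; unfold ypar; auto_derive; [nra|]. field; nra. Qed.

(** With v = tanh(t/2), the factor (1+v^2)/(1-v^2) is cosh t = sqrt(1 + y^2/4), so the product with
    it has differential dy/cosh t = 2 dt, where t = ln(1+v) - ln(1-v). *)
Lemma central_re_1 (v : R) : 0 <= v <= 1 / 4 ->
  central_re 1 (ypar v) = 2 * (ln (1 + v) - ln (1 - v)) * (1 - v * v) / (1 + v * v).
Proof.
  intros Hv.
  pose (f := fun u => central_re 1 (ypar u) * ((1 + u * u) / (1 - u * u))
                      - 2 * (ln (1 + u) - ln (1 - u))).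
  enough (f v = f 0) as E.
  { unfold f in E. replace (ypar 0) with 0 in E by (unfold ypar; field).
    unfold central_re at 2 in E. rewrite Rplus_0_r, Rminus_0_r, ln_1 in E.
    rewrite !Rmult_0_l in E.
    replace (central_re 1 (ypar v)) with
      (central_re 1 (ypar v) * ((1 + v * v) / (1 - v * v)) * ((1 - v * v) / (1 + v * v)))
      by (field; nra).
    replace (central_re 1 (ypar v) * ((1 + v * v) / (1 - v * v)))
      with (2 * (ln (1 + v) - ln (1 - v))) by lra. field; nra. }
  destruct (Req_dec v 0) as [->|H0]; [reflexivity|].
  assert (D : forall t, 0 <= t <= v -> is_derive f t 0).
  { intros t Ht; unfold f.
    replace 0 with (4 * (1 + t * t) / ((1 - t * t) * (1 - t * t)) / ((1 + t * t) / (1 - t * t))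
      - 2 * (/ (1 + t) + / (1 - t))) by (field; repeat split; nra).
    apply (is_derive_minus (V := R_NormedModule)).
    - apply (is_derive_central_re_1 ypar (fun u => (1 + u * u) / (1 - u * u))).
      + apply is_derive_ypar; lra.
      + unfold ypar; auto_derive; [nra|]. field; repeat split; nra.
      + generalize (ypar_bound t ltac:(lra)); lra.
      + unfold ypar; field; nra.
      + apply Rgt_not_eq, Rdiv_lt_0_compat; nra.
    - auto_derive; [lra|]. field; lra. }
  apply eq_of_derive_0; [lra | intros; apply D; lra |].
  intros t Ht; apply (ex_derive_continuous (V := R_NormedModule)); eexists; now apply D.
Qed.

Lemma continuous_central_re (s : nat) (t : R) : 0 <= t <= 1 / 4 ->
  continuous (fun u => central_re (S s) (ypar u)) t.
Proof.
  intros Ht; unfold central_re.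
  apply (continuous_mult (K := R_AbsRing) ypar).
  - apply (ex_derive_continuous (V := R_NormedModule) ypar).
    eexists; exact (is_derive_ypar t Ht).
  - apply (ex_derive_continuous (V := R_NormedModule)
      (fun u => Re (central (S s) (RtoC (ypar u) * RtoC (ypar u))%C))).
    destruct (is_Cderive_CPSeries (fun n => RtoC (central_coef (S s) n))
      (fun u => RtoC (ypar u) * RtoC (ypar u))%C t
      (RtoC (4 * (1 + t * t) / ((1 - t * t) * (1 - t * t))) * RtoC (ypar t)
       + RtoC (ypar t) * RtoC (4 * (1 + t * t) / ((1 - t * t) * (1 - t * t))))%C) as [H _].
    + apply (is_Cderive_mult (fun u => RtoC (ypar u)) (fun u => RtoC (ypar u)));
        exact (is_Cderive_RtoC_comp ypar _ _ (is_derive_ypar t Ht)).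
    + apply central_in_disk, Cmod_sqr_RtoC. generalize (ypar_bound t Ht); lra.
    + eexists; exact H.
Qed.

(** The form d log y times (1-v^2)/(1+v^2) is dv/v, so the derivative is 2 (ln(1+v) - ln(1-v))/v. *)
Lemma central_re_2 (v : R) : 0 <= v <= 1 / 4 ->
  central_re 2 (ypar v) = 2 * (dilog v - dilog (- v)).
Proof.
  intros Hv.
  pose (f := fun u => central_re 2 (ypar u) - 2 * (dilog u - dilog (- u))).
  enough (f v = f 0) as E.
  { unfold f in E. replace (ypar 0) with 0 in E by (unfold ypar; field).
    unfold central_re at 2 in E. rewrite Ropp_0, dilog_0 in E; lra. }
  destruct (Req_dec v 0) as [->|H0]; [reflexivity|].
  apply eq_of_derive_0; [lra| |]; unfold f; intros t Ht.
  - destruct (ypar_bound t ltac:(lra)) as [B1 B2].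
    apply (is_derive_ext_loc (fun u => central_re 2 (ypar u) - 2 * (dilog u - dilog (- u))));
      [now apply filter_forall|].
    evar_last.
    + apply (is_derive_minus (V := R_NormedModule)).
      * apply is_derive_central_re; [apply is_derive_ypar; lra | lra |].
        generalize (B2 ltac:(lra)); lra.
      * auto_derive; [repeat split; lra | reflexivity].
    + match goal with |- minus ?a ?b = ?c => change (a - b = c) end.
      rewrite central_re_1 by lra. unfold ypar.
      replace (1 - - t) with (1 + t) by ring.
      field; repeat split; nra.
  - apply (continuous_minus (V := R_NormedModule)); [apply continuous_central_re; lra | cont].
Qed.

(** Here d log y = (1/v + 1/(1-v) - 1/(1+v)) dv is integrated against 2 (Li_2(v) - Li_2(-v)). The
    arguments -v/(1-v) and v/(1+v) have logarithmic derivatives 1/v + 1/(1-v) and 1/v - 1/(1+v), and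
    Landen's identity turns their dilogarithms into those of v and -v. *)
Lemma central_re_3 (v : R) : 0 <= v <= 1 / 4 ->
  central_re 3 (ypar v) =
    - 2 * trilog v + 2 * trilog (- v) - 4 * trilog (- v / (1 - v)) + 4 * trilog (v / (1 + v))
    + 2 * (ln (1 - v) - ln (1 + v)) * (dilog v + dilog (- v))
    + 2 / 3 * (ln (1 - v) ^ 3 - ln (1 + v) ^ 3).
Proof.
  intros Hv.
  pose (g := fun v => - 2 * trilog v + 2 * trilog (- v) - 4 * trilog (- v / (1 - v))
    + 4 * trilog (v / (1 + v)) + 2 * (ln (1 - v) - ln (1 + v)) * (dilog v + dilog (- v))
    + 2 / 3 * (ln (1 - v) ^ 3 - ln (1 + v) ^ 3)).
  change (central_re 3 (ypar v) = g v).
  enough (central_re 3 (ypar v) - g v = central_re 3 (ypar 0) - g 0) as E.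
  { replace (ypar 0) with 0 in E by (unfold ypar; field).
    unfold central_re at 2, g at 2 in E.
    replace (- 0 / (1 - 0)) with 0 in E by field. replace (0 / (1 + 0)) with 0 in E by field.
    rewrite Ropp_0, dilog_0, trilog_0 in E; rewrite Rplus_0_r, Rminus_0_r in E. lra. }
  destruct (Req_dec v 0) as [->|H0]; [reflexivity|].
  apply (eq_of_derive_0 (fun u => central_re 3 (ypar u) - g u)); [lra| |]; intros t Ht.
  - destruct (ypar_bound t ltac:(lra)) as [B1 B2].
    assert (Hq : - 1 < - t / (1 - t) < 0).
    { split; [apply Rlt_div_r; lra | apply Rlt_div_l; lra]. }
    assert (Hq' : 0 < t / (1 + t) < 1).
    { split; [apply Rlt_div_r; lra | apply Rlt_div_l; lra]. }
    evar_last.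
    + apply (is_derive_minus (V := R_NormedModule)).
      * apply is_derive_central_re; [apply is_derive_ypar; lra | lra |].
        generalize (B2 ltac:(lra)); lra.
      * unfold g; derive_0; [repeat split; lra | reflexivity].
    + match goal with |- minus ?a ?b = ?c => change (a - b = c) end.
      rewrite central_re_2 by lra. unfold ypar.
      (* The substitution x -> -x/(1-x) maps t/(1+t) to -t. *)
      generalize (dilog_landen t ltac:(lra)) (dilog_landen (t / (1 + t))); intros E1 E2.
      replace (- (t / (1 + t)) / (1 - t / (1 + t))) with (- t) in E2 by (field; lra).
      replace (1 - t / (1 + t)) with (/ (1 + t)) in E2 by (field; lra).
      rewrite ln_Rinv in E2 by lra.
      replace (dilog (- t / (1 - t))) with (- ln (1 - t) ^ 2 / 2 - dilog t) by lra.
      replace (dilog (t / (1 + t))) with (- (- ln (1 + t)) ^ 2 / 2 - dilog (- t)).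
      2:{ rewrite <- E2; [ring|]. split; [lra|]. apply Rle_div_l; lra. }
      replace (1 - - t) with (1 + t) by ring.
      field; repeat split; nra.
  - apply (continuous_minus (V := R_NormedModule)); [apply continuous_central_re; lra | unfold g; cont; lra].
Qed.

(** * The closed form at v = phi^-3 *)

Lemma phi_sqr : phi * phi = phi + 1.
Proof.
  unfold phi; generalize (sqrt_sqrt 5 ltac:(lra)); intros E.
  replace ((1 + sqrt 5) / 2 * ((1 + sqrt 5) / 2)) with ((1 + 2 * sqrt 5 + sqrt 5 * sqrt 5) / 4)
    by field. rewrite E; field.
Qed.

Lemma phi_bounds : 1.61 < phi < 1.62.
Proof.
  assert (0 < phi) by (unfold phi; generalize (sqrt_pos 5); lra).
  generalize phi_sqr; nra.
Qed.

(* [phi] satisfies [1 - phi^-1 = phi^-2], [1 - phi^-3 = 2 phi^-2], [1 + phi^-3 = 2 phi^-1]. *)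
Lemma is_series_lhs_term : is_series lhs_term rhs_value.
Proof.
  assert (Hs : ex_series lhs_term).
  { apply (ex_series_dominated _ (fun n => (/ 4) ^ n)); [|apply ex_series_geom; rewrite Rabs_pos_eq; lra].
    intros n; apply (Rmult_le_reg_r (4 ^ n)); [apply pow_lt; lra|].
    rewrite <- Rpow_mult_distr, Rinv_l, pow1 by lra. exact (central_coef_bound 2 n). }
  replace rhs_value with (Series lhs_term); [now apply Series_correct|].
  generalize phi_sqr phi_bounds; intros Hp Hb.
  set (x := / phi). assert (Hx : x * phi = 1) by (unfold x; field; lra).
  assert (Hx1 : 0.61 < x < 0.622) by nra.
  assert (Hx2 : x * x = 1 - x) by nra.
  assert (Hx3 : / phi ^ 3 = 2 * x - 1).
  { apply (Rmult_eq_reg_r (phi ^ 3)); [|apply pow_nonzero; lra].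
    rewrite Rinv_l by (apply pow_nonzero; lra). simpl; rewrite Rmult_1_r. nra. }
  set (v := 2 * x - 1) in *. assert (Hv : 0.22 < v < 0.25) by (unfold v; lra).
  assert (Lx : ln x = - ell) by (apply ln_Rinv; lra).
  assert (Lx2 : ln (1 - x) = - 2 * ell) by (rewrite <- Hx2, ln_mult by lra; lra).
  assert (Lv : ln v = - 3 * ell).
  { replace v with (x * (1 - x)) by (unfold v; nra). rewrite ln_mult by lra; lra. }
  assert (L1 : ln (1 - v) = lam - 2 * ell).
  { replace (1 - v) with (2 * (1 - x)) by (unfold v; ring).
    rewrite ln_mult by lra; unfold lam; lra. }
  assert (L2 : ln (1 + v) = lam - ell).
  { replace (1 + v) with (2 * x) by (unfold v; ring). rewrite ln_mult by lra; unfold lam; lra. }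
  assert (L3 : ln ((1 - x) / 2) = - 2 * ell - lam) by (rewrite ln_div_pos by lra; unfold lam; lra).
  assert (L4 : ln (1 - (1 - x) / 2) = ell - lam).
  { replace (1 - (1 - x) / 2) with (phi / 2) by (unfold v in *; nra).
    rewrite ln_div_pos by lra; reflexivity. }
  assert (Y : ypar v = 1) by (unfold ypar, v; field_simplify_eq; [nra | unfold v; nra]).
  assert (S3 : Series lhs_term = central_re 3 1).
  { unfold central_re, central, CPSeries; simpl; rewrite Rmult_1_l.
    apply Series_ext; intros n. rewrite <- RtoC_mult, Rmult_1_l, <- RtoC_pow, pow1.
    unfold Re, central_coef, lhs_term; simpl; ring. }
  (* Six trilogarithm relations between nine values. Duplication and the three-term relation at
     phi^-2 give Li_3(phi^-2) and Li_3(phi^-1) + Li_3(-phi^-1); Kummer's relation at v gives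
     Li_3(-v) in terms of Li_3(v) and Li_3(phi^-1). The other three do not determine Li_3(-phi^-1/2)
     and Li_3(phi^-2/2) separately, but they do determine their difference, which is all that the
     series involves. *)
  generalize (central_re_3 v ltac:(lra)) (trilog_kummer (1 - x) ltac:(lra))
    (trilog_three_term (1 - x) ltac:(lra)) (trilog_three_term v ltac:(lra))
    (trilog_three_term ((1 - x) / 2) ltac:(lra)) (trilog_sqr x ltac:(lra))
    (trilog_kummer_sum v ltac:(lra)) (dilog_kummer_sum v ltac:(lra))
    (dilog_landen (1 - x) ltac:(lra)) (dilog_reflect (1 - x) ltac:(lra)) (dilog_sqr x ltac:(lra)).
  rewrite Y, <- S3, trilog_m1, trilog_half, dilog_1, Hx2, L1, L2, Lx2, Lv, L3, L4.
  replace (1 - (1 - x)) with x by ring. rewrite Lx.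
  replace (- v / (1 - v)) with (- (x / 2)) by (unfold v; field_simplify_eq; [nra | lra]).
  replace (v / (1 + v)) with ((1 - x) / 2) by (unfold v; field_simplify_eq; [nra | lra]).
  replace ((1 - x) / (2 * (x * x))) with (1 / 2) by (rewrite Hx2; field; lra).
  replace ((1 - x) / x) with x by (field_simplify_eq; [nra | lra]).
  replace (- (1 - x) / (2 * x)) with (- (x / 2)) by (field_simplify_eq; [nra | lra]).
  replace (/ (2 * x)) with (1 - (1 - x) / 2) by (field_simplify_eq; [nra | lra]).
  replace (- (1 - x) / x) with (- x) by (field_simplify_eq; [nra | lra]).
  replace (1 - v) with (2 * (1 - x)) by (unfold v; ring).
  replace (- ((1 - x) / 2) / (1 - (1 - x) / 2)) with (- v)
    by (unfold v; field_simplify_eq; [nra | lra]).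
  replace (2 * v / (1 + v)) with (1 - x) by (unfold v; field_simplify_eq; [nra | lra]).
  replace ((1 + v) / 2) with x by (unfold v; field).
  replace (4 * v / ((1 + v) * (1 + v))) with x by (unfold v; field_simplify_eq; [nra | lra]).
  unfold rhs_value; rewrite Hx3.
  replace (Li 3 v) with (trilog v) by (apply Lic_id; lra).
  replace (Li 2 v) with (dilog v) by (apply Lic_id; lra).
  fold x; replace (Li 3 x) with (trilog x) by (apply Lic_id; lra).
  replace zeta3 with (trilog 1).
  2:{ unfold trilog; rewrite Lic_id by lra. apply Series_ext; intros n.
      rewrite pow1; unfold Rdiv; ring. }
  rewrite trilog_half, dilog_1. fold lam.
  intros E1 E2 E3 E4 E5 E6 E7 E8 E9 E10 E11.
  (* The dilogarithms of v and -v enter the series with the factor [ell], so this relation is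
     substituted before the linear step. It combines Kummer's relation at v with the values of Li_2
     at phi^-1, phi^-2 and -phi^-1, which the last three relations determine. *)
  replace (dilog (- v)) with (dilog v - PI ^ 2 / 12 + 3 / 2 * ell ^ 2) in E1 by lra.
  lra.
Qed.

(** * Convergence of multiple polylogarithms at roots of unity *)

Definition is_Clim_seq (u : nat -> C) (l : C) : Prop :=
  is_lim_seq (fun n => Re (u n)) (Re l) /\ is_lim_seq (fun n => Im (u n)) (Im l).

Lemma is_Clim_seq_const (c : C) : is_Clim_seq (fun _ => c) c.
Proof. split; apply is_lim_seq_const. Qed.

Lemma is_Clim_seq_plus (u v : nat -> C) (a b : C) :
  is_Clim_seq u a -> is_Clim_seq v b -> is_Clim_seq (fun n => u n + v n)%C (a + b)%C.
Proof. intros [H1 H2] [H3 H4]; split; now apply is_lim_seq_plus'. Qed.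

Lemma is_Clim_seq_scal (c : C) (u : nat -> C) (a : C) :
  is_Clim_seq u a -> is_Clim_seq (fun n => c * u n)%C (c * a)%C.
Proof.
  intros [H1 H2]; split; simpl.
  - apply is_lim_seq_minus'; apply is_lim_seq_mult'; try assumption; apply is_lim_seq_const.
  - apply is_lim_seq_plus'; apply is_lim_seq_mult'; try assumption; apply is_lim_seq_const.
Qed.

Lemma is_Clim_seq_ext (u v : nat -> C) (a : C) :
  (forall n, u n = v n) -> is_Clim_seq u a -> is_Clim_seq v a.
Proof.
  intros H [H1 H2]; split; [eapply is_lim_seq_ext; [|exact H1] | eapply is_lim_seq_ext; [|exact H2]];
    intros n; simpl; now rewrite H.
Qed.

Lemma is_Clim_seq_0 (u : nat -> C) (b : nat -> R) :
  (forall n, Cmod (u n) <= b n) -> is_lim_seq b 0 -> is_Clim_seq u 0%C.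
Proof.
  intros H Hb.
  assert (Hb' : is_lim_seq (fun n => - b n) 0).
  { rewrite <- Ropp_0; now apply (is_lim_seq_opp b 0). }
  split; apply (is_lim_seq_le_le (fun n => - b n) _ b); try assumption; intros n.
  - apply Rabs_le_between; eapply Rle_trans; [apply re_le_Cmod | apply H].
  - apply Rabs_le_between; eapply Rle_trans; [apply im_le_Cmod | apply H].
Qed.

Lemma is_Clim_seq_unique (u : nat -> C) (a b : C) : is_Clim_seq u a -> is_Clim_seq u b -> a = b.
Proof.
  intros [H1 H2] [H3 H4]; apply is_lim_seq_unique in H1, H2, H3, H4; apply C_eq; congruence.
Qed.

Fixpoint Csum (a : nat -> C) (n : nat) : C :=
  match n with O => 0%C | S m => (Csum a m + a m)%C end.

Lemma is_Clim_seq_Csum (a : nat -> C) : Csummable a -> is_Clim_seq (Csum a) (CSeries a).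
Proof.
  intros H; split; simpl; apply is_lim_seq_incr_1.
  - apply (is_lim_seq_ext (sum_n (fun n => Re (a n)))).
    + induction n as [|n IH]; [rewrite sum_O; simpl; unfold Re; ring|].
      rewrite sum_Sn, IH; reflexivity.
    + apply Series_correct, Csummable_Re, H.
  - apply (is_lim_seq_ext (sum_n (fun n => Im (a n)))).
    + induction n as [|n IH]; [rewrite sum_O; simpl; unfold Im; ring|].
      rewrite sum_Sn, IH; reflexivity.
    + apply Series_correct, Csummable_Im, H.
Qed.

Lemma mpl_converges_to_Clim (l : list (nat * C)) (v : C) :
  mpl_converges_to l v <-> is_Clim_seq (mpl_part l) v.
Proof.
  unfold mpl_converges_to; split.
  - intros H; split; intros P HP.
    + apply (H (fun z => P (Re z))). destruct HP as [e He]; exists e; intros y [Hy _]; now apply He.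
    + apply (H (fun z => P (Im z))). destruct HP as [e He]; exists e; intros y [_ Hy]; now apply He.
  - intros [H1 H2] P [e He]; unfold filtermap.
    generalize (filter_and (fun n => ball (Re v) e (Re (mpl_part l n)))
      (fun n => ball (Im v) e (Im (mpl_part l n))) (H1 (ball (Re v) e) (locally_ball (Re v) e))
      (H2 (ball (Im v) e) (locally_ball (Im v) e))).
    apply filter_imp; intros n [B1 B2]; apply He; now split.
Qed.

(** The summand of outer index n + 1; truncating the inner sum at n encodes the strict inequality of
    indices. *)
Definition mpl_term (s : nat) (z : C) (r : list (nat * C)) (n : nat) : C :=
  (z ^ S n / (RtoC (INR (S n)) ^ s) * mpl_part r n)%C.

Lemma mpl_part_cons (s : nat) (z : C) (r : list (nat * C)) (n : nat) :
  mpl_part ((s, z) :: r) n = Csum (mpl_term s z r) n.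
Proof. induction n as [|n IH]; [reflexivity|]. simpl Csum; rewrite <- IH; reflexivity. Qed.

Definition unimodular (l : list (nat * C)) : Prop :=
  List.Forall (fun p => (1 <= fst p)%nat /\ Cmod (snd p) = 1) l.

Lemma RtoC_INR_S_neq_0 (n : nat) : RtoC (INR (S n)) <> 0%C.
Proof.
  intros H; apply (f_equal Re) in H; change (INR (S n) = 0) in H.
  generalize (INR_S_ge1 n); lra.
Qed.

Lemma Cmod_mpl_term_le (s : nat) (z : C) (r : list (nat * C)) (n : nat) : Cmod z = 1 ->
  Cmod (mpl_term s z r n) = Cmod (mpl_part r n) / INR (S n) ^ s.
Proof.
  intros Hz; unfold mpl_term.
  assert (RtoC (INR (S n)) ^ s <> 0)%C by apply Cpow_nz, RtoC_INR_S_neq_0.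
  rewrite Cmod_mult, Cmod_div, !Cmod_pow, Hz, pow1, Cmod_R, Rabs_pos_eq by
    (try apply pos_INR; assumption).
  unfold Rdiv; ring.
Qed.

(** The true growth is a power of log n. The coarser sqrt n reproduces itself under summation
    against 1/n and still leaves the summable n^(-3/2) after division by n^2. *)
Lemma mpl_part_bound (l : list (nat * C)) : unimodular l ->
  exists K, 0 <= K /\ forall n, Cmod (mpl_part l n) <= K * sqrt (INR (S n)).
Proof.
  induction 1 as [|[s z] r [Hs Hz] Hr IH].
  - exists 1; split; [lra|]; intros n; simpl mpl_part; rewrite Cmod_1, Rmult_1_l.
    rewrite <- sqrt_1; apply sqrt_le_1_alt, INR_S_ge1.
  - simpl in Hs, Hz; destruct IH as [K [HK IH]]; exists (4 * K); split; [lra|].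
    intros n; rewrite mpl_part_cons; induction n as [|n IHn].
    { simpl Csum; rewrite Cmod_0; apply Rmult_le_pos; [lra | apply sqrt_pos]. }
    simpl Csum; eapply Rle_trans; [apply Cmod_triangle|].
    rewrite Cmod_mpl_term_le by assumption.
    set (b := sqrt (INR (S (S n)))); set (a := sqrt (INR (S n))) in *.
    assert (Ha2 : a * a = INR (S n)) by (apply sqrt_sqrt; generalize (INR_S_ge1 n); lra).
    assert (Hb2 : b * b = INR (S (S n))) by (apply sqrt_sqrt; generalize (INR_S_ge1 (S n)); lra).
    assert (Hab : b * b = a * a + 1) by (rewrite Ha2, Hb2, (S_INR (S n)); ring).
    assert (Ha : 1 <= a) by (unfold a; rewrite <- sqrt_1; apply sqrt_le_1_alt, INR_S_ge1).
    assert (Hb : 0 <= b) by apply sqrt_pos.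
    assert (Ht : Cmod (mpl_part r n) / INR (S n) ^ s <= K / a).
    { apply Rle_trans with (Cmod (mpl_part r n) / INR (S n)).
      - apply Rmult_le_compat_l; [apply Cmod_ge_0|].
        generalize (INR_S_ge1 n); intros H1. apply Rinv_le_contravar; [lra|].
        rewrite <- (pow_1 (INR (S n))) at 1. now apply Rle_pow.
      - apply Rle_div_l; [generalize (INR_S_ge1 n); lra|].
        rewrite <- Ha2. replace (K / a * (a * a)) with (K * a) by (field; lra). apply IH. }
    (* The factor 4 comes from b - a = 1/(a + b) and b <= 3 a. *)
    assert (/ a <= 4 * (b - a)).
    { apply (Rmult_le_reg_l a); [lra|]. rewrite Rinv_r by lra.
      assert (a <= b <= 3 * a) by nra. nra. }
    assert (K / a <= K * (4 * (b - a))) by (apply Rmult_le_compat_l; assumption). lra.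
Qed.

(** For s >= 2 the bound on inner sums gives absolute convergence. For s = 1 and z <> 1 summation by
    parts works, since b n is O(n^(-1/2)) and its differences are O(n^(-3/2)). *)
Lemma mpl_converges (l : list (nat * C)) : unimodular l ->
  (forall s z r, l = (s, z) :: r -> ~ (s = 1%nat /\ z = 1%C)) ->
  exists v, mpl_converges_to l v.
Proof.
  intros Hl H; destruct l as [|[s z] r].
  { exists 1%C; apply mpl_converges_to_Clim, is_Clim_seq_const. }
  specialize (H s z r eq_refl).
  inversion Hl as [|p q [Hs Hz] Hr E]; subst; simpl in Hs, Hz.
  destruct (mpl_part_bound r Hr) as [K [HK B]].
  enough (exists v, is_Clim_seq (Csum (mpl_term s z r)) v) as [v Hv].
  { exists v; apply mpl_converges_to_Clim; revert Hv; apply is_Clim_seq_ext.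
    intros n; symmetry; apply mpl_part_cons. }
  assert (ES : forall c, ex_series (fun n => c * (sqrt (INR (S n)) / INR (S n) ^ 2)))
    by (intros c; apply (ex_series_scal (V := R_NormedModule)), ex_series_sqrt).
  destruct (Nat.eq_dec s 1) as [->|Hs1].
  2:{ eexists; apply is_Clim_seq_Csum.
      eapply Csummable_dominated; [|apply (ES K)].
      intros n; rewrite Cmod_mpl_term_le by assumption.
      generalize (pow_INR_ge1 n 2) (INR_S_ge1 n); intros H2 H1.
      replace (K * (sqrt (INR (S n)) / INR (S n) ^ 2)) with (K * sqrt (INR (S n)) / INR (S n) ^ 2)
        by (field; lra).
      apply Rmult_le_compat; [apply Cmod_ge_0 | | apply B |].
      - left; apply Rinv_0_lt_compat, pow_lt; lra.
      - apply Rinv_le_contravar; [lra|]. apply Rle_pow; [assumption | lia]. }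
  assert (Hz1 : (1 - z)%C <> 0%C).
  { intros E; apply H; split; [reflexivity|]. replace z with (1 - (1 - z))%C by ring.
    rewrite E; ring. }
  pose (b := fun n => (/ RtoC (INR (S n)) * mpl_part r n)%C).
  (* Multiplying by [1 - z] telescopes the powers of [z] and leaves differences of [b]. *)
  assert (E : forall n, Csum (mpl_term 1 z r) n = (/ (1 - z) * (z * b 0%nat + - (z ^ S n * b n)
                + Csum (fun m => z ^ S (S m) * (b (S m) - b m)) n))%C).
  { intros n.
    transitivity (/ (1 - z) * ((1 - z) * Csum (mpl_term 1 z r) n))%C; [now field|].
    f_equal; induction n as [|n IH]; [simpl; ring|].
    simpl Csum at 1; rewrite Cmult_plus_distr_l, IH; simpl Csum.
    replace (mpl_term 1 z r n) with (z ^ S n * b n)%C.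
    2:{ unfold mpl_term, b; rewrite Cpow_1_r; field. apply RtoC_INR_S_neq_0. }
    simpl; ring. }
  assert (Hbn : forall n, Cmod (z ^ S n * b n)%C <= K * / sqrt (INR (S n))).
  { intros n; unfold b; rewrite !Cmod_mult, Cmod_pow, Hz, pow1, Rmult_1_l.
    rewrite Cmod_inv, Cmod_R, Rabs_pos_eq by (try apply pos_INR; apply RtoC_INR_S_neq_0).
    assert (0 < sqrt (INR (S n))) by (apply sqrt_lt_R0; generalize (INR_S_ge1 n); lra).
    replace (K * / sqrt (INR (S n))) with (/ INR (S n) * (K * sqrt (INR (S n)))).
    - apply Rmult_le_compat_l; [|apply B].
      left; apply Rinv_0_lt_compat; generalize (INR_S_ge1 n); lra.
    - rewrite <- (sqrt_sqrt (INR (S n))) at 1 by (generalize (INR_S_ge1 n); lra). field; lra. }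
  (* Consecutive truncations of the inner sum differ by a single term, of order n^(-1/2). *)
  assert (Hdiff : exists K', forall n, Cmod (mpl_part r (S n) - mpl_part r n)%C
            <= K' * sqrt (INR (S n)) / INR (S n)).
  { destruct r as [|[s' z'] r'].
    - exists 0; intros n; simpl mpl_part.
      replace (1 - 1)%C with (RtoC 0) by ring. rewrite Cmod_0; unfold Rdiv; lra.
    - inversion Hr as [|p q [Hs' Hz'] Hr' E']; subst; simpl in Hs', Hz'.
      destruct (mpl_part_bound r' Hr') as [K' [HK' B']]; exists K'; intros n.
      rewrite !mpl_part_cons; simpl Csum.
      match goal with |- Cmod ?e <= _ => replace e with (mpl_term s' z' r' n) by ring end.
      rewrite Cmod_mpl_term_le by assumption.
      generalize (INR_S_ge1 n); intros H1.
      apply Rmult_le_compat; [apply Cmod_ge_0 | | apply B' |].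
      + left; apply Rinv_0_lt_compat, pow_lt; lra.
      + apply Rinv_le_contravar; [lra|].
        rewrite <- (pow_1 (INR (S n))) at 1. now apply Rle_pow. }
  destruct Hdiff as [K' HK'].
  eexists; eapply is_Clim_seq_ext; [intros n; symmetry; apply E|].
  apply is_Clim_seq_scal, is_Clim_seq_plus; [apply is_Clim_seq_plus|].
  - apply is_Clim_seq_const.
  - apply (is_Clim_seq_0 _ (fun n => K * / sqrt (INR (S n)))).
    + intros n; rewrite Cmod_opp; apply Hbn.
    + rewrite <- (Rmult_0_r K). apply (is_lim_seq_scal_l _ K 0), is_lim_seq_inv_sqrt.
  - apply is_Clim_seq_Csum.
    eapply Csummable_dominated; [|apply (ES (Rabs K' + K))].
    intros n; rewrite Cmod_mult, Cmod_pow, Hz, pow1, Rmult_1_l.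
    set (m := INR (S n)). assert (Hm : 1 <= m) by apply INR_S_ge1.
    assert (Em : INR (S (S n)) = m + 1) by apply (S_INR (S n)).
    assert (NZ : RtoC m <> 0%C) by apply RtoC_INR_S_neq_0.
    assert (NZ1 : RtoC (m + 1) <> 0%C) by (rewrite <- Em; apply RtoC_INR_S_neq_0).
    replace (b (S n) - b n)%C with (/ RtoC (m + 1) * (mpl_part r (S n) - mpl_part r n)
      + - (/ (RtoC m * RtoC (m + 1)) * mpl_part r n))%C.
    2:{ unfold b; rewrite Em; fold m. rewrite RtoC_plus in *. field; now split. }
    eapply Rle_trans; [apply Cmod_triangle|].
    rewrite Cmod_opp, !Cmod_mult, !Cmod_inv, Cmod_mult, !Cmod_R
      by (try apply Cmult_neq_0; assumption).
    rewrite !Rabs_pos_eq by lra.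
    assert (Hq : 0 < sqrt m) by (apply sqrt_lt_R0; lra).
    replace ((Rabs K' + K) * (sqrt m / m ^ 2)) with
      (/ m * (Rabs K' * sqrt m / m) + / (m * m) * (K * sqrt m)) by (field; lra).
    apply Rplus_le_compat; apply Rmult_le_compat; try apply Cmod_ge_0.
    + left; apply Rinv_0_lt_compat; lra.
    + apply Rinv_le_contravar; lra.
    + eapply Rle_trans; [apply HK'|]. fold m.
      unfold Rdiv; apply Rmult_le_compat_r; [left; apply Rinv_0_lt_compat; lra|].
      apply Rmult_le_compat_r; [lra | apply Rle_abs].
    + left; apply Rinv_0_lt_compat; nra.
    + apply Rinv_le_contravar; nra.
    + apply B.
Qed.

Lemma is_Clim_seq_mult (u v : nat -> C) (a b : C) :
  is_Clim_seq u a -> is_Clim_seq v b -> is_Clim_seq (fun n => u n * v n)%C (a * b)%C.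
Proof.
  intros [H1 H2] [H3 H4]; split; simpl.
  - apply is_lim_seq_minus'; now apply is_lim_seq_mult'.
  - apply is_lim_seq_plus'; now apply is_lim_seq_mult'.
Qed.

(** * The spaces of multiple polylogarithms at roots of unity *)

(** The three groups correspond to the outer index of the first factor being larger than, smaller
    than or equal to that of the second. The inner [fix] recurses on the second list while the first
    stays unchanged. *)
Fixpoint stuffle (l1 : list (nat * C)) : list (nat * C) -> list (list (nat * C)) :=
  fix aux (l2 : list (nat * C)) : list (list (nat * C)) :=
    match l1, l2 with
    | nil, _ => l2 :: nil
    | _, nil => l1 :: nil
    | (s, z) :: r, (s', z') :: r' =>
        map (cons (s, z)) (stuffle r l2) ++ map (cons (s', z')) (aux r')
        ++ map (cons ((s + s')%nat, (z * z')%C)) (stuffle r r')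
    end.

Definition mpl_sum (ls : list (list (nat * C))) (n : nat) : C :=
  fold_right (fun l acc => (mpl_part l n + acc)%C) 0%C ls.

Lemma mpl_sum_cons (l : list (nat * C)) (ls : list (list (nat * C))) (n : nat) :
  mpl_sum (l :: ls) n = (mpl_part l n + mpl_sum ls n)%C.
Proof. reflexivity. Qed.

Lemma mpl_sum_app (ls ls' : list (list (nat * C))) (n : nat) :
  mpl_sum (ls ++ ls') n = (mpl_sum ls n + mpl_sum ls' n)%C.
Proof. induction ls as [|l ls IH]; simpl; [ring|]. rewrite IH; ring. Qed.

Lemma mpl_sum_map_cons_0 (p : nat * C) (ls : list (list (nat * C))) :
  mpl_sum (map (cons p) ls) 0 = 0%C.
Proof. destruct p; induction ls as [|l ls IH]; simpl in *; [reflexivity|]. rewrite IH; ring. Qed.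

Lemma mpl_sum_map_cons_S (s : nat) (z : C) (ls : list (list (nat * C))) (n : nat) :
  mpl_sum (map (cons (s, z)) ls) (S n) =
  (mpl_sum (map (cons (s, z)) ls) n + z ^ S n / RtoC (INR (S n)) ^ s * mpl_sum ls n)%C.
Proof.
  induction ls as [|l ls IH]; [simpl; ring|].
  cbn [map]; rewrite !mpl_sum_cons, IH, !mpl_part_cons.
  cbn [Csum]; unfold mpl_term; ring.
Qed.

(** Exact at every truncation, so that products of conditionally convergent series follow by passing
    to the limit. The induction on n expands (P + p)(R + r) = PR + pR + Pr + pr for the increments p
    and r. *)
Lemma mpl_part_mult (l1 l2 : list (nat * C)) (n : nat) :
  mpl_sum (stuffle l1 l2) n = (mpl_part l1 n * mpl_part l2 n)%C.
Proof.
  revert l2 n; induction l1 as [|[s z] r IH1]; intros l2.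
  { intros n; destruct l2; simpl; ring. }
  induction l2 as [|[s' z'] r' IH2]; intros n; [simpl; ring|].
  change (stuffle ((s, z) :: r) ((s', z') :: r')) with
    (map (cons (s, z)) (stuffle r ((s', z') :: r')) ++ map (cons (s', z')) (stuffle ((s, z) :: r) r')
     ++ map (cons ((s + s')%nat, (z * z')%C)) (stuffle r r')).
  induction n as [|n IHn].
  - rewrite !mpl_sum_app, !mpl_sum_map_cons_0; simpl; ring.
  - rewrite !mpl_sum_app, !mpl_sum_map_cons_S, IH1, IH1, IH2 in *.
    rewrite (mpl_part_cons s z r (S n)), (mpl_part_cons s' z' r' (S n)); simpl Csum.
    rewrite <- !mpl_part_cons.
    transitivity (mpl_part ((s, z) :: r) n * mpl_part ((s', z') :: r') n
      + z ^ S n / RtoC (INR (S n)) ^ s * (mpl_part r n * mpl_part ((s', z') :: r') n)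
      + z' ^ S n / RtoC (INR (S n)) ^ s' * (mpl_part ((s, z) :: r) n * mpl_part r' n)
      + (z * z') ^ S n / RtoC (INR (S n)) ^ (s + s') * (mpl_part r n * mpl_part r' n))%C.
    { rewrite <- IHn; ring. }
    unfold mpl_term. rewrite Cpow_mult_l, Cpow_add_r.
    assert (NZ := RtoC_INR_S_neq_0 n).
    set (x := (RtoC (INR (S n)) ^ s)%C). set (x' := (RtoC (INR (S n)) ^ s')%C).
    assert (x <> 0%C) by now apply Cpow_nz. assert (x' <> 0%C) by now apply Cpow_nz.
    field; now split.
Qed.

Lemma root_of_unity_Cmod (z : C) (N : nat) : (1 <= N)%nat -> (z ^ N)%C = 1%C -> Cmod z = 1.
Proof.
  intros HN H; apply (f_equal Cmod) in H; rewrite Cmod_pow, Cmod_1 in H.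
  destruct (Rtotal_order (Cmod z) 1) as [Hlt|[E|Hgt]]; [|exact E|].
  - exfalso. assert (Cmod z ^ N < 1); [|lra].
    destruct N as [|N]; [lia|]. apply pow_lt_1_compat; [split; [apply Cmod_ge_0 | assumption] | lia].
  - exfalso. assert (1 < Cmod z ^ N); [|lra]. apply Rlt_pow_R1; [assumption | lia].
Qed.

Lemma admissible_converges (k N : nat) (l : list (nat * C)) : (1 <= N)%nat ->
  admissible k N l -> exists v, mpl_converges_to l v.
Proof.
  intros HN (_ & H & _ & Hh); apply mpl_converges; [|assumption].
  eapply List.Forall_impl; [|exact H]; intros p [H1 H2]; split; [assumption|].
  now apply root_of_unity_Cmod with N.
Qed.

Definition weight (l : list (nat * C)) : nat := fold_right (fun p acc => (fst p + acc)%nat) 0%nat l.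

Definition roots (N : nat) (l : list (nat * C)) : Prop :=
  List.Forall (fun p => (1 <= fst p)%nat /\ (snd p ^ N)%C = 1%C) l.

Lemma stuffle_weight (N : nat) (l1 l2 l : list (nat * C)) :
  roots N l1 -> roots N l2 -> In l (stuffle l1 l2) ->
  roots N l /\ weight l = (weight l1 + weight l2)%nat.
Proof.
  unfold roots; revert l2 l; induction l1 as [|[s z] r IH1]; intros l2.
  { intros l _ H2; destruct l2; simpl; intros [<-|[]]; now split. }
  induction l2 as [|[s' z'] r' IH2]; intros l H1 H2.
  { simpl; intros [<-|[]]; split; [assumption | simpl; lia]. }
  inversion H1 as [|p q A1 A2]; inversion H2 as [|p' q' B1 B2]; subst; simpl in A1, B1.
  change (stuffle ((s, z) :: r) ((s', z') :: r')) with
    (map (cons (s, z)) (stuffle r ((s', z') :: r')) ++ map (cons (s', z')) (stuffle ((s, z) :: r) r')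
     ++ map (cons ((s + s')%nat, (z * z')%C)) (stuffle r r')).
  intros Hl; apply in_app_or in Hl; destruct Hl as [Hl|Hl];
    [|apply in_app_or in Hl; destruct Hl as [Hl|Hl]];
    apply in_map_iff in Hl; destruct Hl as [l' [<- Hl']].
  - destruct (IH1 _ _ A2 H2 Hl') as [C1 C2]; split; [now constructor|]. simpl in *; lia.
  - destruct (IH2 _ H1 B2 Hl') as [C1 C2]; split; [now constructor|]. simpl in *; lia.
  - destruct (IH1 _ _ A2 B2 Hl') as [C1 C2]; split; [|simpl in *; lia].
    constructor; [|assumption]; simpl; split; [lia|].
    rewrite Cpow_mult_l; destruct A1 as [_ ->], B1 as [_ ->]; ring.
Qed.

(** The head of a quasi-shuffle term is the head of one factor or has exponent at least 2, so the
    pair (1, 1) cannot arise. *)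
Lemma stuffle_admissible (j k N : nat) (l1 l2 l : list (nat * C)) :
  admissible j N l1 -> admissible k N l2 -> In l (stuffle l1 l2) -> admissible (j + k) N l.
Proof.
  intros (N1 & R1 & W1 & F1) (N2 & R2 & W2 & F2) Hl.
  destruct (stuffle_weight N l1 l2 l R1 R2 Hl) as [R W].
  split; [|split; [exact R | split; [unfold weight in *; lia|]]].
  - destruct l1 as [|[s z] r]; [easy|]. destruct l2 as [|[s' z'] r']; [easy|].
    intros ->; simpl in Hl.
    apply in_app_or in Hl; destruct Hl as [Hl|Hl];
      [|apply in_app_or in Hl; destruct Hl as [Hl|Hl]];
      apply in_map_iff in Hl; destruct Hl as [l' [Hl' _]]; discriminate.
  - destruct l1 as [|[s z] r]; [easy|]. destruct l2 as [|[s' z'] r']; [easy|].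
    inversion R1 as [|p q [A1 _] _]; inversion R2 as [|p' q' [B1 _] _]; subst; simpl in A1, B1.
    intros s0 z0 r0 ->.
    simpl in Hl; apply in_app_or in Hl; destruct Hl as [Hl|Hl];
      [|apply in_app_or in Hl; destruct Hl as [Hl|Hl]];
      apply in_map_iff in Hl; destruct Hl as [l' [Hl' _]]; injection Hl' as <- <- _.
    + now apply (F1 _ _ _ eq_refl).
    + now apply (F2 _ _ _ eq_refl).
    + lia.
Qed.

Lemma in_frakZ_0 (k N : nat) : in_frakZ k N 0%C.
Proof. exists nil; split; [constructor | reflexivity]. Qed.

Lemma in_frakZ_plus (k N : nat) (x y : C) :
  in_frakZ k N x -> in_frakZ k N y -> in_frakZ k N (x + y)%C.
Proof.
  intros [t1 [H1 ->]] [t2 [H2 ->]]; exists (t1 ++ t2); split; [now apply Forall_app|].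
  clear H1 H2; induction t1 as [|[[q l] v] t1 IH]; simpl; [ring|]. rewrite <- IH; ring.
Qed.

Lemma in_frakZ_scal (k N : nat) (q : Q) (x : C) :
  in_frakZ k N x -> in_frakZ k N (RtoC (Q2R q) * x)%C.
Proof.
  intros [t [H ->]].
  exists (map (fun t => let '(q', l, v) := t in ((q * q')%Q, l, v)) t); split.
  - induction H as [|[[q' l] v] t H1 _ IH]; simpl; constructor; assumption.
  - clear H; induction t as [|[[q' l] v] t IH]; simpl; [ring|].
    rewrite <- IH, Q2R_mult, RtoC_mult; ring.
Qed.

Lemma in_frakZ_mpl (k N : nat) (l : list (nat * C)) (v : C) :
  admissible k N l -> mpl_converges_to l v -> in_frakZ k N v.
Proof.
  intros Hl Hv; exists ((1%Q, l, v) :: nil); split.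
  - constructor; [now split | constructor].
  - simpl; unfold Q2R; simpl. replace (1 * / 1) with 1 by field. ring.
Qed.

Lemma in_frakZ_mpl_mult (j k N : nat) (l1 l2 : list (nat * C)) (v1 v2 : C) : (1 <= N)%nat ->
  admissible j N l1 -> admissible k N l2 -> mpl_converges_to l1 v1 -> mpl_converges_to l2 v2 ->
  in_frakZ (j + k) N (v1 * v2)%C.
Proof.
  intros HN A1 A2 C1 C2.
  assert (G : forall ls, (forall l, In l ls -> admissible (j + k) N l) ->
    exists v, is_Clim_seq (mpl_sum ls) v /\ in_frakZ (j + k) N v).
  { induction ls as [|l ls IH]; intros H.
    - exists 0%C; split; [apply is_Clim_seq_const | apply in_frakZ_0].
    - destruct IH as [v [Hv Zv]]; [intros l' Hl'; apply H; now right|].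
      assert (Al : admissible (j + k) N l) by (apply H; now left).
      destruct (admissible_converges _ _ _ HN Al) as [w Hw].
      exists (w + v)%C; split.
      + apply is_Clim_seq_plus; [now apply mpl_converges_to_Clim | assumption].
      + apply in_frakZ_plus; [now apply in_frakZ_mpl with l | assumption]. }
  destruct (G (stuffle l1 l2)) as [v [Hv Zv]].
  { intros l Hl; now apply (stuffle_admissible j k N l1 l2). }
  replace (v1 * v2)%C with v; [assumption|].
  apply (is_Clim_seq_unique _ _ _ Hv).
  apply (is_Clim_seq_ext (fun n => mpl_part l1 n * mpl_part l2 n)%C).
  - intros n; symmetry; apply mpl_part_mult.
  - apply is_Clim_seq_mult; now apply mpl_converges_to_Clim.
Qed.

Lemma in_frakZ_ext (k N : nat) (x y : C) : x = y -> in_frakZ k N x -> in_frakZ k N y.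
Proof. now intros ->. Qed.

Lemma in_frakZ_mult (j k N : nat) (x y : C) : (1 <= N)%nat ->
  in_frakZ j N x -> in_frakZ k N y -> in_frakZ (j + k) N (x * y)%C.
Proof.
  intros HN [t1 [H1 ->]] [t2 [H2 ->]].
  induction H1 as [|[[q1 l1] v1] t1 [A1 C1] _ IH1]; simpl.
  - apply (in_frakZ_ext _ _ 0%C); [ring | apply in_frakZ_0].
  - rewrite Cmult_plus_distr_r; apply in_frakZ_plus; [|exact IH1]. clear IH1.
    induction H2 as [|[[q2 l2] v2] t2 [A2 C2] _ IH2]; simpl.
    + apply (in_frakZ_ext _ _ 0%C); [ring | apply in_frakZ_0].
    + rewrite Cmult_plus_distr_l; apply in_frakZ_plus; [|exact IH2].
      apply (in_frakZ_ext _ _ (RtoC (Q2R q1) * (RtoC (Q2R q2) * (v1 * v2)))%C); [ring|].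
      do 2 apply in_frakZ_scal. now apply in_frakZ_mpl_mult with l1 l2.
Qed.

(** * Iterated integrals *)

Definition mpl_coef (z : C) (r : list (nat * C)) (n : nat) : C :=
  match n with O => 0%C | S m => mpl_term 1 z r m end.

(** Expanding the geometric series produces a_1^(n_1 - n_2) a_2^(n_2 - n_3) ..., hence successive
    quotients as arguments. All exponents are 1 because the letter dt/t does not occur. *)
Fixpoint word_tail (a : C) (w : list C) : list (nat * C) :=
  match w with nil => nil | b :: w' => (1%nat, (b / a)%C) :: word_tail b w' end.

Definition word_index (w : list C) : list (nat * C) :=
  match w with nil => nil | a :: w' => (1%nat, a) :: word_tail a w' end.

(* The iterated integral of [a_1 dt / (1 - a_1 t), ..., a_m dt / (1 - a_m t)] from [0] to [t]. *)
Definition iter_int (w : list C) (t : R) : C :=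
  match w with nil => 1%C | a :: w' => CPSeries (mpl_coef a (word_tail a w')) (RtoC t) end.

Definition unit_letters (w : list C) : Prop := List.Forall (fun a => Cmod a = 1) w.

Lemma Cmod_1_neq_0 (a : C) : Cmod a = 1 -> a <> 0%C.
Proof. intros H ->; rewrite Cmod_0 in H; lra. Qed.

Lemma unimodular_word_tail (a : C) (w : list C) :
  Cmod a = 1 -> unit_letters w -> unimodular (word_tail a w).
Proof.
  intros Ha Hw; revert a Ha; induction Hw as [|b w Hb _ IH]; intros a Ha; [constructor|].
  constructor; [|now apply IH]. simpl; split; [lia|].
  rewrite Cmod_div, Ha, Hb by now apply Cmod_1_neq_0. field.
Qed.

Lemma mpl_coef_bound (z : C) (r : list (nat * C)) : Cmod z = 1 -> unimodular r ->
  exists K, forall n, Cmod (mpl_coef z r n) <= K.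
Proof.
  intros Hz Hr; destruct (mpl_part_bound r Hr) as [K [HK B]]; exists K; intros [|n]; simpl.
  { rewrite Cmod_0; assumption. }
  rewrite Cmod_mpl_term_le by assumption.
  generalize (INR_S_ge1 n); intros H1; rewrite pow_1; apply Rle_div_l; [lra|].
  eapply Rle_trans; [apply B|]. apply Rmult_le_compat_l; [assumption|].
  apply Rle_trans with (sqrt (INR (S n) ^ 2)); [|rewrite sqrt_pow2; lra].
  apply sqrt_le_1_alt; nra.
Qed.

Lemma mpl_coef_in_disk (z : C) (r : list (nat * C)) (x : R) : Cmod z = 1 -> unimodular r ->
  0 <= x < 1 -> in_disk (mpl_coef z r) x.
Proof.
  intros Hz Hr Hx; destruct (mpl_coef_bound z r Hz Hr) as [K HK].
  apply (in_disk_bounded _ 1 _ K); [|assumption].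
  intros n; rewrite pow1, Rmult_1_r; apply HK.
Qed.

Lemma one_minus_neq_0 (a : C) (t : R) : Cmod a = 1 -> Rabs t < 1 -> (1 - a * t <> 0)%C.
Proof.
  intros Ha Ht E; assert (H : (a * t = 1)%C).
  { transitivity (1 - (1 - a * t))%C; [ring | rewrite E; ring]. }
  apply (f_equal Cmod) in H; rewrite Cmod_mult, Ha, Cmod_R, Cmod_1 in H; lra.
Qed.

(** The derivative has coefficients a^(n+1) times truncated inner sums. Multiplying by 1 - a t takes
    differences of these sums, which leaves a times the series of the shorter word. *)
Lemma is_Cderive_iter_int (a : C) (w : list C) (t : R) :
  Cmod a = 1 -> unit_letters w -> Rabs t < 1 ->
  is_Cderive (iter_int (a :: w)) t (a / (1 - a * t) * iter_int w t)%C.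
Proof.
  intros Ha Hw Ht.
  assert (Hr := unimodular_word_tail a w Ha Hw).
  assert (Dk : forall z r, Cmod z = 1 -> unimodular r -> in_disk (mpl_coef z r) (Cmod t)).
  { intros z r Hz Hr'; rewrite Cmod_R; apply mpl_coef_in_disk; try assumption.
    split; [apply Rabs_pos | assumption]. }
  eapply is_Cderive_val.
  { apply (is_Cderive_CPSeries _ RtoC); [apply is_Cderive_RtoC | now apply Dk]. }
  rewrite Cmult_1_r.
  pose (d := fun n => (a ^ S n * mpl_part (word_tail a w) n * t ^ n)%C).
  assert (Ed : forall n, (CPS_derive (mpl_coef a (word_tail a w)) n * t ^ n)%C = d n).
  { intros n; unfold CPS_derive, mpl_coef, mpl_term, d; rewrite Cpow_1_r; field.
    apply RtoC_INR_S_neq_0. }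
  assert (Sd : Csummable d).
  { eapply ex_series_ext; [|exact (in_disk_summable _ _ (in_disk_derive _ _ (Dk _ _ Ha Hr)))].
    intros n; apply (f_equal Cmod), Ed. }
  unfold CPSeries at 1; rewrite (CSeries_ext _ d Ed).
  enough (E : ((1 - a * t) * CSeries d = a * iter_int w t)%C).
  { transitivity ((1 - a * t) * CSeries d / (1 - a * t))%C;
      [field; now apply one_minus_neq_0 | rewrite E; field; now apply one_minus_neq_0]. }
  assert (Sd' := proj1 (Csummable_incr_1 _) Sd).
  transitivity (d 0%nat + CSeries (fun n => d (S n) - a * t * d n))%C.
  { rewrite (CSeries_minus (fun n => d (S n)) (fun n => a * t * d n)%C Sd'
      (Csummable_scal (a * t)%C d Sd)).
    rewrite (CSeries_scal (a * t)%C d Sd).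
    rewrite (CSeries_incr_1 d Sd) at 1.
    transitivity (d 0%nat + CSeries (fun n => d (S n)) - a * t * CSeries d)%C; [|ring].
    rewrite (CSeries_incr_1 d Sd); ring. }
  destruct w as [|b w]; simpl iter_int; unfold d at 1; simpl (word_tail _ _).
  - rewrite (CSeries_ext _ (fun n => 0 * d n)%C) by (intros n; unfold d; simpl; ring).
    rewrite CSeries_scal by assumption; simpl; ring.
  - inversion Hw as [|b' w' Hb Hw']; subst. assert (Ha0 := Cmod_1_neq_0 a Ha).
    assert (Dc := Dk _ _ Hb (unimodular_word_tail b w Hb Hw')).
    assert (Sc := in_disk_summable _ _ Dc).
    unfold CPSeries; rewrite (CSeries_incr_1 _ Sc).
    rewrite (CSeries_ext _ (fun n => a * (mpl_coef b (word_tail b w) (S n) * t ^ S n))%C).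
    + rewrite (CSeries_scal a _ (proj1 (Csummable_incr_1 _) Sc)). simpl; ring.
    + intros n; unfold d; simpl (word_tail _ _); rewrite (mpl_part_cons 1 _ _ (S n)), (mpl_part_cons 1 _ _ n).
      simpl Csum; simpl mpl_coef; unfold mpl_term.
      replace ((b / a) ^ S n)%C with (b ^ S n / a ^ S n)%C.
      2:{ unfold Cdiv; now rewrite Cpow_mult_l, (Cpow_inv a _ Ha0). }
      rewrite (Cpow_S a (S n)), (Cpow_S t n); field; split.
      * apply RtoC_INR_S_neq_0.
      * now apply Cpow_nz.
Qed.

Lemma iter_int_0 (a : C) (w : list C) : Cmod a = 1 -> unit_letters w -> iter_int (a :: w) 0 = 0%C.
Proof.
  intros Ha Hw; simpl; unfold CPSeries; rewrite CSeries_incr_1.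
  - rewrite (CSeries_ext _ (fun n => 0 * (mpl_coef a (word_tail a w) n * 0 ^ n))%C)
      by (intros n; simpl; ring).
    rewrite CSeries_scal; [simpl; ring|].
    apply in_disk_summable; rewrite Cmod_0; apply mpl_coef_in_disk;
      [assumption | now apply unimodular_word_tail | lra].
  - apply in_disk_summable; rewrite Cmod_0; apply mpl_coef_in_disk;
      [assumption | now apply unimodular_word_tail | lra].
Qed.

(** * Boundary values at t = 1 *)

Definition tends_to_1 (n : nat) : R := 1 - / INR (S (S n)).

(** Left limits are taken along 1 - 1/(n+2), a sequence in [1/2, 1), so that the rules for limits of
    sequences apply. *)
Definition is_Cleft_lim (f : R -> C) (v : C) : Prop := is_Clim_seq (fun n => f (tends_to_1 n)) v.

Lemma tends_to_1_bound (n : nat) : 0 <= tends_to_1 n < 1.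
Proof.
  unfold tends_to_1; generalize (INR_S_ge1 (S n)); intros H; split.
  - assert (/ INR (S (S n)) <= / 1) by (apply Rinv_le_contravar; lra). lra.
  - assert (0 < / INR (S (S n))) by (apply Rinv_0_lt_compat; lra). lra.
Qed.

Lemma is_lim_seq_inv_INR : is_lim_seq (fun n => / INR (S (S n))) 0.
Proof.
  apply (is_lim_seq_inv (fun n => INR (S (S n))) p_infty); [|discriminate].
  apply (is_lim_seq_incr_1 (fun n => INR (S n))), (is_lim_seq_incr_1 INR), is_lim_seq_INR.
Qed.

Lemma tends_to_1_lim : is_lim_seq tends_to_1 1.
Proof.
  unfold tends_to_1; replace (Finite 1) with (Finite (1 - 0)) by (f_equal; ring).
  apply is_lim_seq_minus'; [apply is_lim_seq_const | apply is_lim_seq_inv_INR].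
Qed.

Lemma tends_to_1_at_left : filterlim tends_to_1 eventually (at_left 1).
Proof.
  intros P [e He]; destruct (tends_to_1_lim _ (locally_ball 1 e)) as [N HN].
  exists N; intros n Hn; apply He; [now apply HN | apply tends_to_1_bound].
Qed.

(** Abel's theorem applies on the circle of convergence; if the radius exceeds 1 the statement is
    continuity of the sum. *)
Lemma Abel_at_1 (a : nat -> R) (s K : R) : (forall n, Rabs (a n) <= K) -> is_series a s ->
  filterlim (PSeries a) (at_left 1) (locally s).
Proof.
  intros HK Hs.
  assert (E : PSeries a 1 = s).
  { unfold PSeries; apply is_series_unique; eapply is_series_ext; [|exact Hs].
    intros n; simpl; rewrite pow1; ring. }
  assert (R1 : Rbar_le 1 (CV_radius a)).
  { apply (proj1 (CV_radius_bounded a)); exists K; intros n; rewrite pow1, Rmult_1_r; apply HK. }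
  rewrite <- E; destruct (Rbar_le_lt_or_eq_dec _ _ R1) as [Hlt|Heq].
  - assert (Cn : continuous (PSeries a) 1).
    { apply continuity_pt_filterlim, PSeries_continuity; now rewrite Rabs_pos_eq by lra. }
    intros P HP; specialize (Cn P HP); unfold filtermap, at_left, within in *.
    revert Cn; apply filter_imp; now intros.
  - assert (H := Abel a); rewrite <- Heq in H; apply H; simpl; [lra | exact I|].
    exists s; unfold is_pseries. eapply is_series_ext; [|exact Hs].
    intros n; rewrite pow_n_pow, pow1; unfold scal; simpl; unfold mult; simpl; ring.
Qed.

Lemma Re_mul_pow (c : C) (t : R) (n : nat) : Re (c * t ^ n)%C = Re c * t ^ n.
Proof. rewrite <- RtoC_pow; apply re_scal_r. Qed.

Lemma Im_mul_pow (c : C) (t : R) (n : nat) : Im (c * t ^ n)%C = Im c * t ^ n.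
Proof. rewrite <- RtoC_pow, im_mult; simpl; unfold Im; simpl; ring. Qed.

Lemma is_series_of_lim (a u : nat -> R) (l : R) : a 0%nat = 0 ->
  (forall n, sum_n (fun k => a (S k)) n = u (S n)) -> is_lim_seq u l -> is_series a l.
Proof.
  intros H0 H Hu; apply is_series_decr_1; rewrite H0.
  change (is_lim_seq (sum_n (fun k => a (S k))) (l + - 0)). rewrite Ropp_0, Rplus_0_r.
  apply is_lim_seq_incr_1 in Hu; revert Hu; apply is_lim_seq_ext; intros n; now rewrite H.
Qed.

Lemma iter_int_left_lim (a : C) (w : list C) (v : C) : Cmod a = 1 -> unit_letters w ->
  mpl_converges_to (word_index (a :: w)) v -> is_Cleft_lim (iter_int (a :: w)) v.
Proof.
  intros Ha Hw Hv; apply mpl_converges_to_Clim in Hv.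
  destruct (mpl_coef_bound a (word_tail a w) Ha (unimodular_word_tail a w Ha Hw)) as [K HK].
  set (c := mpl_coef a (word_tail a w)) in *.
  assert (Hs : is_Clim_seq (Csum (fun n => c (S n))) v).
  { revert Hv; apply is_Clim_seq_ext; intros n; apply mpl_part_cons. }
  destruct Hs as [H1 H2]; split.
  - apply (is_lim_seq_ext (fun n => PSeries (fun k => Re (c k)) (tends_to_1 n))).
    { intros n; simpl iter_int; unfold CPSeries, PSeries; simpl.
      apply Series_ext; intros k; fold c. symmetry; apply Re_mul_pow. }
    apply (filterlim_comp _ _ _ tends_to_1 _ _ (at_left 1)); [apply tends_to_1_at_left|].
    apply (Abel_at_1 _ _ K).
    { intros n; eapply Rle_trans; [apply re_le_Cmod | apply HK]. }
    apply (is_series_of_lim _ _ _ eq_refl) with (2 := H1).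
    induction n as [|n IH]; [rewrite sum_O; simpl; unfold Re; simpl; ring|].
    rewrite sum_Sn, IH; reflexivity.
  - apply (is_lim_seq_ext (fun n => PSeries (fun k => Im (c k)) (tends_to_1 n))).
    { intros n; simpl iter_int; unfold CPSeries, PSeries; simpl.
      apply Series_ext; intros k; fold c. symmetry; apply Im_mul_pow. }
    apply (filterlim_comp _ _ _ tends_to_1 _ _ (at_left 1)); [apply tends_to_1_at_left|].
    apply (Abel_at_1 _ _ K).
    { intros n; eapply Rle_trans; [apply im_le_Cmod | apply HK]. }
    apply (is_series_of_lim _ _ _ eq_refl) with (2 := H2).
    induction n as [|n IH]; [rewrite sum_O; simpl; unfold Im; simpl; ring|].
    rewrite sum_Sn, IH; reflexivity.
Qed.

Definition comb_int (l : list (Q * list C)) (t : R) : C :=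
  fold_right (fun p acc => (RtoC (Q2R (fst p)) * iter_int (snd p) t + acc)%C) 0%C l.

Definition form (x : list (Q * C)) (t : R) : C :=
  fold_right (fun (p : Q * C) acc => (RtoC (Q2R (fst p)) * (snd p / (1 - snd p * t)) + acc)%C) 0%C x.

(** Bilinear concatenation of letters with words: on iterated integrals, one further integration
    from 0 against [form x]. *)
Definition prepend (x : list (Q * C)) (l : list (Q * list C)) : list (Q * list C) :=
  flat_map (fun p => map (fun q => ((fst p * fst q)%Q, snd p :: snd q)) l) x.

Definition root_letters (N : nat) (w : list C) : Prop := List.Forall (fun a => (a ^ N)%C = 1%C) w.

Definition root_comb (k N : nat) (l : list (Q * list C)) : Prop :=
  List.Forall (fun p => length (snd p) = k /\ root_letters N (snd p)) l.

Definition root_form (N : nat) (x : list (Q * C)) : Prop :=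
  List.Forall (fun p : Q * C => (snd p ^ N)%C = 1%C) x.

Definition regular_form (x : list (Q * C)) : Prop := List.Forall (fun p : Q * C => snd p <> 1%C) x.

Lemma unit_letters_roots (N : nat) (w : list C) : (1 <= N)%nat -> root_letters N w -> unit_letters w.
Proof.
  intros HN; apply List.Forall_impl; intros a; now apply root_of_unity_Cmod.
Qed.

Arguments comb_int : simpl never.
Arguments iter_int : simpl never.

Lemma comb_int_cons (p : Q * list C) (l : list (Q * list C)) (t : R) :
  comb_int (p :: l) t = (RtoC (Q2R (fst p)) * iter_int (snd p) t + comb_int l t)%C.
Proof. reflexivity. Qed.

Lemma comb_int_app (l l' : list (Q * list C)) (t : R) :
  comb_int (l ++ l') t = (comb_int l t + comb_int l' t)%C.
Proof.
  induction l as [|p l IH]; [change (comb_int nil t) with (RtoC 0); simpl; ring|].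
  rewrite <- app_comm_cons, !comb_int_cons, IH; ring.
Qed.

Lemma root_comb_prepend (k N : nat) (x : list (Q * C)) (l : list (Q * list C)) :
  root_form N x -> root_comb k N l -> root_comb (S k) N (prepend x l).
Proof.
  intros Hx Hl; induction Hx as [|[q a] x Ha Hx IH]; simpl in *; [constructor|].
  apply Forall_app; split; [|assumption].
  clear IH; induction Hl as [|[q' w] l [Hk Hw] Hl IH]; simpl in *; constructor; [|assumption].
  simpl; split; [congruence | now constructor].
Qed.

Lemma root_comb_app (k N : nat) (l l' : list (Q * list C)) :
  root_comb k N l -> root_comb k N l' -> root_comb k N (l ++ l').
Proof. intros; now apply Forall_app. Qed.

Lemma comb_int_prepend_0 (k N : nat) (x : list (Q * C)) (l : list (Q * list C)) : (1 <= N)%nat ->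
  root_form N x -> root_comb k N l -> comb_int (prepend x l) 0 = 0%C.
Proof.
  intros HN Hx Hl; induction Hx as [|[q a] x Ha Hx IH]; simpl in *; [reflexivity|].
  rewrite comb_int_app, IH.
  enough (comb_int (map (fun q0 => ((q * fst q0)%Q, a :: snd q0)) l) 0 = 0%C) as -> by ring.
  clear IH; induction Hl as [|[q' w] l [Hk Hw] Hl IH]; [reflexivity|].
  cbn [map]; rewrite comb_int_cons, IH; cbn [fst snd] in *.
  rewrite iter_int_0; [ring | now apply root_of_unity_Cmod with N | now apply unit_letters_roots with N].
Qed.

Lemma is_Cderive_comb_int_prepend (k N : nat) (x : list (Q * C)) (l : list (Q * list C)) (t : R) :
  (1 <= N)%nat -> root_form N x -> root_comb k N l -> Rabs t < 1 ->
  is_Cderive (comb_int (prepend x l)) t (form x t * comb_int l t)%C.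
Proof.
  intros HN Hx Hl Ht; induction Hx as [|[q a] x Ha Hx IH]; simpl in *.
  { apply (is_Cderive_ext (fun _ => RtoC 0)); [reflexivity|].
    eapply is_Cderive_val; [apply is_Cderive_const | ring]. }
  apply (is_Cderive_ext (fun t => comb_int (map (fun q0 => ((q * fst q0)%Q, a :: snd q0)) l) t
    + comb_int (prepend x l) t)%C).
  { intros u; symmetry; apply comb_int_app. }
  rewrite Cmult_plus_distr_r; apply is_Cderive_plus; [|exact IH].
  clear IH; induction Hl as [|[q' w] l [Hk Hw] Hl IH].
  { apply (is_Cderive_ext (fun _ => RtoC 0)); [reflexivity|].
    eapply is_Cderive_val; [apply is_Cderive_const|].
    change (comb_int nil t) with (RtoC 0); ring. }
  simpl in Hw; cbn [map].
  apply (is_Cderive_ext (fun u => RtoC (Q2R (q * q')) * iter_int (a :: w) u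
    + comb_int (map (fun q0 => ((q * fst q0)%Q, a :: snd q0)) l) u)%C); [reflexivity|].
  eapply is_Cderive_val.
  - apply is_Cderive_plus; [|exact IH].
    apply is_Cderive_scal, is_Cderive_iter_int; [now apply root_of_unity_Cmod with N
      | now apply unit_letters_roots with N | assumption].
  - rewrite comb_int_cons; cbn [fst snd]. rewrite Q2R_mult, RtoC_mult; ring.
Qed.

Lemma word_index_admissible (N : nat) (a : C) (w : list C) : (1 <= N)%nat -> a <> 1%C ->
  root_letters N (a :: w) -> admissible (length (a :: w)) N (word_index (a :: w)).
Proof.
  intros HN Ha Hw; split; [easy|]; split; [|split].
  - simpl; inversion Hw as [|a' w' H1 H2]; subst; constructor; [simpl; split; [lia | assumption]|].
    clear Hw Ha; revert a H1; induction H2 as [|b w Hb _ IH]; intros a Ha; simpl; constructor.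
    + simpl; split; [lia|]. unfold Cdiv; rewrite Cpow_mult_l, Cpow_inv, Ha, Hb.
      * field.
      * now apply Cmod_1_neq_0, root_of_unity_Cmod with N.
    + now apply IH.
  - simpl; f_equal; clear; revert a; induction w as [|b w IH]; intros a; simpl; [reflexivity|].
    now rewrite IH.
  - simpl; intros s z r E; injection E as <- <- _; intros [_ E1]; now apply Ha.
Qed.

(** Convergence depends on the outermost letter alone: if it is not 1, the index of the word is
    admissible whatever the other letters are. *)
Lemma comb_int_left_lim (k N : nat) (x : list (Q * C)) (l : list (Q * list C)) : (1 <= N)%nat ->
  root_form N x -> regular_form x -> root_comb k N l ->
  exists v, in_frakZ (S k) N v /\ is_Cleft_lim (comb_int (prepend x l)) v.
Proof.
  intros HN Hx Hr Hl; induction Hx as [|[q a] x Ha Hx IH]; simpl in *.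
  { exists 0%C; split; [apply in_frakZ_0 | apply is_Clim_seq_const]. }
  inversion Hr as [|p y Hra Hr']; subst; simpl in Hra.
  destruct (IH Hr') as [v [Zv Lv]]; clear IH.
  enough (exists u, in_frakZ (S k) N u /\
    is_Cleft_lim (comb_int (map (fun q0 => ((q * fst q0)%Q, a :: snd q0)) l)) u) as [u [Zu Lu]].
  { exists (u + v)%C; split; [now apply in_frakZ_plus|].
    unfold is_Cleft_lim in *; eapply is_Clim_seq_ext; [|apply is_Clim_seq_plus; [exact Lu | exact Lv]].
    intros n; symmetry; apply comb_int_app. }
  clear v Zv Lv; induction Hl as [|[q' w] l [Hk Hw] Hl IH].
  { exists 0%C; split; [apply in_frakZ_0 | apply is_Clim_seq_const]. }
  destruct IH as [u [Zu Lu]]. simpl in Hk, Hw.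
  assert (Hw' : root_letters N (a :: w)) by now constructor.
  assert (Ad := word_index_admissible N a w HN Hra Hw').
  destruct (admissible_converges _ _ _ HN Ad) as [c Hc].
  exists (RtoC (Q2R (q * q')) * c + u)%C; split.
  - apply in_frakZ_plus; [|assumption]. apply in_frakZ_scal.
    rewrite <- Hk; now apply (in_frakZ_mpl (S (length w)) N (word_index (a :: w))).
  - apply (is_Clim_seq_plus (fun n => RtoC (Q2R (q * q')) * iter_int (a :: w) (tends_to_1 n))%C);
      [|exact Lu].
    apply is_Clim_seq_scal. apply iter_int_left_lim; [now apply root_of_unity_Cmod with N | | assumption].
    now apply unit_letters_roots with N.
Qed.

Lemma is_Cleft_lim_continuous (f : R -> C) (l : C) : is_Cderive f 1 l -> is_Cleft_lim f (f 1).
Proof.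
  intros [H1 H2]; split.
  - apply (is_lim_seq_continuous (fun u => Re (f u))); [|exact tends_to_1_lim].
    apply continuity_pt_filterlim, (ex_derive_continuous (V := R_NormedModule) (fun u => Re (f u))).
    eexists; exact H1.
  - apply (is_lim_seq_continuous (fun u => Im (f u))); [|exact tends_to_1_lim].
    apply continuity_pt_filterlim, (ex_derive_continuous (V := R_NormedModule) (fun u => Im (f u))).
    eexists; exact H2.
Qed.

(** The function -log(1 - t), whose powers carry the divergence of words that begin with the letter
    1. *)
Definition log_int : R -> C := iter_int (RtoC 1 :: nil).

Lemma log_int_eq (t : R) : 0 <= t < 1 -> log_int t = RtoC (- ln (1 - t)).
Proof.
  intros Ht.
  assert (E : (log_int t - log_int 0 = RtoC (- ln (1 - t)) - RtoC (- ln (1 - 0)))%C).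
  { apply (is_Cderive_unique_primitive log_int (fun t => RtoC (- ln (1 - t)))
      (fun u => RtoC (/ (1 - u)))); [lra| |]; intros u Hu.
    - eapply is_Cderive_val.
      + apply is_Cderive_iter_int; [apply Cmod_1 | constructor | rewrite Rabs_pos_eq; lra].
      + change (iter_int nil u) with (RtoC 1); rewrite RtoC_inv, RtoC_minus by lra. field.
        intros E; apply (f_equal Re) in E; simpl in E; lra.
    - apply is_Cderive_RtoC_comp; auto_derive; [lra|]. field; lra. }
  replace (log_int 0) with (RtoC 0) in E
    by (symmetry; apply iter_int_0; [apply Cmod_1 | constructor]).
  rewrite Rminus_0_r, ln_1, Ropp_0 in E.
  replace (log_int t) with (log_int t - 0)%C by ring. rewrite E; ring.
Qed.

Lemma is_lim_seq_sqrt_inv : is_lim_seq (fun n => 16 * sqrt (/ INR (S (S n)))) 0.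
Proof.
  replace (Finite 0) with (Rbar_mult 16 0) by (simpl; f_equal; ring).
  apply is_lim_seq_scal_l.
  apply (is_lim_seq_ext (fun n => / sqrt (INR (S (S n))))).
  - intros n; symmetry; apply sqrt_inv.
  - apply (is_lim_seq_incr_1 (fun n => / sqrt (INR (S n)))), is_lim_seq_inv_sqrt.
Qed.

(** With x = 1 - t and r = sqrt x, x (ln x)^2 = 4 (r ln r)^2 <= 16 r by [Rabs_mul_ln_le] at r. The
    constant 16 serves the three cases at once. *)
Lemma mul_log_int_bound (n : nat) :
  Cmod (RtoC (1 - tends_to_1 n)) <= 16 * sqrt (/ INR (S (S n))) /\
  Cmod (RtoC (1 - tends_to_1 n) * log_int (tends_to_1 n))%C <= 16 * sqrt (/ INR (S (S n))) /\
  Cmod (RtoC (1 - tends_to_1 n) * (log_int (tends_to_1 n) * log_int (tends_to_1 n)))%C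
    <= 16 * sqrt (/ INR (S (S n))).
Proof.
  rewrite !log_int_eq by apply tends_to_1_bound. rewrite <- !RtoC_mult, !Cmod_R.
  unfold tends_to_1; generalize (INR_S_ge1 (S n)); intros H.
  set (x := / INR (S (S n))). replace (1 - (1 - x)) with x by ring.
  assert (Hx : 0 < x) by (apply Rinv_0_lt_compat; lra).
  assert (Hx1 : x <= 1) by (rewrite <- Rinv_1; apply Rinv_le_contravar; lra).
  set (r := sqrt x); assert (Hr : 0 < r) by now apply sqrt_lt_R0.
  assert (Hr2 : r * r = x) by (apply sqrt_sqrt; lra).
  assert (Hr1 : r <= 1) by nra.
  generalize (Rabs_mul_ln_le r ltac:(lra)); intros G.
  assert (Hs2 : sqrt r * sqrt r = r) by (apply sqrt_sqrt; lra).
  assert (Hs1 : 0 <= sqrt r <= 1) by (split; [apply sqrt_pos | rewrite <- sqrt_1; apply sqrt_le_1_alt; lra]).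
  assert (El : ln x = 2 * ln r) by (rewrite <- Hr2, ln_mult by assumption; ring).
  rewrite El.
  assert (G2 : Rabs (r * ln r) ^ 2 <= 4 * r).
  { generalize (Rabs_pos (r * ln r)); nra. }
  rewrite pow2_abs in G2.
  repeat split.
  - rewrite Rabs_pos_eq; nra.
  - replace (x * - (2 * ln r)) with (- 2 * r * (r * ln r)) by (rewrite <- Hr2; ring).
    rewrite Rabs_mult, (Rabs_left (-2 * r)) by lra. generalize (Rabs_pos (r * ln r)); nra.
  - replace (x * (- (2 * ln r) * - (2 * ln r))) with (4 * (r * ln r) ^ 2) by (rewrite <- Hr2; ring).
    rewrite Rabs_pos_eq; nra.
Qed.

Lemma is_Cleft_lim_mul_log (k : R -> C) (c : C) : is_Cleft_lim k c ->
  is_Cleft_lim (fun t => RtoC (1 - t) * k t)%C 0%C /\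
  is_Cleft_lim (fun t => RtoC (1 - t) * k t * log_int t)%C 0%C /\
  is_Cleft_lim (fun t => RtoC (1 - t) * k t * (log_int t * log_int t))%C 0%C.
Proof.
  intros Hk.
  assert (G : forall f : R -> C, (forall n, Cmod (RtoC (1 - tends_to_1 n) * f (tends_to_1 n))%C
      <= 16 * sqrt (/ INR (S (S n)))) -> is_Cleft_lim (fun t => RtoC (1 - t) * k t * f t)%C 0%C).
  { intros f Hf; unfold is_Cleft_lim.
    apply (is_Clim_seq_ext (fun n => k (tends_to_1 n)
      * (RtoC (1 - tends_to_1 n) * f (tends_to_1 n)))%C); [intros n; ring|].
    replace (RtoC 0) with (c * 0)%C by ring. apply is_Clim_seq_mult; [exact Hk|].
    eapply is_Clim_seq_0; [exact Hf | exact is_lim_seq_sqrt_inv]. }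
  split; [|split]; [|apply G; intros n; apply mul_log_int_bound
                    |apply (G (fun t => log_int t * log_int t)%C); intros n; apply mul_log_int_bound].
  apply (is_Clim_seq_ext (fun n => RtoC (1 - tends_to_1 n) * k (tends_to_1 n) * 1)%C);
    [intros n; ring|].
  apply (G (fun _ => 1%C)). intros n; rewrite Cmult_1_r; apply mul_log_int_bound.
Qed.

(** * Paths from the origin to roots of unity *)

(* With [z = g t] and [v = c (1 - z) / (1 + z)], where [c = (e^2 - 1) / (e^2 + 1)] and [e^5 = -1],
   [ypath] is [4 v / (1 - v^2)] and [Qpath] is [(1 + v^2) / (1 - v^2)]. *)
Definition ypath (e g : C) (t : R) : C :=
  ((e ^ 2 + e ^ 3) * ((1 - g * t) * (1 - - g * t))
   / ((1 - e ^ 3 * g * t) * (1 - - (e ^ 2) * g * t)))%C.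

Definition Qpath (e g : C) (t : R) : C :=
  (((e ^ 2 - e ^ 3) * (1 + g * t * (g * t)) + 4 * (g * t))
   / (2 * ((1 - e ^ 3 * g * t) * (1 - - (e ^ 2) * g * t))))%C.

(** With z = g t, the forms [form_v], [form_q] and [form_y] are d log v, d log((1-v)/(1+v)) and d
    log y. Up to constants, 1 + v = (1 - e^3 z)/(1 + z) and 1 - v = (1 + e^2 z)/(1 + z); this is
    where the letters e^3 and -e^2 come from. *)
Definition form_v (g : C) : list (Q * C) := ((-1)%Q, g) :: (1%Q, (- g)%C) :: nil.

Definition form_q (e g : C) : list (Q * C) :=
  (1%Q, (e ^ 3 * g)%C) :: ((-1)%Q, (- (e ^ 2) * g)%C) :: nil.

Definition form_y (e g : C) : list (Q * C) :=
  ((-1)%Q, g) :: ((-1)%Q, (- g)%C) :: (1%Q, (e ^ 3 * g)%C) :: (1%Q, (- (e ^ 2) * g)%C) :: nil.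

Definition empty_word : list (Q * list C) := (1%Q, nil) :: nil.

Definition path_ok (e g : C) (t : R) : Prop :=
  (1 - g * t <> 0)%C /\ (1 - - g * t <> 0)%C /\
  (1 - e ^ 3 * g * t <> 0)%C /\ (1 - - (e ^ 2) * g * t <> 0)%C.

Lemma Q2R_1 : Q2R 1 = 1.
Proof. unfold Q2R; simpl; field. Qed.

Lemma Q2R_m1 : Q2R (-1) = -1.
Proof. unfold Q2R; simpl; field. Qed.

Lemma comb_int_empty_word (t : R) : comb_int empty_word t = 1%C.
Proof.
  unfold empty_word; rewrite comb_int_cons; cbn [fst snd]; rewrite Q2R_1.
  change (iter_int nil t) with (RtoC 1); change (comb_int nil t) with (RtoC 0); ring.
Qed.

(** The factor [Qpath] is left visible: it cancels in dy/Q, and dy is y Q d log v. *)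
Definition dypath (e g : C) (t : R) : C :=
  (-2 * (e ^ 2 + e ^ 3) * g * Qpath e g t
   / ((1 - e ^ 3 * g * t) * (1 - - (e ^ 2) * g * t)))%C.

Lemma is_Cderive_linear (a b : C) (t : R) : is_Cderive (fun u => a + b * RtoC u)%C t b.
Proof.
  eapply is_Cderive_val.
  - apply is_Cderive_plus; [apply is_Cderive_const | apply is_Cderive_scal, is_Cderive_RtoC].
  - ring.
Qed.

Lemma is_Cderive_ypath (e g : C) (t : R) : (e ^ 5 = - (1))%C ->
  (1 - e ^ 3 * g * t <> 0)%C -> (1 - - (e ^ 2) * g * t <> 0)%C ->
  is_Cderive (ypath e g) t (dypath e g t).
Proof.
  intros He H3 H4; unfold ypath.
  assert (L : forall a, is_Cderive (fun u => 1 - a * RtoC u)%C t (- a)%C).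
  { intros a; apply (is_Cderive_ext (fun u => 1 + - a * RtoC u)%C); [intros u; ring|].
    apply is_Cderive_linear. }
  eapply is_Cderive_val.
  - apply is_Cderive_div.
    + apply is_Cderive_scal, is_Cderive_mult; apply L.
    + apply is_Cderive_mult; apply L.
    + now apply Cmult_neq_0.
  - unfold dypath, Qpath; field_simplify_eq; [cbv beta; ring [He] | now split].
Qed.

Lemma is_Cderive_Qpath (e g : C) (t : R) : (e ^ 5 = - (1))%C ->
  (1 - e ^ 3 * g * t <> 0)%C -> (1 - - (e ^ 2) * g * t <> 0)%C -> Qpath e g t <> 0%C ->
  is_Cderive (Qpath e g) t (ypath e g t * dypath e g t / (4 * Qpath e g t))%C.
Proof.
  intros He H3 H4 HQ.
  assert (L : forall a, is_Cderive (fun u => 1 - a * RtoC u)%C t (- a)%C).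
  { intros a; apply (is_Cderive_ext (fun u => 1 + - a * RtoC u)%C); [intros u; ring|].
    apply is_Cderive_linear. }
  assert (G : is_Cderive (fun u => g * RtoC u)%C t g).
  { eapply is_Cderive_val; [apply is_Cderive_scal, is_Cderive_RtoC | ring]. }
  assert (H2 : (2 * ((1 - e ^ 3 * g * t) * (1 - - (e ^ 2) * g * t)) <> 0)%C).
  { apply Cmult_neq_0; [|now apply Cmult_neq_0]. intros E; injection E; lra. }
  (* [Qpath] cancels against the factor inside [dypath], which leaves only the denominators of the
     path. *)
  replace (ypath e g t * dypath e g t / (4 * Qpath e g t))%C with
    (- (e ^ 2 + e ^ 3) ^ 2 * g * ((1 - g * t) * (1 - - g * t))
     / (2 * ((1 - e ^ 3 * g * t) * (1 - - (e ^ 2) * g * t)) ^ 2))%C.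
  - unfold Qpath; eapply is_Cderive_val.
    + apply is_Cderive_div.
      * apply is_Cderive_plus; [|apply is_Cderive_scal, G].
        apply is_Cderive_scal, is_Cderive_plus; [apply is_Cderive_const|].
        apply is_Cderive_mult; exact G.
      * apply is_Cderive_scal, is_Cderive_mult; apply L.
      * exact H2.
    + field_simplify_eq; [cbv beta; ring [He] | now repeat split].
  - unfold dypath, ypath; field; now repeat split.
Qed.

Lemma Qpath_sqr (e g : C) (t : R) : (e ^ 5 = - (1))%C ->
  (1 - e ^ 3 * g * t <> 0)%C -> (1 - - (e ^ 2) * g * t <> 0)%C ->
  (Qpath e g t * Qpath e g t = 1 + ypath e g t * ypath e g t / 4)%C.
Proof.
  intros He H3 H4; unfold Qpath, ypath; field_simplify_eq; [cbv beta; ring [He] | now split].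
Qed.

(** A zero of Q would force y^2 = -4, on the boundary of the disk. *)
Lemma Qpath_neq_0 (e g : C) (t : R) : (e ^ 5 = - (1))%C ->
  (1 - e ^ 3 * g * t <> 0)%C -> (1 - - (e ^ 2) * g * t <> 0)%C ->
  Cmod (ypath e g t * ypath e g t)%C < 4 -> Qpath e g t <> 0%C.
Proof.
  intros He H3 H4 Hy E; assert (E2 := Qpath_sqr e g t He H3 H4); rewrite E in E2.
  assert (Y : (ypath e g t * ypath e g t = - (4))%C).
  { transitivity (4 * (1 + ypath e g t * ypath e g t / 4) - 4)%C; [field | rewrite <- E2; ring]. }
  rewrite Y, Cmod_opp, Cmod_R, Rabs_pos_eq in Hy; lra.
Qed.

Lemma dypath_div_Qpath (e g : C) (t : R) : path_ok e g t -> Qpath e g t <> 0%C ->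
  (dypath e g t / Qpath e g t = -2 * form (form_q e g) t)%C.
Proof.
  intros (H1 & H2 & H3 & H4) HQ; unfold dypath, form_q, form; cbn [fold_right fst snd].
  rewrite Q2R_1, Q2R_m1; field; now repeat split.
Qed.

Lemma dypath_form_v (e g : C) (t : R) : path_ok e g t ->
  (dypath e g t = ypath e g t * Qpath e g t * form (form_v g) t)%C.
Proof.
  intros (H1 & H2 & H3 & H4); unfold dypath, ypath, form_v, form; cbn [fold_right fst snd].
  rewrite Q2R_1, Q2R_m1; field; now repeat split.
Qed.

Lemma dypath_form_y (e g : C) (t : R) : (e ^ 5 = - (1))%C -> path_ok e g t ->
  (dypath e g t = ypath e g t * form (form_y e g) t)%C.
Proof.
  intros He (H1 & H2 & H3 & H4); unfold dypath, Qpath, ypath, form_y, form; cbn [fold_right fst snd].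
  rewrite Q2R_1, Q2R_m1; field_simplify_eq; [cbv beta; ring [He] | now repeat split].
Qed.

Definition epath (s : nat) (e g : C) (t : R) : C :=
  (ypath e g t * central s (ypath e g t * ypath e g t))%C.

(** Multiplication by Q makes the weight-one function a primitive of a logarithmic form. Writing M
    for [mpath] and E_s for [epath s], the chain is dM = -2 [form_q], dE_2 = M [form_v], dE_3 = E_2
    [form_y]. *)
Definition mpath (e g : C) (t : R) : C := (epath 1 e g t * Qpath e g t)%C.

(** The last condition keeps the open path in the disk of convergence; end points are treated
    separately, by the explicit values y = 0 and y = 1. *)
Definition path_data (e g : C) : Prop :=
  (e ^ 5 = - (1))%C /\ (g ^ 10 = 1)%C /\
  forall t, 0 <= t < 1 -> Cmod (ypath e g t * ypath e g t)%C < 4.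

Lemma path_letters (e g : C) : (e ^ 5 = - (1))%C -> (g ^ 10 = 1)%C ->
  ((- g) ^ 10 = 1)%C /\ ((e ^ 3 * g) ^ 10 = 1)%C /\ ((- (e ^ 2) * g) ^ 10 = 1)%C.
Proof.
  intros He Hg; repeat split.
  - transitivity (g ^ 10)%C; [ring | assumption].
  - transitivity ((e ^ 5) ^ 6 * g ^ 10)%C; [ring | rewrite He, Hg; ring].
  - transitivity ((e ^ 5) ^ 4 * g ^ 10)%C; [ring | rewrite He, Hg; ring].
Qed.

Lemma path_ok_lt_1 (e g : C) (t : R) : (e ^ 5 = - (1))%C -> (g ^ 10 = 1)%C -> Rabs t < 1 ->
  path_ok e g t.
Proof.
  intros He Hg Ht; destruct (path_letters e g He Hg) as (H2 & H3 & H4).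
  repeat split; apply one_minus_neq_0; try assumption;
    apply root_of_unity_Cmod with 10%nat; try assumption; lia.
Qed.

Lemma root_form_v (g : C) : (g ^ 10 = 1)%C -> root_form 10 (form_v g).
Proof.
  intros Hg; repeat constructor; cbn [snd]; [assumption|].
  transitivity (g ^ 10)%C; [ring | assumption].
Qed.

Lemma root_form_q (e g : C) : (e ^ 5 = - (1))%C -> (g ^ 10 = 1)%C -> root_form 10 (form_q e g).
Proof. intros He Hg; destruct (path_letters e g He Hg) as (H2 & H3 & H4); now repeat constructor. Qed.

Lemma root_form_y (e g : C) : (e ^ 5 = - (1))%C -> (g ^ 10 = 1)%C -> root_form 10 (form_y e g).
Proof. intros He Hg; destruct (path_letters e g He Hg) as (H2 & H3 & H4); now repeat constructor. Qed.

Lemma root_comb_empty_word (N : nat) : root_comb 0 N empty_word.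
Proof. repeat constructor. Qed.

(** * Three successive integrations along a segment *)

Section Path.
Context (e g : C) (H : path_data e g).

Let He : (e ^ 5 = - (1))%C := proj1 H.
Let Hg : (g ^ 10 = 1)%C := proj1 (proj2 H).

Lemma path_Qpath_neq_0 (t : R) : 0 <= t < 1 -> Qpath e g t <> 0%C.
Proof.
  intros Ht; destruct (path_ok_lt_1 e g t He Hg) as (H1 & H2 & H3 & H4);
    [rewrite Rabs_pos_eq; lra|].
  apply Qpath_neq_0; try assumption. now apply H.
Qed.

Lemma is_Cderive_mpath (t : R) : 0 <= t < 1 ->
  is_Cderive (mpath e g) t (-2 * form (form_q e g) t)%C.
Proof.
  intros Ht; assert (HQ := path_Qpath_neq_0 t Ht).
  assert (Ok := path_ok_lt_1 e g t He Hg ltac:(rewrite Rabs_pos_eq; lra)).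
  rewrite <- dypath_div_Qpath by assumption. destruct Ok as (H1 & H2 & H3 & H4).
  apply (is_Cderive_central_1 (ypath e g) (Qpath e g)); try assumption.
  - now apply is_Cderive_ypath.
  - now apply is_Cderive_Qpath.
  - now apply H.
  - now apply Qpath_sqr.
Qed.

Lemma is_Cderive_epath_2 (t : R) : 0 <= t < 1 ->
  is_Cderive (epath 2 e g) t (mpath e g t * form (form_v g) t)%C.
Proof.
  intros Ht; assert (Ok := path_ok_lt_1 e g t He Hg ltac:(rewrite Rabs_pos_eq; lra)).
  assert (Ok' := Ok); destruct Ok' as (H1 & H2 & H3 & H4).
  eapply is_Cderive_val.
  - apply (is_Cderive_central 0 (ypath e g)); [now apply is_Cderive_ypath | now apply H].
  - rewrite (dypath_form_v e g t Ok); unfold mpath, epath; ring.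
Qed.

Lemma is_Cderive_epath_3 (t : R) : 0 <= t < 1 ->
  is_Cderive (epath 3 e g) t (epath 2 e g t * form (form_y e g) t)%C.
Proof.
  intros Ht; assert (Ok := path_ok_lt_1 e g t He Hg ltac:(rewrite Rabs_pos_eq; lra)).
  assert (Ok' := Ok); destruct Ok' as (H1 & H2 & H3 & H4).
  eapply is_Cderive_val.
  - apply (is_Cderive_central 1 (ypath e g)); [now apply is_Cderive_ypath | now apply H].
  - rewrite (dypath_form_y e g t He Ok); unfold epath; ring.
Qed.

Definition int_q := prepend (form_q e g) empty_word.
Definition int_v := prepend (form_v g) empty_word.
Definition int_vq := prepend (form_v g) int_q.

Lemma root_int_q : root_comb 1 10 int_q.
Proof. apply root_comb_prepend; [now apply root_form_q | apply root_comb_empty_word]. Qed.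

Lemma root_int_v : root_comb 1 10 int_v.
Proof. apply root_comb_prepend; [now apply root_form_v | apply root_comb_empty_word]. Qed.

Lemma root_int_vq : root_comb 2 10 int_vq.
Proof. apply root_comb_prepend; [now apply root_form_v | apply root_int_q]. Qed.

Lemma mpath_eq (t : R) : 0 <= t < 1 ->
  mpath e g t = (mpath e g 0 - 2 * comb_int int_q t)%C.
Proof.
  intros Ht.
  assert (E := is_Cderive_unique_primitive (mpath e g) (fun u => -2 * comb_int int_q u)%C
    (fun u => -2 * form (form_q e g) u)%C t (proj1 Ht)).
  replace (mpath e g t) with (mpath e g 0 + (mpath e g t - mpath e g 0))%C by ring.
  rewrite E.
  - unfold int_q at 2; rewrite (comb_int_prepend_0 0 10) by
      (try lia; try (now apply root_form_q); apply root_comb_empty_word). ring.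
  - intros u Hu; apply is_Cderive_mpath; lra.
  - intros u Hu; apply is_Cderive_scal. eapply is_Cderive_val.
    + apply (is_Cderive_comb_int_prepend 0 10);
        [lia | now apply root_form_q | apply root_comb_empty_word | rewrite Rabs_pos_eq; lra].
    + rewrite comb_int_empty_word; ring.
Qed.

Lemma is_Cderive_prepend_form_v (k : nat) (l : list (Q * list C)) (t : R) :
  root_comb k 10 l -> 0 <= t < 1 ->
  is_Cderive (comb_int (prepend (form_v g) l)) t (form (form_v g) t * comb_int l t)%C.
Proof.
  intros Hl Ht; apply (is_Cderive_comb_int_prepend k 10);
    [lia | now apply root_form_v | assumption | rewrite Rabs_pos_eq; lra].
Qed.

Lemma is_Cderive_prepend_form_y (k : nat) (l : list (Q * list C)) (t : R) :
  root_comb k 10 l -> 0 <= t < 1 ->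
  is_Cderive (comb_int (prepend (form_y e g) l)) t (form (form_y e g) t * comb_int l t)%C.
Proof.
  intros Hl Ht; apply (is_Cderive_comb_int_prepend k 10);
    [lia | now apply root_form_y | assumption | rewrite Rabs_pos_eq; lra].
Qed.

Lemma epath_2_eq (t : R) : 0 <= t < 1 ->
  epath 2 e g t = (epath 2 e g 0 + mpath e g 0 * comb_int int_v t - 2 * comb_int int_vq t)%C.
Proof.
  intros Ht.
  assert (E := is_Cderive_unique_primitive (epath 2 e g)
    (fun u => mpath e g 0 * comb_int int_v u - 2 * comb_int int_vq u)%C
    (fun u => mpath e g u * form (form_v g) u)%C t (proj1 Ht)).
  replace (epath 2 e g t) with (epath 2 e g 0 + (epath 2 e g t - epath 2 e g 0))%C by ring.
  rewrite E.
  - assert (Z1 : comb_int int_v 0 = 0%C) by (apply (comb_int_prepend_0 0 10);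
      [lia | now apply root_form_v | apply root_comb_empty_word]).
    assert (Z2 : comb_int int_vq 0 = 0%C) by (apply (comb_int_prepend_0 1 10);
      [lia | now apply root_form_v | apply root_int_q]).
    rewrite Z1, Z2; ring.
  - intros u Hu; apply is_Cderive_epath_2; lra.
  - intros u Hu; eapply is_Cderive_val.
    + apply is_Cderive_minus; apply is_Cderive_scal.
      * apply (is_Cderive_prepend_form_v 0); [apply root_comb_empty_word | lra].
      * apply (is_Cderive_prepend_form_v 1); [apply root_int_q | lra].
    + rewrite comb_int_empty_word, (mpath_eq u) by lra; ring.
Qed.

Lemma epath_3_eq (t : R) : 0 <= t < 1 ->
  epath 3 e g t = (epath 3 e g 0 + epath 2 e g 0 * comb_int (prepend (form_y e g) empty_word) t
    + mpath e g 0 * comb_int (prepend (form_y e g) int_v) t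
    - 2 * comb_int (prepend (form_y e g) int_vq) t)%C.
Proof.
  intros Ht.
  assert (E := is_Cderive_unique_primitive (epath 3 e g)
    (fun u => epath 2 e g 0 * comb_int (prepend (form_y e g) empty_word) u
    + mpath e g 0 * comb_int (prepend (form_y e g) int_v) u
    - 2 * comb_int (prepend (form_y e g) int_vq) u)%C
    (fun u => epath 2 e g u * form (form_y e g) u)%C t (proj1 Ht)).
  replace (epath 3 e g t) with (epath 3 e g 0 + (epath 3 e g t - epath 3 e g 0))%C by ring.
  rewrite E.
  - assert (Y := root_form_y e g He Hg).
    rewrite (comb_int_prepend_0 0 10 _ _ ltac:(lia) Y (root_comb_empty_word 10)).
    rewrite (comb_int_prepend_0 1 10 _ _ ltac:(lia) Y root_int_v).
    rewrite (comb_int_prepend_0 2 10 _ _ ltac:(lia) Y root_int_vq). ring.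
  - intros u Hu; apply is_Cderive_epath_3; lra.
  - intros u Hu; eapply is_Cderive_val.
    + apply is_Cderive_minus; [apply is_Cderive_plus|]; apply is_Cderive_scal.
      * apply (is_Cderive_prepend_form_y 0); [apply root_comb_empty_word | lra].
      * apply (is_Cderive_prepend_form_y 1); [apply root_int_v | lra].
      * apply (is_Cderive_prepend_form_y 2); [apply root_int_vq | lra].
    + rewrite comb_int_empty_word, (epath_2_eq u) by lra; ring.
Qed.

End Path.

(** * The segment ending at y = 0: regularization and constants *)

(** The hypotheses make e a primitive tenth root of unity. The list contains the letters of the path
    g = e and those of the path g = 1 except the letter 1, so these letters give convergent
    words. *)
Lemma golden_root_facts (e : C) : (e ^ 5 = - (1))%C -> e <> (- (1))%C ->
  (e <> 1 /\ - e <> 1 /\ e ^ 3 <> 1 /\ - (e ^ 2) <> 1 /\ e ^ 3 * e <> 1 /\ - (e ^ 2) * e <> 1)%C.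
Proof.
  intros He H1; repeat split; intros E.
  - rewrite E in He. assert (X : (1 ^ 5 = 1)%C) by ring. rewrite X in He.
    apply (f_equal Re) in He; simpl in He; lra.
  - apply H1; transitivity (- - e)%C; [ring | rewrite E; reflexivity].
  - apply H1. assert (E2 : (e ^ 2 = - (1))%C) by (rewrite <- He; transitivity (1 * e ^ 2)%C;
      [ring | rewrite <- E; ring]).
    rewrite <- He; transitivity (1 * e)%C; [ring|].
    transitivity ((e ^ 2) ^ 2 * e)%C; [rewrite E2; ring | ring].
  - apply H1. assert (E2 : (e ^ 2 = - (1))%C) by (rewrite <- E; ring).
    rewrite <- He; transitivity ((- (1)) ^ 2 * e)%C; [ring | rewrite <- E2; ring].
  - apply H1; rewrite <- He; transitivity (1 * e)%C; [ring | rewrite <- E; ring].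
  - apply H1. assert (E3 : (e ^ 3 = - (1))%C) by (rewrite <- E; ring).
    assert (E2 : (e ^ 2 = 1)%C).
    { transitivity (- (- (1) * e ^ 2))%C; [ring | rewrite <- E3].
      transitivity (- (e ^ 5))%C; [ring | rewrite He; ring]. }
    rewrite <- E3; transitivity (1 * e)%C; [ring | rewrite <- E2; ring].
Qed.

Lemma is_Cleft_lim_unique (f : R -> C) (a b : C) : is_Cleft_lim f a -> is_Cleft_lim f b -> a = b.
Proof. apply is_Clim_seq_unique. Qed.

Lemma is_Cleft_lim_ext (f h : R -> C) (a : C) : (forall t, 0 <= t < 1 -> f t = h t) ->
  is_Cleft_lim f a -> is_Cleft_lim h a.
Proof. intros H; apply is_Clim_seq_ext; intros n; apply H, tends_to_1_bound. Qed.

Lemma is_Cleft_lim_const (c : C) : is_Cleft_lim (fun _ => c) c.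
Proof. apply is_Clim_seq_const. Qed.

Lemma is_Cleft_lim_plus (f h : R -> C) (a b : C) :
  is_Cleft_lim f a -> is_Cleft_lim h b -> is_Cleft_lim (fun t => f t + h t)%C (a + b)%C.
Proof. apply is_Clim_seq_plus. Qed.

Lemma is_Cleft_lim_scal (c : C) (f : R -> C) (a : C) :
  is_Cleft_lim f a -> is_Cleft_lim (fun t => c * f t)%C (c * a)%C.
Proof. apply is_Clim_seq_scal. Qed.

(** [epath] on the segment to z = 1 without its factor 1 - t; that zero of y outweighs the powers of
    the logarithm. *)
Definition central_quot (s : nat) (e : C) (t : R) : C :=
  ((e ^ 2 + e ^ 3) * (1 - - (1) * t) / ((1 - e ^ 3 * 1 * t) * (1 - - (e ^ 2) * 1 * t))
   * central s (ypath e 1 t * ypath e 1 t))%C.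

Lemma epath_factor (s : nat) (e : C) (t : R) :
  epath s e 1 t = (RtoC (1 - t) * central_quot s e t)%C.
Proof.
  unfold epath, central_quot. unfold ypath at 1. rewrite RtoC_minus. unfold Cdiv; ring.
Qed.

Section Regularization.
Context (e : C) (H : path_data e 1) (H1 : e <> (- (1))%C).

Let He : (e ^ 5 = - (1))%C := proj1 H.

Let one10 : (1 ^ 10 = 1)%C.
Proof. ring. Qed.

Lemma path_denominators_1 : (1 - e ^ 3 * 1 * 1 <> 0)%C /\ (1 - - (e ^ 2) * 1 * 1 <> 0)%C.
Proof.
  destruct (golden_root_facts e He H1) as (_ & _ & E3 & E2 & _); split; intros E.
  - apply E3; transitivity (1 - (1 - e ^ 3 * 1 * 1))%C; [ring | rewrite E; ring].
  - apply E2; transitivity (1 - (1 - - (e ^ 2) * 1 * 1))%C; [ring | rewrite E; ring].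
Qed.

Lemma ypath_1_at_1 : ypath e 1 1 = 0%C.
Proof. unfold ypath, Cdiv; ring. Qed.

Lemma central_quot_left_lim (s : nat) : exists c, is_Cleft_lim (central_quot (S s) e) c.
Proof.
  destruct path_denominators_1 as [D3 D4].
  assert (L : forall a, is_Cderive (fun u => 1 - a * RtoC u)%C 1 (- a)%C).
  { intros a; apply (is_Cderive_ext (fun u => 1 + - a * RtoC u)%C); [intros u; ring|].
    apply is_Cderive_linear. }
  eexists; eapply is_Cleft_lim_continuous; unfold central_quot.
  apply is_Cderive_mult.
  - apply is_Cderive_div.
    + apply is_Cderive_scal, L.
    + apply is_Cderive_mult; apply L.
    + now apply Cmult_neq_0.
  - apply (is_Cderive_CPSeries _ (fun u => ypath e 1 u * ypath e 1 u)%C).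
    + apply is_Cderive_mult; now apply is_Cderive_ypath.
    + apply central_in_disk. rewrite ypath_1_at_1, Cmult_0_l, Cmod_0; lra.
Qed.

Lemma Qpath_left_lim : exists c, is_Cleft_lim (Qpath e 1) c.
Proof.
  destruct path_denominators_1 as [D3 D4].
  eexists; eapply is_Cleft_lim_continuous; apply is_Cderive_Qpath; try assumption.
  apply Qpath_neq_0; try assumption. rewrite ypath_1_at_1, Cmult_0_l, Cmod_0; lra.
Qed.

Lemma epath_left_lim (s : nat) :
  is_Cleft_lim (epath (S s) e 1) 0%C /\
  is_Cleft_lim (fun t => epath (S s) e 1 t * log_int t)%C 0%C /\
  is_Cleft_lim (fun t => epath (S s) e 1 t * (log_int t * log_int t))%C 0%C.
Proof.
  destruct (central_quot_left_lim s) as [c Hc].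
  destruct (is_Cleft_lim_mul_log _ c Hc) as (L1 & L2 & L3); split; [|split].
  - revert L1; apply is_Cleft_lim_ext; intros t _; now rewrite epath_factor.
  - revert L2; apply is_Cleft_lim_ext; intros t _; now rewrite epath_factor.
  - revert L3; apply is_Cleft_lim_ext; intros t _; now rewrite epath_factor.
Qed.

Lemma mpath_left_lim :
  is_Cleft_lim (mpath e 1) 0%C /\
  is_Cleft_lim (fun t => mpath e 1 t * log_int t)%C 0%C /\
  is_Cleft_lim (fun t => mpath e 1 t * (log_int t * log_int t))%C 0%C.
Proof.
  destruct Qpath_left_lim as [c Hc]; destruct (epath_left_lim 0) as (L1 & L2 & L3).
  assert (G : forall f, is_Cleft_lim f 0%C -> is_Cleft_lim (fun t => f t * Qpath e 1 t)%C 0%C).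
  { intros f Hf; rewrite <- (Cmult_0_l c). now apply (is_Clim_seq_mult _ _ _ _ Hf). }
  split; [|split].
  - exact (G _ L1).
  - generalize (G _ L2); apply is_Cleft_lim_ext; intros t _; unfold mpath; ring.
  - generalize (G _ L3); apply is_Cleft_lim_ext; intros t _; unfold mpath; ring.
Qed.

(** On this segment the letter 1 is the pole of the forms at the end point v = 0. It occurs in
    [form_v] and [form_y] with coefficient -1; [form_m] and [form_r] are what remains. *)
Definition form_1 : list (Q * C) := (1%Q, RtoC 1) :: nil.
Definition form_m : list (Q * C) := (1%Q, (- (1))%C) :: nil.
Definition form_r : list (Q * C) :=
  ((-1)%Q, (- (1))%C) :: (1%Q, (e ^ 3 * 1)%C) :: (1%Q, (- (e ^ 2) * 1)%C) :: nil.

Lemma form_v_split (t : R) : form (form_v 1) t = (form form_m t - form form_1 t)%C.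
Proof.
  unfold form, form_v, form_m, form_1; cbn [fold_right fst snd]; rewrite Q2R_1, Q2R_m1; ring.
Qed.

Lemma form_y_split (t : R) : form (form_y e 1) t = (form form_r t - form form_1 t)%C.
Proof.
  unfold form, form_y, form_r, form_1; cbn [fold_right fst snd]; rewrite Q2R_1, Q2R_m1; ring.
Qed.

Lemma root_form_1 : root_form 10 form_1.
Proof. repeat constructor; exact one10. Qed.

Lemma root_form_m : root_form 10 form_m.
Proof. repeat constructor; cbn [snd]; ring. Qed.

Lemma root_form_r : root_form 10 form_r.
Proof.
  destruct (path_letters e 1 He one10) as (H2 & H3 & H4); now repeat constructor.
Qed.

Lemma neq_m1_1 : (- (1))%C <> 1%C.
Proof. intros E; apply (f_equal Re) in E; simpl in E; lra. Qed.

Lemma regular_form_m : regular_form form_m.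
Proof. repeat constructor; apply neq_m1_1. Qed.

Lemma regular_form_q : regular_form (form_q e 1).
Proof.
  destruct (golden_root_facts e He H1) as (_ & _ & E3 & E2 & _).
  repeat constructor; cbn [snd]; rewrite Cmult_1_r; assumption.
Qed.

Lemma regular_form_r : regular_form form_r.
Proof.
  destruct (golden_root_facts e He H1) as (_ & _ & E3 & E2 & _).
  repeat constructor; cbn [snd]; rewrite ?Cmult_1_r; try assumption. apply neq_m1_1.
Qed.

Definition int_1 : list (Q * list C) := prepend form_1 empty_word.
Definition int_11 : list (Q * list C) := prepend form_1 int_1.
Definition int_q1 : list (Q * list C) := prepend (form_q e 1) int_1 ++ prepend form_1 (int_q e 1).

Lemma root_int_1 : root_comb 1 10 int_1.
Proof. apply root_comb_prepend; [apply root_form_1 | apply root_comb_empty_word]. Qed.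

Lemma root_int_11 : root_comb 2 10 int_11.
Proof. apply root_comb_prepend; [apply root_form_1 | apply root_int_1]. Qed.

Lemma root_int_q1 : root_comb 2 10 int_q1.
Proof.
  apply root_comb_app; apply root_comb_prepend.
  - now apply root_form_q.
  - apply root_int_1.
  - apply root_form_1.
  - now apply root_int_q.
Qed.

Lemma comb_int_1 (t : R) : comb_int int_1 t = log_int t.
Proof.
  unfold int_1, form_1, empty_word, prepend; cbn [flat_map map app fst snd].
  rewrite comb_int_cons; cbn [fst snd]. change (comb_int nil t) with (RtoC 0).
  rewrite Q2R_mult, Q2R_1; unfold log_int. rewrite Rmult_1_l. ring.
Qed.

Lemma is_Cderive_prepend (k : nat) (x : list (Q * C)) (l : list (Q * list C)) (t : R) :
  root_form 10 x -> root_comb k 10 l -> 0 <= t < 1 ->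
  is_Cderive (comb_int (prepend x l)) t (form x t * comb_int l t)%C.
Proof.
  intros Hx Hl Ht; apply (is_Cderive_comb_int_prepend k 10);
    [lia | assumption | assumption | rewrite Rabs_pos_eq; lra].
Qed.

Lemma is_Cderive_log_int (t : R) : 0 <= t < 1 -> is_Cderive log_int t (form form_1 t).
Proof.
  intros Ht; apply (is_Cderive_ext (comb_int int_1)); [apply comb_int_1|].
  eapply is_Cderive_val; [apply (is_Cderive_prepend 0);
    [apply root_form_1 | apply root_comb_empty_word | assumption]|].
  rewrite comb_int_empty_word; ring.
Qed.

Lemma comb_int_prepend_at_0 (k : nat) (x : list (Q * C)) (l : list (Q * list C)) :
  root_form 10 x -> root_comb k 10 l -> comb_int (prepend x l) 0 = 0%C.
Proof. intros; apply (comb_int_prepend_0 k 10); [lia | assumption | assumption]. Qed.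

Lemma log_int_0 : log_int 0 = 0%C.
Proof.
  rewrite <- comb_int_1; apply (comb_int_prepend_at_0 0);
    [apply root_form_1 | apply root_comb_empty_word].
Qed.

Lemma eq_of_is_Cderive (f h l : R -> C) (t : R) : 0 <= t < 1 ->
  (forall u, 0 <= u < 1 -> is_Cderive f u (l u)) ->
  (forall u, 0 <= u < 1 -> is_Cderive h u (l u)) -> f 0 = h 0 -> f t = h t.
Proof.
  intros Ht Hf Hh H0.
  assert (E := is_Cderive_unique_primitive f h l t (proj1 Ht)).
  replace (f t) with (f 0 + (f t - f 0))%C by ring. rewrite E, H0; [ring | |];
    intros; [apply Hf | apply Hh]; lra.
Qed.

(** Shuffle of two words of length one, obtained from the product rule. *)
Lemma comb_int_q_mul_log (t : R) : 0 <= t < 1 ->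
  (comb_int (int_q e 1) t * log_int t)%C = comb_int int_q1 t.
Proof.
  intros Ht.
  apply (eq_of_is_Cderive (fun t => comb_int (int_q e 1) t * log_int t)%C (comb_int int_q1)
    (fun u => form (form_q e 1) u * log_int u + comb_int (int_q e 1) u * form form_1 u)%C);
    [assumption| | |].
  - intros u Hu; apply is_Cderive_mult; [|exact (is_Cderive_log_int u Hu)].
    eapply is_Cderive_val; [apply (is_Cderive_prepend 0);
      [now apply root_form_q | apply root_comb_empty_word | assumption]|].
    rewrite comb_int_empty_word; ring.
  - intros u Hu; apply (is_Cderive_ext (fun u => comb_int (prepend (form_q e 1) int_1) u
      + comb_int (prepend form_1 (int_q e 1)) u)%C); [intros v; symmetry; apply comb_int_app|].
    eapply is_Cderive_val.
    + apply is_Cderive_plus; apply (is_Cderive_prepend 1); try assumption.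
      * now apply root_form_q.
      * apply root_int_1.
      * apply root_form_1.
      * now apply root_int_q.
    + rewrite comb_int_1; ring.
  - rewrite log_int_0; unfold int_q1; rewrite comb_int_app.
    rewrite (comb_int_prepend_at_0 1), (comb_int_prepend_at_0 1); [ring| | | |].
    + apply root_form_1.
    + now apply root_int_q.
    + now apply root_form_q.
    + apply root_int_1.
Qed.

Lemma log_int_sqr (t : R) : 0 <= t < 1 -> (log_int t * log_int t = 2 * comb_int int_11 t)%C.
Proof.
  intros Ht.
  apply (eq_of_is_Cderive (fun t => log_int t * log_int t)%C (fun t => 2 * comb_int int_11 t)%C
    (fun u => form form_1 u * log_int u + log_int u * form form_1 u)%C); [assumption| | |].
  - intros u Hu; apply is_Cderive_mult; exact (is_Cderive_log_int u Hu).
  - intros u Hu; eapply is_Cderive_val.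
    + apply is_Cderive_scal, (is_Cderive_prepend 1);
        [apply root_form_1 | apply root_int_1 | assumption].
    + rewrite comb_int_1; ring.
  - rewrite log_int_0; unfold int_11;
      rewrite (comb_int_prepend_at_0 1); [ring | apply root_form_1 | apply root_int_1].
Qed.

(* Adding multiples of [log_int] removes the letter [1] in first position. *)
Lemma regularized_2 (t : R) : 0 <= t < 1 ->
  (epath 2 e 1 t + mpath e 1 t * log_int t
   = epath 2 e 1 0 + mpath e 1 0 * comb_int (prepend form_m empty_word) t
     - 2 * comb_int (prepend form_m (int_q e 1)) t
     - 2 * comb_int (prepend (form_q e 1) int_1) t)%C.
Proof.
  intros Ht.
  apply (eq_of_is_Cderive (fun t => epath 2 e 1 t + mpath e 1 t * log_int t)%C
    (fun t => epath 2 e 1 0 + mpath e 1 0 * comb_int (prepend form_m empty_word) t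
     - 2 * comb_int (prepend form_m (int_q e 1)) t
     - 2 * comb_int (prepend (form_q e 1) int_1) t)%C
    (fun u => mpath e 1 u * form form_m u - 2 * form (form_q e 1) u * log_int u)%C);
    [assumption| | |].
  - intros u Hu; eapply is_Cderive_val.
    + apply is_Cderive_plus; [exact (is_Cderive_epath_2 e 1 H u Hu)|].
      apply is_Cderive_mult; [exact (is_Cderive_mpath e 1 H u Hu) | exact (is_Cderive_log_int u Hu)].
    + rewrite form_v_split; ring.
  - intros u Hu; eapply is_Cderive_val.
    + apply is_Cderive_minus; [apply is_Cderive_minus; [apply is_Cderive_plus;
        [apply is_Cderive_const|]|]|]; apply is_Cderive_scal.
      * apply (is_Cderive_prepend 0);
          [apply root_form_m | apply root_comb_empty_word | assumption].
      * apply (is_Cderive_prepend 1); [apply root_form_m | now apply root_int_q | assumption].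
      * apply (is_Cderive_prepend 1); [now apply root_form_q | apply root_int_1 | assumption].
    + rewrite comb_int_empty_word, comb_int_1, (mpath_eq e 1 H u Hu); ring.
  - rewrite log_int_0, (comb_int_prepend_at_0 0), (comb_int_prepend_at_0 1),
      (comb_int_prepend_at_0 1); [ring| | | | | |].
    + now apply root_form_q.
    + apply root_int_1.
    + apply root_form_m.
    + now apply root_int_q.
    + apply root_form_m.
    + apply root_comb_empty_word.
Qed.

(** In the derivative of E_3 + E_2 L + M L^2/2, where L = -log(1-t), the letter 1 cancels between
    successive summands. The products with L that remain are shuffles, written as words beginning
    with a letter other than 1. At t = 1 the left side tends to 0 because y does. *)
Lemma regularized_3 (t : R) : 0 <= t < 1 ->
  (epath 3 e 1 t + epath 2 e 1 t * log_int t + / 2 * (mpath e 1 t * (log_int t * log_int t))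
   = epath 3 e 1 0 + epath 2 e 1 0 * comb_int (prepend form_r empty_word) t
     + mpath e 1 0 * comb_int (prepend form_r (int_v 1)) t
     - 2 * comb_int (prepend form_r (int_vq e 1)) t
     + mpath e 1 0 * comb_int (prepend form_m int_1) t
     - 2 * comb_int (prepend form_m int_q1) t
     - 2 * comb_int (prepend (form_q e 1) int_11) t)%C.
Proof.
  intros Ht.
  apply (eq_of_is_Cderive
    (fun t => epath 3 e 1 t + epath 2 e 1 t * log_int t
       + / 2 * (mpath e 1 t * (log_int t * log_int t)))%C
    (fun t => epath 3 e 1 0 + epath 2 e 1 0 * comb_int (prepend form_r empty_word) t
     + mpath e 1 0 * comb_int (prepend form_r (int_v 1)) t
     - 2 * comb_int (prepend form_r (int_vq e 1)) t
     + mpath e 1 0 * comb_int (prepend form_m int_1) t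
     - 2 * comb_int (prepend form_m int_q1) t
     - 2 * comb_int (prepend (form_q e 1) int_11) t)%C
    (fun u => epath 2 e 1 u * form form_r u + mpath e 1 u * form form_m u * log_int u
       - form (form_q e 1) u * (log_int u * log_int u))%C); [assumption| | |].
  - intros u Hu; eapply is_Cderive_val.
    + apply is_Cderive_plus; [apply is_Cderive_plus; [exact (is_Cderive_epath_3 e 1 H u Hu)|]|].
      * apply is_Cderive_mult; [exact (is_Cderive_epath_2 e 1 H u Hu) | exact (is_Cderive_log_int u Hu)].
      * apply is_Cderive_scal, is_Cderive_mult; [exact (is_Cderive_mpath e 1 H u Hu)|].
        apply is_Cderive_mult; exact (is_Cderive_log_int u Hu).
    + rewrite form_v_split, form_y_split; field.
  - intros u Hu; eapply is_Cderive_val.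
    + apply is_Cderive_minus; [apply is_Cderive_minus; [apply is_Cderive_plus;
        [apply is_Cderive_minus; [apply is_Cderive_plus; [apply is_Cderive_plus;
          [apply is_Cderive_const|]|]|]|]|]|]; apply is_Cderive_scal.
      * apply (is_Cderive_prepend 0);
          [apply root_form_r | apply root_comb_empty_word | assumption].
      * apply (is_Cderive_prepend 1); [apply root_form_r | exact (root_int_v e 1 H) | assumption].
      * apply (is_Cderive_prepend 2); [apply root_form_r | now apply root_int_vq | assumption].
      * apply (is_Cderive_prepend 1); [apply root_form_m | apply root_int_1 | assumption].
      * apply (is_Cderive_prepend 2); [apply root_form_m | apply root_int_q1 | assumption].
      * apply (is_Cderive_prepend 2); [now apply root_form_q | apply root_int_11 | assumption].
    + rewrite comb_int_empty_word, comb_int_1, <- comb_int_q_mul_log by assumption.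
      rewrite (epath_2_eq e 1 H u Hu), (mpath_eq e 1 H u Hu), log_int_sqr by assumption.
      ring.
  - rewrite log_int_0, (comb_int_prepend_at_0 0 form_r), (comb_int_prepend_at_0 1 form_r),
      (comb_int_prepend_at_0 2 form_r), (comb_int_prepend_at_0 1 form_m),
      (comb_int_prepend_at_0 2 form_m), (comb_int_prepend_at_0 2 (form_q e 1));
      try (now apply root_form_q); try apply root_form_m; try apply root_form_r;
      try apply root_int_11; try apply root_int_q1; try apply root_int_1;
      try (now apply root_int_vq); try exact (root_int_v e 1 H); try apply root_comb_empty_word.
    ring.
Qed.

Lemma prepend_left_lim (k : nat) (x : list (Q * C)) (l : list (Q * list C)) :
  root_form 10 x -> regular_form x -> root_comb k 10 l ->
  exists v, in_frakZ (S k) 10 v /\ is_Cleft_lim (comb_int (prepend x l)) v.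
Proof. apply comb_int_left_lim; lia. Qed.

Lemma in_frakZ_double (k N : nat) (x : C) : in_frakZ k N x -> in_frakZ k N (2 * x)%C.
Proof.
  intros Hx; apply (in_frakZ_ext _ _ (x + x)%C); [ring | now apply in_frakZ_plus].
Qed.

Lemma in_frakZ_opp (k N : nat) (x : C) : in_frakZ k N x -> in_frakZ k N (- x)%C.
Proof.
  intros Hx; apply (in_frakZ_ext _ _ (RtoC (Q2R (-1)) * x)%C); [rewrite Q2R_m1; ring|].
  now apply in_frakZ_scal.
Qed.

Lemma in_frakZ_minus (k N : nat) (x y : C) :
  in_frakZ k N x -> in_frakZ k N y -> in_frakZ k N (x - y)%C.
Proof. intros; apply in_frakZ_plus; [assumption | now apply in_frakZ_opp]. Qed.

(** All letters of [form_q e 1] differ from 1, so the limit of [mpath_eq] is taken directly; [mpath]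
    tends to 0, and the constant is twice a convergent value. *)
Lemma mpath_0_in_frakZ : in_frakZ 1 10 (mpath e 1 0).
Proof.
  destruct (prepend_left_lim 0 (form_q e 1) empty_word) as [v [Zv Lv]];
    [now apply root_form_q | apply regular_form_q | apply root_comb_empty_word|].
  destruct mpath_left_lim as [L _].
  apply (in_frakZ_ext _ _ (2 * v)%C); [|now apply in_frakZ_double].
  assert (E : (mpath e 1 0 + - (2) * v = 0)%C).
  { apply (is_Cleft_lim_unique (mpath e 1)); [|exact L].
    eapply is_Cleft_lim_ext; [|apply is_Cleft_lim_plus;
      [apply is_Cleft_lim_const | apply is_Cleft_lim_scal; exact Lv]].
    intros t Ht; cbv beta; rewrite (mpath_eq e 1 H t Ht); unfold int_q; ring. }
  transitivity (mpath e 1 0 - (mpath e 1 0 + - (2) * v))%C; [ring | rewrite E; ring].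
Qed.

Lemma epath_2_0_in_frakZ : in_frakZ 2 10 (epath 2 e 1 0).
Proof.
  destruct (prepend_left_lim 0 form_m empty_word) as [v1 [Z1 L1]];
    [apply root_form_m | apply regular_form_m | apply root_comb_empty_word|].
  destruct (prepend_left_lim 1 form_m (int_q e 1)) as [v2 [Z2 L2]];
    [apply root_form_m | apply regular_form_m | now apply root_int_q|].
  destruct (prepend_left_lim 1 (form_q e 1) int_1) as [v3 [Z3 L3]];
    [now apply root_form_q | apply regular_form_q | apply root_int_1|].
  assert (E : (epath 2 e 1 0 + (mpath e 1 0 * v1 + (- (2) * v2 + - (2) * v3)) = 0 + 0)%C).
  { apply (is_Cleft_lim_unique (fun t => epath 2 e 1 t + mpath e 1 t * log_int t)%C).
    - eapply is_Cleft_lim_ext; [|apply is_Cleft_lim_plus; [apply is_Cleft_lim_const|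
        apply is_Cleft_lim_plus; [apply is_Cleft_lim_scal; exact L1|
          apply is_Cleft_lim_plus; apply is_Cleft_lim_scal; [exact L2 | exact L3]]]].
      intros t Ht; cbv beta; rewrite (regularized_2 t Ht); ring.
    - apply is_Cleft_lim_plus; [apply epath_left_lim | apply mpath_left_lim]. }
  apply (in_frakZ_ext _ _ (2 * v2 + 2 * v3 - mpath e 1 0 * v1)%C).
  - transitivity (epath 2 e 1 0
      - (epath 2 e 1 0 + (mpath e 1 0 * v1 + (- (2) * v2 + - (2) * v3))))%C; [ring|].
    rewrite E; ring.
  - apply in_frakZ_minus; [apply in_frakZ_plus; now apply in_frakZ_double|].
    apply (in_frakZ_mult 1 1); [lia | apply mpath_0_in_frakZ | assumption].
Qed.

Lemma epath_3_0_in_frakZ : in_frakZ 3 10 (epath 3 e 1 0).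
Proof.
  destruct (prepend_left_lim 0 form_r empty_word) as [v1 [Z1 L1]];
    [apply root_form_r | apply regular_form_r | apply root_comb_empty_word|].
  destruct (prepend_left_lim 1 form_r (int_v 1)) as [v2 [Z2 L2]];
    [apply root_form_r | apply regular_form_r | exact (root_int_v e 1 H)|].
  destruct (prepend_left_lim 2 form_r (int_vq e 1)) as [v3 [Z3 L3]];
    [apply root_form_r | apply regular_form_r | now apply root_int_vq|].
  destruct (prepend_left_lim 1 form_m int_1) as [v4 [Z4 L4]];
    [apply root_form_m | apply regular_form_m | apply root_int_1|].
  destruct (prepend_left_lim 2 form_m int_q1) as [v5 [Z5 L5]];
    [apply root_form_m | apply regular_form_m | apply root_int_q1|].
  destruct (prepend_left_lim 2 (form_q e 1) int_11) as [v6 [Z6 L6]];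
    [now apply root_form_q | apply regular_form_q | apply root_int_11|].
  assert (E : (epath 3 e 1 0 + (epath 2 e 1 0 * v1 + (mpath e 1 0 * v2 + (- (2) * v3
    + (mpath e 1 0 * v4 + (- (2) * v5 + - (2) * v6))))) = 0 + 0 + / 2 * 0)%C).
  { apply (is_Cleft_lim_unique (fun t => epath 3 e 1 t + epath 2 e 1 t * log_int t
      + / 2 * (mpath e 1 t * (log_int t * log_int t)))%C).
    - eapply is_Cleft_lim_ext; [|apply is_Cleft_lim_plus; [apply is_Cleft_lim_const|
        apply is_Cleft_lim_plus; [apply is_Cleft_lim_scal; exact L1|
        apply is_Cleft_lim_plus; [apply is_Cleft_lim_scal; exact L2|
        apply is_Cleft_lim_plus; [apply is_Cleft_lim_scal; exact L3|
        apply is_Cleft_lim_plus; [apply is_Cleft_lim_scal; exact L4|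
        apply is_Cleft_lim_plus; apply is_Cleft_lim_scal; [exact L5 | exact L6]]]]]]].
      intros t Ht; cbv beta; rewrite (regularized_3 t Ht); ring.
    - apply is_Cleft_lim_plus; [apply is_Cleft_lim_plus; apply epath_left_lim|].
      apply is_Cleft_lim_scal, mpath_left_lim. }
  apply (in_frakZ_ext _ _ (2 * v3 + 2 * v5 + 2 * v6 - epath 2 e 1 0 * v1
    - mpath e 1 0 * v2 - mpath e 1 0 * v4)%C).
  - transitivity (epath 3 e 1 0 - (epath 3 e 1 0 + (epath 2 e 1 0 * v1 + (mpath e 1 0 * v2
      + (- (2) * v3 + (mpath e 1 0 * v4 + (- (2) * v5 + - (2) * v6)))))))%C; [ring|].
    rewrite E; ring.
  - repeat apply in_frakZ_minus.
    + repeat apply in_frakZ_plus; now apply in_frakZ_double.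
    + apply (in_frakZ_mult 2 1); [lia | apply epath_2_0_in_frakZ | assumption].
    + apply (in_frakZ_mult 1 2); [lia | apply mpath_0_in_frakZ | assumption].
    + apply (in_frakZ_mult 1 2); [lia | apply mpath_0_in_frakZ | assumption].
Qed.

End Regularization.

(** * The segment ending at y = 1, and the root exp(i pi/5) *)

Lemma regular_form_y (e : C) : (e ^ 5 = - (1))%C -> e <> (- (1))%C -> regular_form (form_y e e).
Proof.
  intros He H1; destruct (golden_root_facts e He H1) as (E1 & E2 & E3 & E4 & E5 & E6).
  now repeat constructor.
Qed.

(** Both segments start at z = 0, so they share the three constants of integration. *)
Lemma path_0 (e g : C) : ypath e g 0 = ypath e 1 0 /\ Qpath e g 0 = Qpath e 1 0.
Proof.
  assert (E : forall a : C, (a * RtoC 0 = 0)%C) by (intros a; ring).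
  unfold ypath, Qpath; now rewrite !E.
Qed.

Lemma ypath_golden_1 (e : C) : (e ^ 5 = - (1))%C -> e <> (- (1))%C -> ypath e e 1 = 1%C.
Proof.
  intros He H1; destruct (golden_root_facts e He H1) as (E1 & E2 & E3 & E4 & E5 & E6).
  assert (N1 : (1 - e ^ 3 * e * 1 <> 0)%C).
  { intros E; apply E5; transitivity (1 - (1 - e ^ 3 * e * 1))%C; [ring | rewrite E; ring]. }
  assert (N2 : (1 - - (e ^ 2) * e * 1 <> 0)%C).
  { intros E; apply E6; transitivity (1 - (1 - - (e ^ 2) * e * 1))%C; [ring | rewrite E; ring]. }
  unfold ypath; set (d1 := (1 - e ^ 3 * e * 1)%C) in *. set (d2 := (1 - - (e ^ 2) * e * 1)%C) in *.
  replace ((e ^ 2 + e ^ 3) * ((1 - e * 1) * (1 - - e * 1)))%C with (d1 * d2)%C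
    by (unfold d1, d2; ring [He]).
  field; now split.
Qed.

(** The outermost letters e, -e, e^4 and -e^3 all differ from 1, so [epath_3_eq] passes to the limit
    term by term. The end point y = 1 is interior to the disk, which makes the series continuous
    there. *)
Lemma central_1_in_frakZ (e : C) : path_data e 1 -> path_data e e -> e <> (- (1))%C ->
  in_frakZ 3 10 (central 3 1).
Proof.
  intros Pd1 Pde H1; assert (He := proj1 Pd1); assert (Hg := proj1 (proj2 Pde)).
  destruct (golden_root_facts e He H1) as (E1 & E2 & E3 & E4 & E5 & E6).
  assert (Z1 := mpath_0_in_frakZ e Pd1 H1). assert (Z2 := epath_2_0_in_frakZ e Pd1 H1).
  assert (Z3 := epath_3_0_in_frakZ e Pd1 H1).
  destruct (path_0 e e) as [Y0 Q0].
  assert (X1 : mpath e e 0 = mpath e 1 0) by (unfold mpath, epath; now rewrite Y0, Q0).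
  assert (X2 : epath 2 e e 0 = epath 2 e 1 0) by (unfold epath; now rewrite Y0).
  assert (X3 : epath 3 e e 0 = epath 3 e 1 0) by (unfold epath; now rewrite Y0).
  rewrite <- X1 in Z1; rewrite <- X2 in Z2; rewrite <- X3 in Z3.
  assert (Ry := root_form_y e e He Hg). assert (Gy := regular_form_y e He H1).
  destruct (prepend_left_lim 0 _ _ Ry Gy (root_comb_empty_word 10)) as [v1 [V1 L1]].
  destruct (prepend_left_lim 1 _ _ Ry Gy (root_int_v e e Pde)) as [v2 [V2 L2]].
  destruct (prepend_left_lim 2 _ _ Ry Gy (root_int_vq e e Pde)) as [v3 [V3 L3]].
  assert (Y1 := ypath_golden_1 e He H1).
  assert (L : is_Cleft_lim (epath 3 e e) (central 3 1)).
  { replace (central 3 1) with (epath 3 e e 1).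
    2:{ unfold epath; rewrite Y1, !Cmult_1_l; reflexivity. }
    eapply is_Cleft_lim_continuous, (is_Cderive_central 1 (ypath e e)).
    - apply is_Cderive_ypath; [assumption | |].
      + intros E; apply E5; transitivity (1 - (1 - e ^ 3 * e * 1))%C; [ring | rewrite E; ring].
      + intros E; apply E6; transitivity (1 - (1 - - (e ^ 2) * e * 1))%C; [ring | rewrite E; ring].
    - rewrite Y1, Cmult_1_l, Cmod_1; lra. }
  apply (in_frakZ_ext _ _ (epath 3 e e 0 + (epath 2 e e 0 * v1 + (mpath e e 0 * v2 + - (2) * v3)))%C).
  - apply (is_Cleft_lim_unique (epath 3 e e)); [|exact L].
    eapply is_Cleft_lim_ext; [|apply is_Cleft_lim_plus; [apply is_Cleft_lim_const|
        apply is_Cleft_lim_plus; [apply is_Cleft_lim_scal; exact L1|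
        apply is_Cleft_lim_plus; apply is_Cleft_lim_scal; [exact L2 | exact L3]]]].
    intros t Ht; cbv beta; rewrite (epath_3_eq e e Pde t Ht); ring.
  - apply in_frakZ_plus; [assumption|]. apply in_frakZ_plus; [|apply in_frakZ_plus].
    + apply (in_frakZ_mult 2 1); [lia | assumption | assumption].
    + apply (in_frakZ_mult 1 2); [lia | assumption | assumption].
    + apply (in_frakZ_ext _ _ (- (2 * v3))%C); [ring | now apply in_frakZ_opp, in_frakZ_double].
Qed.

(* [exp (i pi / 5)], whose real part is [phi / 2]. *)
Definition golden_root : C := (phi / 2, sqrt (1 - phi * phi / 4)).

Lemma golden_root_im_sqr :
  sqrt (1 - phi * phi / 4) * sqrt (1 - phi * phi / 4) = 1 - phi * phi / 4.
Proof. apply sqrt_sqrt; generalize phi_sqr phi_bounds; lra. Qed.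

(** The root satisfies z^2 - phi z + 1 = 0, so its powers are linear in it with coefficients in
    Q(phi); e^5 = -1 and the real parts of powers are read off from these forms. *)
Lemma golden_root_sqr : (golden_root ^ 2 = phi * golden_root - 1)%C.
Proof.
  generalize golden_root_im_sqr; unfold golden_root; set (s := sqrt _); intros E.
  apply C_eq; simpl; [|field].
  transitivity (phi * phi / 4 - s * s); [field | rewrite E; field].
Qed.

Lemma phi_sqr_C : (RtoC phi * RtoC phi = RtoC phi + 1)%C.
Proof. rewrite <- RtoC_mult, phi_sqr, RtoC_plus; reflexivity. Qed.

Lemma golden_root_cube : (golden_root ^ 3 = phi * golden_root - phi)%C.
Proof.
  transitivity (golden_root * golden_root ^ 2)%C; [ring|]. rewrite golden_root_sqr.
  transitivity (phi * golden_root ^ 2 - golden_root)%C; [ring|]. rewrite golden_root_sqr.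
  transitivity ((phi * phi - 1) * golden_root - phi)%C; [ring|]. rewrite phi_sqr_C; ring.
Qed.

Lemma golden_root_4 : (golden_root ^ 4 = golden_root - phi)%C.
Proof.
  transitivity (golden_root * golden_root ^ 3)%C; [ring|]. rewrite golden_root_cube.
  transitivity (phi * golden_root ^ 2 - phi * golden_root)%C; [ring|]. rewrite golden_root_sqr.
  transitivity ((phi * phi - phi) * golden_root - phi)%C; [ring|]. rewrite phi_sqr_C; ring.
Qed.

Lemma golden_root_5 : (golden_root ^ 5 = - (1))%C.
Proof.
  transitivity (golden_root * golden_root ^ 4)%C; [ring|]. rewrite golden_root_4.
  transitivity (golden_root ^ 2 - phi * golden_root)%C; [ring|]. rewrite golden_root_sqr; ring.
Qed.

Lemma golden_root_neq_m1 : golden_root <> (- (1))%C.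
Proof.
  intros E; apply (f_equal Re) in E; simpl in E. generalize phi_bounds; lra.
Qed.

(* The squared leading constant of [ypath golden_root]; its modulus is less than [4]. *)
Lemma golden_root_q_sqr : ((golden_root ^ 2 + golden_root ^ 3) ^ 2 = RtoC (- (phi + 2)))%C.
Proof.
  rewrite golden_root_sqr, golden_root_cube.
  transitivity (4 * (phi * phi) * golden_root ^ 2 - 4 * phi * (phi + 1) * golden_root
    + (phi + 1) * (phi + 1))%C; [ring|].
  rewrite golden_root_sqr, RtoC_opp, RtoC_plus.
  transitivity (4 * (phi * phi) * phi * golden_root - 4 * (phi * phi)
    - 4 * (phi * phi + phi) * golden_root + (phi * phi + 2 * phi + 1))%C; [ring|].
  assert (P3 : (phi * phi * phi = 2 * phi + 1)%C).
  { rewrite phi_sqr_C; transitivity (phi * phi + phi)%C; [ring | rewrite phi_sqr_C; ring]. }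
  transitivity (4 * (phi * phi * phi) * golden_root - 3 * (phi * phi)
    - 4 * (phi * phi + phi) * golden_root + 2 * phi + 1)%C; [ring|].
  rewrite P3, phi_sqr_C; ring.
Qed.

Lemma Cmod_one_minus_sqr (a : C) (t : R) : Cmod a = 1 ->
  Cmod (1 - a * t)%C ^ 2 = 1 - 2 * Re a * t + t ^ 2.
Proof.
  intros Ha; assert (E : Re a ^ 2 + Im a ^ 2 = 1) by (rewrite <- Cmod2_alt, Ha; ring).
  rewrite Cmod2_alt. destruct a as [x y]; simpl in *.
  transitivity (1 - 2 * x * t + t ^ 2 * (x * (x * 1) + y * (y * 1))); [ring | rewrite E; ring].
Qed.

(** As (e^2 + e^3)^2 has modulus phi + 2, the disk condition becomes an inequality between squared
    moduli, polynomial in t. *)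
Lemma Cmod_ypath_sqr_lt (g : C) (t : R) : (g ^ 10 = 1)%C -> 0 <= t < 1 ->
  (phi + 2) * Cmod ((1 - g * t) * (1 - - g * t))%C ^ 2 <
    4 * (Cmod (1 - golden_root ^ 3 * g * t)%C ^ 2 * Cmod (1 - - (golden_root ^ 2) * g * t)%C ^ 2) ->
  Cmod (ypath golden_root g t * ypath golden_root g t)%C < 4.
Proof.
  intros Hg Ht H.
  destruct (path_ok_lt_1 golden_root g t golden_root_5 Hg) as (_ & _ & N3 & N4);
    [rewrite Rabs_pos_eq; lra|].
  replace (ypath golden_root g t * ypath golden_root g t)%C with
    ((golden_root ^ 2 + golden_root ^ 3) ^ 2 * ((1 - g * t) * (1 - - g * t)) ^ 2
     / ((1 - golden_root ^ 3 * g * t) ^ 2 * (1 - - (golden_root ^ 2) * g * t) ^ 2))%C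
    by (unfold ypath; field; now split).
  assert (M3 := N3); assert (M4 := N4); apply Cmod_gt_0 in M3; apply Cmod_gt_0 in M4.
  rewrite Cmod_div by (apply Cmult_neq_0; now apply Cpow_nz).
  rewrite golden_root_q_sqr, !Cmod_mult, !Cmod_pow, Cmod_R.
  rewrite Rabs_Ropp, Rabs_pos_eq by (generalize phi_bounds; lra).
  apply Rlt_div_l; [|exact H]. apply Rmult_lt_0_compat; now apply pow_lt.
Qed.

Lemma golden_root_Re : Re golden_root = phi / 2 /\ Re (golden_root ^ 2)%C = (phi - 1) / 2 /\
  Re (golden_root ^ 3)%C = (1 - phi) / 2 /\ Re (golden_root ^ 4)%C = - phi / 2.
Proof.
  generalize phi_sqr; intros Hp.
  rewrite golden_root_sqr, golden_root_cube, golden_root_4; simpl; repeat split; lra.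
Qed.

Lemma Cmod_golden_root_pow (n : nat) : Cmod (golden_root ^ n)%C = 1.
Proof.
  rewrite Cmod_pow, (root_of_unity_Cmod golden_root 10); [apply pow1 | lia|].
  transitivity ((golden_root ^ 5) ^ 2)%C; [ring | rewrite golden_root_5; ring].
Qed.

Lemma golden_path_1 : path_data golden_root 1.
Proof.
  split; [exact golden_root_5 | split; [ring|]]; intros t Ht.
  apply Cmod_ypath_sqr_lt; [ring | assumption|].
  destruct golden_root_Re as (R1 & R2 & R3 & R4). generalize phi_sqr phi_bounds; intros Hp Hb.
  rewrite !Cmult_1_r, !Cmod_one_minus_sqr, re_opp, R2, R3 by
    (rewrite ?Cmod_opp; apply Cmod_golden_root_pow).
  replace ((1 - 1 * t) * (1 - - (1) * t))%C with (RtoC (1 - t * t))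
    by (rewrite RtoC_minus, RtoC_mult; ring).
  (* Both factors on the right are 1 + (phi - 1) t + t^2 >= 1, while the left is at most phi + 2 <
     4. *)
  rewrite Cmod_R, pow2_abs. nra.
Qed.

Lemma golden_path_2 : path_data golden_root golden_root.
Proof.
  assert (G10 : (golden_root ^ 10 = 1)%C).
  { transitivity ((golden_root ^ 5) ^ 2)%C; [ring | rewrite golden_root_5; ring]. }
  split; [exact golden_root_5 | split; [exact G10|]]; intros t Ht.
  apply Cmod_ypath_sqr_lt; [exact G10 | assumption|].
  destruct golden_root_Re as (R1 & R2 & R3 & R4). generalize phi_sqr phi_bounds; intros Hp Hb.
  replace (golden_root ^ 3 * golden_root)%C with (golden_root ^ 4)%C by ring.
  replace (- (golden_root ^ 2) * golden_root)%C with (- (golden_root ^ 3))%C by ring.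
  replace ((1 - golden_root * t) * (1 - - golden_root * t))%C
    with (1 - golden_root ^ 2 * RtoC (t * t))%C by (rewrite RtoC_mult; ring).
  rewrite !Cmod_one_minus_sqr, re_opp, R2, R3, R4 by
    (rewrite ?Cmod_opp; apply Cmod_golden_root_pow).
  (* Since phi^2 = phi + 1, the product of the two squared moduli is the fifth cyclotomic polynomial
     1 + t + t^2 + t^3 + t^4. *)
  replace ((1 - 2 * (- phi / 2) * t + t ^ 2) * (1 - 2 * (- ((1 - phi) / 2)) * t + t ^ 2))
    with (1 + t + t ^ 2 + t ^ 3 + t ^ 4 + (t ^ 2) * (phi + 1 - phi * phi)) by field.
  rewrite Hp. assert (0 <= t ^ 4) by (apply pow_le; lra). assert (0 <= t ^ 3) by (apply pow_le; lra).
  assert (0 <= t ^ 2) by (apply pow_le; lra).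
  assert (0 <= (phi - 1) * t ^ 2) by (apply Rmult_le_pos; lra).
  replace ((phi + 2) * (1 - 2 * ((phi - 1) / 2) * (t * t) + (t * t) ^ 2))
    with ((phi + 2) * (1 + t ^ 4) - (phi + 2) * ((phi - 1) * t ^ 2)) by field.
  assert (0 <= (phi + 2) * ((phi - 1) * t ^ 2)) by (apply Rmult_le_pos; lra).
  assert ((phi + 2) * (1 + t ^ 4) < 4 * (1 + t ^ 4)) by (apply Rmult_lt_compat_r; lra). lra.
Qed.

Theorem theorem2 :
  is_series lhs_term rhs_value /\ in_frakZ 3 10 (RtoC (Series lhs_term)).
Proof.
  split; [exact is_series_lhs_term|].
  apply (in_frakZ_ext _ _ (central 3 1)).
  - unfold central, CPSeries, CSeries; apply C_eq; simpl.
    + apply Series_ext; intros n; rewrite Cpow_1_l. simpl; unfold central_coef, lhs_term; ring.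
    + rewrite (Series_ext _ (fun n => 0 * 0)), Series_scal_l; [ring|].
      intros n; rewrite Cpow_1_l; simpl; ring.
  - apply (central_1_in_frakZ golden_root);
      [exact golden_path_1 | exact golden_path_2 | exact golden_root_neq_m1].
Qed.
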